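(* Assume the following conjecture (a form of the Vojta / Hall–Lang conjecture): for each $d\ge 3$ there exist constants $C_1(d),C_2(d)$ such that for every $f\in\mathbb{Z}[x]$ of degree $d$ with nonzero discriminant, if $x,y\in\mathbb{Z}$ satisfy $y^2=f(x)$, then $h(x)\le C_1(d)\,h(f)+C_2(d)$. Let $d\ge 3$ and, for $c\in\mathbb{Z}^+$, let $\phi_{(d,c)}(x)=x^d-cdx^{d-1}+c(d-1)$. Suppose that either (1) $d$ is prime, or (2) there exists a prime $q$ dividing $d-1$ such that $\gcd(d-1,v_q(d-1))=1$. Let $\mathcal{B}_d$ be the set of $c\in\mathbb{Z}^+$ such that $\phi_{(d,c)}^n(x)$ is irreducible over $\mathbb{Q}$ for all $n\ge1$ and $\gcd(c,d-1)=1$. If $c\in\mathcal{B}_d$, then $G_{\mathbb{Q}}(\phi_{(d,c)})$ has finite index in $\mathrm{Aut}(T_\infty)$. Moreover, for all but finitely many $c\in\mathcal{B}_d$, $G_{\mathbb{Q}}(\phi_{(d,c)})=\mathrm{Aut}(T_\infty)$.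
   Context: $h$ denotes the absolute logarithmic height (for a rational number $r/s$ in lowest terms, $h(r/s)=\log\max(|r|,|s|)$), and for $f\in\mathbb{Z}[x]$, $h(f)$ is the maximum of the heights of its coefficients. $v_q$ is the $q$-adic valuation. For a number field $K$ and $\varphi\in K[x]$ of degree $d\ge 2$ with all iterates $\varphi^n$ separable, the pre-image tree $T_\infty$ has vertex set $\bigsqcup_{n\ge 0}\varphi^{-n}(0)$ (with $\varphi^{-0}(0)=\{0\}$), edges joining $\beta\in\varphi^{-(n+1)}(0)$ to $\varphi(\beta)\in\varphi^{-n}(0)$; $\mathrm{Aut}(T_\infty)$ is its automorphism group, and $G_K(\varphi)$ is the image of the natural action homomorphism $\mathrm{Gal}(\overline K/K)\to\mathrm{Aut}(T_\infty)$. *)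

(* Defs.v *)
From HB Require Import structures.
From mathcomp Require Import all_boot all_order all_algebra all_field.
From mathcomp Require Import all_classical all_reals exp.
Set Implicit Arguments. Unset Strict Implicit. Unset Printing Implicit Defensive.
Import Order.TTheory GRing.Theory Num.Theory.
Local Open Scope ring_scope.

Definition hint (R : realType) (x : int) : R := ln (Num.max (`|x|%:~R) 1).

Definition hpoly (R : realType) (f : {poly int}) : R :=
  ln (Num.max ((\max_(i < size f) absz (f`_i)%R)%N%:R) 1).

(* discriminant of f of degree n = size f - 1:
   disc f = (-1)^(n(n-1)/2) Res(f, f') / lead_coef f  (exact division in Z) *)
Definition disc (f : {poly int}) : int :=
  let n := (size f).-1 in
  (((-1) ^+ (n * n.-1)./2 * resultant f f^`()) %/ lead_coef f)%Z.

Definition vojta_conjecture (R : realType) : Prop :=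
  forall d : nat, (3 <= d)%N ->
  exists C1 C2 : R,
    forall f : {poly int}, size f = d.+1 -> disc f != 0 ->
    forall x y : int, y ^+ 2 = f.[x] ->
      hint R x <= C1 * hpoly R f + C2.

Definition phi_dc (d c : nat) : {poly int} :=
  'X^d - ((c * d)%:R) *: 'X^(d.-1) + ((c * d.-1)%:R)%:P.

Definition iter_poly (R : nzRingType) (n : nat) (f : {poly R}) : {poly R} :=
  iter n (fun g => g \Po f) 'X.

Definition in_Bd (d c : nat) : Prop :=
  (0 < c)%N /\
  (forall n : nat, (1 <= n)%N ->
     irreducible_poly (map_poly (intr : int -> rat) (iter_poly n (phi_dc d c)))) /\
  coprime c d.-1.

Section Tree.
Variable phi : {poly algC}.

Definition vertex := {v : nat * algC | root (iter_poly v.1 phi) v.2}.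

Definition level (v : vertex) : nat := (sval v).1.
Definition pt (v : vertex) : algC := (sval v).2.

Definition tedge (v w : vertex) : Prop :=
  level w = (level v).+1 /\ pt v = phi.[pt w].

Definition tree_aut (s : vertex -> vertex) : Prop :=
  bijective s /\ (forall v, level (s v) = level v) /\
  (forall v w, tedge v w <-> tedge (s v) (s w)).

(* the image of Gal(Qbar/Q) in Aut(T_oo): automorphisms induced by a field
   automorphism of Qbar = algC (which automatically fixes Q) *)
Definition galois_image (s : vertex -> vertex) : Prop :=
  exists sigma : {rmorphism algC -> algC}, bijective sigma /\
    forall v, pt (s v) = sigma (pt v).

Definition finite_index_in_aut : Prop :=
  exists ts : seq (vertex -> vertex),
    (forall t, t \in ts -> tree_aut t) /\
    forall a, tree_aut a ->
      exists2 t, t \in ts &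
        exists g, tree_aut g /\ galois_image g /\ forall v, a v = t (g v).

Definition galois_image_full : Prop :=
  forall a, tree_aut a -> galois_image a.
End Tree.

Definition phiC (d c : nat) : {poly algC} := map_poly intr (phi_dc d c).

(* Main.v *)
Require Import Defs.
From HB Require Import structures.
From mathcomp Require Import all_boot all_order all_algebra all_field.
From mathcomp Require Import all_classical all_reals exp.
From mathcomp Require Import ring lra zify.
Import Order.TTheory GRing.Theory Num.Theory.
Local Open Scope ring_scope.
Set Implicit Arguments. Unset Strict Implicit. Unset Printing Implicit Defensive.

(*
   phi = phi_(d,c) has the critical points 0 and gamma = c(d-1), and phi(0) = gamma, so
   everything is governed by the critical orbit a_n = phi^n(0). Fix an extension to the
   algebraic numbers of the p-adic valuation. If p does not divide d, nor a_1, ..., a_n, but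
   divides a_(n+1) = phi^n(gamma) to an odd power, then exactly two zeros of phi^n meet above
   p, they have the same image under phi, and inertia contains an automorphism exchanging
   them and fixing all other zeros of phi^n. By irreducibility of phi^n such transpositions
   exist in every fibre of level n. They generate the full symmetric group of a fibre when d
   is prime; in the other case the prime q | d-1 gives phi the Newton polygon of a simple
   root and d-1 totally ramified ones, so the stabiliser of one point of a fibre is
   transitive on the d-1 others, and again a transposition generates everything. Thus such a
   prime p for level n makes the Galois group as large as possible there.

   If no p exists, a_(n+1) is, up to a square, a divisor of a product of primes dividing d or
   an earlier a_j; periodicity modulo p confines these j to j <= (n+1)/2. Then
   D z^2 = a_(n+1) = phi(a_n) with D small, and the conjectured bound on integral points
   contradicts the growth of a_n for n large, uniformly in c. For fixed n, a_(n+1) is a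
   separable polynomial in c; when d^n >= 4 its part prime to a_1, ..., a_n has degree at
   least 3, and the conjecture applied to that part excludes all but finitely many c. The
   remaining case d = 3, n = 1 is read off the discriminant of a cubic.
*)

(** * Rational-valued valuations *)

(** The odd power matters because phi is quadratic at gamma: if b is a zero of phi^n near gamma,
    then phi(gamma) - phi(b) is a unit times (gamma - b)^2 and has the value of a_(n+1), so gamma -
    b has half an odd integer as its value. Trivial inertia would make all values integral. This is
    proved without ideals or completions: v is a rational-valued function on the algebraic numbers
    with v(p) = 1, rational numbers have integral values, and traces to the rationals, weighted so
    that unwanted conjugates vanish or become negligible, carry this integrality over to the field.
    The same device shows that elements fixed by the decomposition group have integral values, which
    yields the transitivity at q. Irreducibility gives transitivity on each level and separability,
    and it excludes c = 1. The growth |a_(n+1)| >= |a_n|^2 is what separates a_n from the product of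
    the a_j with j <= (n+1)/2. If all levels beyond n0 are full, cosets are told apart by their
    action on level n0, which gives finite index. *)

Definition vge (K : fieldType) (v : K -> rat) (r : rat) (x : K) : bool :=
  (x == 0) || (r <= v x).

(** [v 0] carries no information, so the axioms avoid 0 and [vge] counts 0 as infinitely
    divisible. *)
Record is_val (K : fieldType) (p : nat) (v : K -> rat) : Prop := IsVal {
  valM : forall x y, x != 0 -> y != 0 -> v (x * y) = v x + v y;
  valD : forall x y, x != 0 -> y != 0 -> x + y != 0 ->
    Num.min (v x) (v y) <= v (x + y);
  valp_neq0 : p%:R != 0 :> K;
  valp : v p%:R = 1 }.

Section ValTheory.
Variables (K : fieldType) (p : nat) (v : K -> rat).
Hypothesis Hv : is_val p v.

Lemma val1 : v 1 = 0.
Proof. by have := valM Hv (oner_neq0 K) (oner_neq0 K); rewrite mulr1; lra. Qed.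

Lemma valX x n : x != 0 -> v (x ^+ n) = n%:R * v x.
Proof.
move=> x0; elim: n => [|n IH]; first by rewrite expr0 val1 mul0r.
by rewrite exprS (valM Hv) ?expf_neq0 // IH -nat1r mulrDl mul1r.
Qed.

Lemma valV x : x != 0 -> v x^-1 = - v x.
Proof.
move=> x0; have := valM Hv x0 (invr_neq0 x0).
by rewrite divff // val1; lra.
Qed.

Lemma valN1 : v (-1) = 0.
Proof.
have n0 : (-1 : K) != 0 by rewrite oppr_eq0 oner_neq0.
by have := valM Hv n0 n0; rewrite mulrNN mulr1 val1; lra.
Qed.

Lemma valN x : v (- x) = v x.
Proof.
have [->|x0] := eqVneq x 0; first by rewrite oppr0.
by rewrite -mulN1r (valM Hv) // ?valN1 ?add0r // oppr_eq0 oner_neq0.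
Qed.

Lemma val_prod (I : Type) (s : seq I) (P : pred I) (F : I -> K) :
  (forall i, P i -> F i != 0) ->
  v (\prod_(i <- s | P i) F i) = \sum_(i <- s | P i) v (F i).
Proof.
move=> F0; suff [] : v (\prod_(i <- s | P i) F i) = \sum_(i <- s | P i) v (F i)
  /\ \prod_(i <- s | P i) F i != 0 by [].
elim: s => [|i s [IH1 IH2]]; first by rewrite !big_nil val1 oner_neq0.
rewrite !big_cons; case: ifP => // Pi; rewrite (valM Hv) ?F0 // IH1.
by rewrite mulf_neq0 ?F0.
Qed.

Lemma vge0 r : vge v r 0. Proof. by rewrite /vge eqxx. Qed.

Lemma vge_le r s x : s <= r -> vge v r x -> vge v s x.
Proof. by move=> sr /orP[/eqP->|h]; rewrite /vge ?eqxx // (le_trans sr h) orbT. Qed.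

Lemma vgeN r x : vge v r (- x) = vge v r x.
Proof. by rewrite /vge oppr_eq0 valN. Qed.

Lemma vgeD r x y : vge v r x -> vge v r y -> vge v r (x + y).
Proof.
rewrite /vge; have [->|x0] := eqVneq x 0; first by rewrite add0r.
have [->|y0 /= rx ry] := eqVneq y 0; first by rewrite addr0 (negPf x0).
have [->|xy0] //= := eqVneq (x + y) 0.
by apply: le_trans (valD Hv x0 y0 xy0); rewrite le_min rx.
Qed.

Lemma vgeB r x y : vge v r x -> vge v r y -> vge v r (x - y).
Proof. by move=> hx hy; apply: vgeD; rewrite ?vgeN. Qed.

Lemma vgeM r s x y : vge v r x -> vge v s y -> vge v (r + s) (x * y).
Proof.
rewrite /vge mulf_eq0; have [->|x0] //= := eqVneq x 0.
have [->|y0 /= rx ry] //= := eqVneq y 0.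
by rewrite (valM Hv) // lerD.
Qed.

Lemma vge_mul0 r x y : vge v 0 x -> vge v r y -> vge v r (x * y).
Proof. by move=> hx hy; have := vgeM hx hy; rewrite add0r. Qed.

Lemma vge_sum r (I : Type) (s : seq I) (P : pred I) (F : I -> K) :
  (forall i, P i -> vge v r (F i)) -> vge v r (\sum_(i <- s | P i) F i).
Proof.
move=> hF; elim/big_ind: _ => //; [exact: vge0 | move=> x y; exact: vgeD].
Qed.

Lemma vge1 : vge v 0 1. Proof. by rewrite /vge val1 lexx orbT. Qed.

Lemma vge_prod (I : Type) (s : seq I) (P : pred I) (F : I -> K) :
  (forall i, P i -> vge v 0 (F i)) -> vge v 0 (\prod_(i <- s | P i) F i).
Proof.
move=> hF; elim/big_ind: _ => //; [exact: vge1 | move=> x y; exact: vge_mul0].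
Qed.

Lemma vgeX x n : vge v 0 x -> vge v 0 (x ^+ n).
Proof.
by move=> hx; elim: n => [|n IH]; rewrite ?expr0 ?vge1 // exprS vge_mul0.
Qed.

Lemma vge_nat n : vge v 0 n%:R.
Proof.
elim: n => [|n IH]; first exact: vge0.
by rewrite -natr1 vgeD // vge1.
Qed.

Lemma vge_int (n : int) : vge v 0 n%:~R.
Proof. by case: n => n; rewrite ?NegzE ?mulrNz ?vgeN; apply: vge_nat. Qed.

Lemma vge_neq0 r x : x != 0 -> vge v r x = (r <= v x).
Proof. by rewrite /vge => /negPf->. Qed.

(** Equality case of the ultrametric inequality. That the sum is nonzero belongs to the conclusion
    because the value at 0 is arbitrary. *)
Lemma val_dom r x y : x != 0 -> v x < r -> vge v r y ->
  (x + y != 0) /\ v (x + y) = v x.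
Proof.
move=> x0 xr hy.
have xy0 : x + y != 0.
  apply/eqP=> /(canRL (addrK y)); rewrite sub0r => xE.
  by move: hy; rewrite -vgeN -xE vge_neq0 // leNgt xr.
split=> //; apply/eqP; rewrite eq_le; apply/andP; split; last first.
  have hy' : vge v (v x) y by apply: vge_le hy; apply: ltW.
  have hx : vge v (v x) x by rewrite vge_neq0.
  by have := vgeD hx hy'; rewrite vge_neq0.
rewrite leNgt; apply/negP=> lt1.
have : vge v (Num.min r (v (x + y))) (x + y - y).
  by apply: vgeB; [rewrite vge_neq0 // ge_min lexx orbT |
    apply: vge_le hy; rewrite ge_min lexx].
by rewrite addrK vge_neq0 // leNgt lt_min xr lt1.
Qed.

End ValTheory.

Lemma is_val_comp (K L : fieldType) (p : nat) (v : L -> rat) (f : {rmorphism K -> L}) :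
  is_val p v -> is_val p (v \o f).
Proof.
move=> Hv; split=> [x y x0 y0|x y x0 y0 xy0||] /=.
- by rewrite rmorphM (valM Hv) ?fmorph_eq0.
- by rewrite rmorphD (valD Hv) ?fmorph_eq0 // -rmorphD fmorph_eq0.
- by have := valp_neq0 Hv; rewrite -(rmorph_nat f) fmorph_eq0.
- by rewrite rmorph_nat (valp Hv).
Qed.

(** * Extending the p-adic valuation to the algebraic numbers *)

Section ValuationRing.
Local Open Scope classical_set_scope.
Local Open Scope ring_scope.
Variables (K : fieldType) (p : nat).
Local Notation pK := (p%:R : K).
Hypothesis p0 : pK != 0.

(** A maximal subring without 1/p is a valuation ring ([O_total]): Chevalley's extension theorem in
    a form that needs no prime ideals. *)
Definition avoiding_subring (A : set K) : Prop :=
  [/\ A 1, (forall x y, A x -> A y -> A (x - y)),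
      (forall x y, A x -> A y -> A (x * y)) & ~ A pK^-1].

Lemma maximal_avoiding_subring : avoiding_subring (range (intr : int -> K)) ->
  exists O : set K, avoiding_subring O /\
    forall B, avoiding_subring B -> O `<=` B -> B `<=` O.
Proof.
move=> goodZ.
have [|A [[A0|gA] maxA]] :=
  @Zorn_bigcup K [set A | A = set0 \/ avoiding_subring A].
- move=> F FP Ftot.
  have [[X0 FX0 gX0]|noX] := pselect (exists2 X, F X & avoiding_subring X).
    right; split.
    + by exists X0 => //; case: gX0.
    + move=> x y [X FX Xx] [Y FY Yy].
      have [gX|] := FP _ FX; first by move: Xx; rewrite gX.
      have [gY|] := FP _ FY; first by move: Yy; rewrite gY.
      move=> [_ By _ _] [_ Bx _ _].
      have [sub|sub] := Ftot _ _ FX FY.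
        by exists Y => //; apply: By => //; apply: sub.
      by exists X => //; apply: Bx => //; apply: sub.
    + move=> x y [X FX Xx] [Y FY Yy].
      have [gX|] := FP _ FX; first by move: Xx; rewrite gX.
      have [gY|] := FP _ FY; first by move: Yy; rewrite gY.
      move=> [_ _ By _] [_ _ Bx _].
      have [sub|sub] := Ftot _ _ FX FY.
        by exists Y => //; apply: By => //; apply: sub.
      by exists X => //; apply: Bx => //; apply: sub.
    + move=> [X FX Xp]; have [gX|[_ _ _]] := FP _ FX; last exact.
      by move: Xp; rewrite gX.
  left; apply/seteqP; split=> // x [X FX Xx].
  have [gX|gX] := FP _ FX; first by move: Xx; rewrite gX.
  by case: noX; exists X.
- exfalso; apply: (maxA (range (intr : int -> K))); last by right.
  by rewrite A0; split=> // /(_ 1); apply; exists 1.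
- exists A; split=> // B gB AB x Bx; apply: contrapT => nAx.
  by apply: (maxA B); [split=> // /(_ x Bx) | right].
Qed.

Variable O : set K.
Hypothesis gO : avoiding_subring O.
Hypothesis maxO : forall B, avoiding_subring B -> O `<=` B -> B `<=` O.

Lemma O_one : O 1. Proof. by case: gO. Qed.
Lemma OB x y : O x -> O y -> O (x - y). Proof. by case: gO => _ + _ _; apply. Qed.
Lemma O_mul x y : O x -> O y -> O (x * y). Proof. by case: gO => _ _ + _; apply. Qed.
Lemma O_zero : O 0. Proof. by rewrite -(subrr 1); apply: OB; apply: O_one. Qed.
Lemma ON x : O x -> O (- x). Proof. by rewrite -sub0r; apply: OB; apply: O_zero. Qed.
Lemma O_add x y : O x -> O y -> O (x + y).
Proof. by move=> Ox Oy; rewrite -(opprK y); apply/OB/ON. Qed.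
Lemma Onat n : O n%:R.
Proof. by elim: n => [|n IH]; [apply: O_zero | rewrite -natr1; apply/O_add/O_one]. Qed.
Lemma OX x n : O x -> O (x ^+ n).
Proof. by move=> Ox; elim: n => [|n IH]; [apply: O_one | rewrite exprS; apply: O_mul]. Qed.
Lemma Osum (I : Type) (s : seq I) (P : pred I) (F : I -> K) :
  (forall i, P i -> O (F i)) -> O (\sum_(i <- s | P i) F i).
Proof. by move=> hF; elim/big_ind: _ => //; [exact: O_zero | exact: O_add]. Qed.

Lemma notOp : ~ O pK^-1. Proof. by case: gO. Qed.

Lemma one_addp_neq0 a : O a -> 1 + pK * a != 0.
Proof.
move=> Oa; apply/eqP=> /(canRL (addKr 1)); rewrite addr0 => paE.
apply: notOp; suff -> : pK^-1 = - a by apply: ON.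
by apply: (mulfI p0); rewrite mulrN paE opprK divff.
Qed.

(* Localising O at 1 + pO does not make p invertible, so maximality of O forces 1 + pO to consist of units. *)
Lemma one_addp_unit a : O a -> O (1 + pK * a)^-1.
Proof.
move=> Oa; pose B := [set x | exists2 b, O b & O (x * (1 + pK * b))].
apply: (maxO (B := B)).
- split.
  + by exists 0; [apply: O_zero | rewrite mulr0 addr0 mulr1; apply: O_one].
  + move=> x y [b Ob Ox] [c Oc Oy]; exists (b + c + pK * b * c).
      by apply: O_add; [apply: O_add | do 2?apply: O_mul; rewrite //; apply: Onat].
    have -> : (x - y) * (1 + pK * (b + c + pK * b * c)) =
      x * (1 + pK * b) * (1 + pK * c) - y * (1 + pK * c) * (1 + pK * b) by ring.
    have O1p e : O e -> O (1 + pK * e).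
      by move=> Oe; apply: O_add; [apply: O_one | apply: O_mul => //; apply: Onat].
    by apply: OB; apply: O_mul => //; apply: O1p.
  + move=> x y [b Ob Ox] [c Oc Oy]; exists (b + c + pK * b * c).
      by apply: O_add; [apply: O_add | do 2?apply: O_mul; rewrite //; apply: Onat].
    have -> : (x * y) * (1 + pK * (b + c + pK * b * c)) =
      (x * (1 + pK * b)) * (y * (1 + pK * c)) by ring.
    by apply: O_mul.
  + move=> [b Ob]; rewrite mulrDr mulr1 mulKf // => Opb.
    by apply: notOp; rewrite -(addrK b pK^-1); apply: OB.
- by move=> x Ox; exists 0; [apply: O_zero | rewrite mulr0 addr0 mulr1].
- by exists a => //; rewrite mulVf ?one_addp_neq0 //; apply: O_one.
Qed.

Definition Opoly (P : {poly K}) := forall i, O P`_i.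

Lemma OpolyB P Q : Opoly P -> Opoly Q -> Opoly (P - Q).
Proof. by move=> OP OQ i; rewrite coefB; apply: OB. Qed.

Lemma OpolyM P Q : Opoly P -> Opoly Q -> Opoly (P * Q).
Proof. by move=> OP OQ i; rewrite coefM; apply: Osum => j _; apply: O_mul. Qed.

Lemma Opoly1 : Opoly 1.
Proof. by move=> i; rewrite coef1; case: eqP => _; [apply: O_one | apply: O_zero]. Qed.

(** The ring O[y] is strictly larger than O, so by maximality it contains 1/p. *)
Lemma adjoin_p_inv y : ~ O y -> exists2 P, Opoly P & 1 = pK * P.[y].
Proof.
move=> nOy; pose B := [set x | exists2 P, Opoly P & x = P.[y]].
have [[P OP PE]|nB] := pselect (B pK^-1).
  by exists P => //; rewrite -PE divff.
case: nOy; apply: (maxO (B := B)).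
- split=> //.
  + by exists 1; [apply: Opoly1 | rewrite hornerE].
  + by move=> x z [P OP ->] [Q OQ ->]; exists (P - Q); [apply: OpolyB|rewrite !hornerE].
  + by move=> x z [P OP ->] [Q OQ ->]; exists (P * Q); [apply: OpolyM|rewrite !hornerE].
- move=> x Ox; exists x%:P; last by rewrite hornerE.
  by move=> i; rewrite coefC; case: eqP => _ //; apply: O_zero.
- exists 'X; last by rewrite hornerE.
  by move=> i; rewrite coefX; case: eqP => _; [apply: O_one | apply: O_zero].
Qed.

(** Chevalley's descent on the total size of the two relations: the shorter one, in 1/y, rewrites
    the top power of y in the other as p times lower powers. *)
Lemma adjoin_no_both N y P Q : y != 0 -> Opoly P -> Opoly Q ->
  1 = pK * P.[y] -> 1 = pK * Q.[y^-1] -> (size P + size Q <= N)%N -> False.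
Proof.
elim: N y P Q => [|N IH] y P Q y0 OP OQ PE QE sz.
  move: sz; rewrite leqn0 addn_eq0 size_poly_eq0 => /andP[/eqP P0 _].
  by move: PE; rewrite P0 hornerE mulr0 => /eqP; rewrite oner_eq0.
wlog szPQ : y P Q y0 OP OQ PE QE sz / (size Q <= size P)%N.
  move=> W; have [|/ltnW le] := leqP (size Q) (size P); first exact: (W y P Q).
  apply: (W y^-1 Q P); rewrite ?invrK ?invr_neq0 //.
  by rewrite addnC.
have Q0 : Q != 0.
  by apply: contra_eqN QE => /eqP->; rewrite hornerE mulr0 oner_eq0.
have [n szP] : exists n, size P = n.+1.
  move: szPQ; case: (size P) => [|n]; last by exists n.
  by rewrite leqn0 size_poly_eq0 (negPf Q0).
pose u := 1 - pK * Q`_0; have uE : u = 1 + pK * - Q`_0 by rewrite /u; ring.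
have Ou : O u^-1 by rewrite uE; apply: one_addp_unit; apply: ON.
have u0 : u != 0 by rewrite uE one_addp_neq0 //; apply: ON.
(* Multiplying the relation for 1/y by y^n / u, with the unit u = 1 - p Q_0, turns it into y^n = p
   T(y) with T of degree below n. *)
pose T := \sum_(1 <= j < size Q) (u^-1 * Q`_j) *: 'X^(n - j).
have OT : Opoly T.
  move=> i; rewrite /T coef_sum; apply: Osum => j _; rewrite coefZ coefXn.
  by apply: O_mul; [apply: O_mul | case: eqP => _; [apply: O_one | apply: O_zero]].
have TE : pK * T.[y] = y ^+ n.
  rewrite /T horner_sum.
  have -> : \sum_(1 <= j < size Q) ((u^-1 * Q`_j) *: 'X^(n - j)).[y] =
     u^-1 * y ^+ n * \sum_(1 <= j < size Q) Q`_j * y^-1 ^+ j.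
    rewrite big_distrr /= !big_nat; apply: eq_bigr => j /andP[j1 jQ].
    rewrite hornerZ hornerXn.
    have -> : y^-1 ^+ j = y ^- j by rewrite exprVn.
    have jn : (j <= n)%N by rewrite -ltnS -szP (leq_trans jQ).
    have -> : y ^+ (n - j) = y ^+ n * y ^- j.
      by rewrite -{2}(subnK jn) exprD mulfK ?expf_neq0.
    by move: u^-1 (y ^- j) (y ^+ n) => ? ? ?; ring.
  have : \sum_(1 <= j < size Q) Q`_j * y^-1 ^+ j = Q.[y^-1] - Q`_0.
    rewrite horner_coef -(big_mkord xpredT (fun j => Q`_j * y^-1 ^+ j)).
    rewrite big_ltn ?size_poly_gt0 // expr0 mulr1; ring.
  move=> ->; have -> : pK * (u^-1 * y ^+ n * (Q.[y^-1] - Q`_0)) =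
     u^-1 * y ^+ n * (pK * Q.[y^-1] - pK * Q`_0) by ring.
  by rewrite -QE -/u mulrAC mulVf // mul1r.
pose P' := P - P`_n *: 'X^n + (pK * P`_n) *: T.
have szP' : (size P' <= n)%N.
  apply/leq_sizeP => i ni; rewrite /P' coefD coefB !coefZ coefXn.
  have -> : T`_i = 0.
    rewrite /T coef_sum big_nat big1 // => j /andP[j1 jQ].
    rewrite coefZ coefXn; case: eqP => [iE|]; rewrite ?mulr0 //.
    by move: jQ szPQ; rewrite szP; lia.
  have [->|inn] := eqVneq i n; first by rewrite mulr1 subrr mulr0 addr0.
  by rewrite nth_default ?mulr0 ?subr0 ?addr0 // szP; lia.
apply: (IH y P' Q) => //.
- apply: (_ : Opoly (P - _ + _)); move=> i; apply: (_ : O _).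
  rewrite coefD coefB !coefZ coefXn; apply: O_add.
    by apply: OB => //; apply: O_mul => //; case: eqP => _; [apply: O_one | apply: O_zero].
  by apply: O_mul => //; apply: O_mul => //; apply: Onat.
- rewrite /P' !hornerE -mulrA [P`_n * T.[y]]mulrC mulrA TE [y ^+ n * _]mulrC subrK.
  exact: PE.
- by move: sz szP'; rewrite szP; lia.
Qed.

Lemma O_total y : y != 0 -> O y \/ O y^-1.
Proof.
move=> y0; have [|nO] := pselect (O y); first by left.
have [|nOV] := pselect (O y^-1); first by right.
have [P OP PE] := adjoin_p_inv nO; have [Q OQ QE] := adjoin_p_inv nOV.
by case: (@adjoin_no_both (size P + size Q) y P Q).
Qed.
End ValuationRing.

Lemma exists_max (T : eqType) (R : T -> T -> Prop) (s : seq T) :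
  (forall x, R x x) -> (forall x y z, R x y -> R y z -> R x z) ->
  (forall x y, x \in s -> y \in s -> R x y \/ R y x) -> s != [::] ->
  exists2 x, x \in s & forall y, y \in s -> R y x.
Proof.
move=> Rxx Rtr; elim: s => // x s IH tot _.
have [->|s0] := eqVneq s [::].
  by exists x; rewrite ?mem_head // => y; rewrite inE => /eqP->.
have [|//|z zs zmax] := IH.
  by move=> y z ys zs; apply: tot; rewrite inE ?ys ?zs orbT.
have zxs : z \in x :: s by rewrite inE zs orbT.
have [Rxz|Rzx] := tot x z (mem_head _ _) zxs.
  by exists z => // y; rewrite inE => /predU1P[->|/zmax].
exists x; rewrite ?mem_head // => y; rewrite inE => /predU1P[->//|/zmax Ryz].
exact: Rtr Ryz Rzx.
Qed.

Section ValuationOfRing.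
Local Open Scope classical_set_scope.
Local Open Scope ring_scope.
Variables (p : nat) (O : set algC).
Hypothesis pp : prime p.
Local Notation pK := (p%:R : algC).
Hypothesis gO : avoiding_subring p O.
Hypothesis maxO : forall B, avoiding_subring p B -> O `<=` B -> B `<=` O.

Let p0 : pK != 0. Proof. by rewrite pnatr_eq0 -lt0n prime_gt0. Qed.
Let OM := O_mul gO.
Let OD := O_add gO.
Let O1 := O_one gO.
Let O0 := O_zero gO.
Let Otot := O_total p0 gO maxO.

Definition Ounit (x : algC) := [/\ x != 0, O x & O x^-1].

Lemma Ounit1 : Ounit 1.
Proof. by split; rewrite ?invr1 ?oner_eq0 //. Qed.

Lemma OunitM x y : Ounit x -> Ounit y -> Ounit (x * y).
Proof.
by move=> [x0 Ox OVx] [y0 Oy OVy]; split; rewrite ?mulf_neq0 ?invfM //; apply: OM.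
Qed.

Lemma OunitV x : Ounit x -> Ounit x^-1.
Proof. by move=> [x0 Ox OVx]; split; rewrite ?invr_neq0 ?invrK. Qed.

Lemma OunitX x n : Ounit x -> Ounit (x ^+ n).
Proof.
move=> Ux; elim: n => [|n IH]; first exact: Ounit1.
by rewrite exprS; apply: OunitM.
Qed.

Lemma Ounit_exp x n : (0 < n)%N -> x != 0 -> Ounit (x ^+ n) -> Ounit x.
Proof.
case: n => // n _ x0 [_ Ox OVx]; have [h|h] := Otot x0; split=> //.
  have -> : x^-1 = (x ^+ n.+1)^-1 * x ^+ n.
    by rewrite exprS invfM -mulrA mulVf ?expf_neq0 ?mulr1.
  by apply: OM => //; exact: (OX gO).
have -> : x = x ^+ n.+1 * (x^-1) ^+ n.
  by rewrite exprS -mulrA -exprMn divff // expr1n mulr1.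
by apply: OM => //; exact: (OX gO).
Qed.

Lemma Ounit_pz (n : int) : Ounit (pK ^ n) -> n = 0.
Proof.
have aux m : ~ Ounit (pK ^+ m.+1).
  by move/(Ounit_exp (ltn0Sn m) p0) => [_ _]; exact: (notOp gO).
case: n => [[|n]|n] //; first by move/(aux n).
by move/OunitV; rewrite NegzE -exprnN invrK => /(aux n).
Qed.

Lemma Ounit_coprime n : coprime n p -> Ounit n%:R.
Proof.
move=> cnp; have n0 : (0 < n)%N.
  by case: n cnp => //; rewrite /coprime gcd0n; move: (prime_gt1 pp); case: p => [|[]].
have nK0 : n%:R != 0 :> algC by rewrite pnatr_eq0 -lt0n.
split=> //; first exact: (Onat gO).
case: (egcdnP p n0) => u w uE _; move: uE; rewrite (eqP cnp) => uE.
have /(congr1 (fun m => m%:R : algC)) := uE; rewrite natrM natrD natrM => uE'.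
have Ow : O w%:R by exact: (Onat gO).
have n1 := one_addp_neq0 p0 gO Ow.
have -> : n%:R^-1 = u%:R * (1 + pK * w%:R)^-1.
  apply: (mulfI nK0); rewrite divff // mulrA [_ * u%:R]mulrC uE'.
  by rewrite [1 + _]addrC [pK * _]mulrC divff // addrC [_ * pK]mulrC.
by apply: OM; [exact: (Onat gO) | apply: (one_addp_unit p0 gO maxO Ow)].
Qed.

(** The pair (N, k) records that x^N p^k is a unit, that is v(x) = -k/N. *)
Definition val_rel (x : algC) (Nk : nat * int) :=
  (0 < Nk.1)%N /\ Ounit (x ^+ Nk.1 * pK ^ Nk.2).

Lemma Ounit_nat n : (0 < n)%N -> exists k : int, Ounit (n%:R * pK ^ k).
Proof.
move=> n0; exists (- (logn p n)%:Z).
have /(congr1 (fun m => m%:R : algC)) := esym (partnC p n0).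
rewrite natrM p_part natrX => ->.
rewrite -mulrA mulrC -mulrA -exprnN mulVf ?expf_neq0 // mulr1.
apply: Ounit_coprime; rewrite coprime_sym prime_coprime // -p'natE //.
exact: part_pnat.
Qed.

Lemma Ounit_rat (a : rat) : a != 0 -> exists k : int, Ounit (ratr a * pK ^ k).
Proof.
move=> a0; rewrite /ratr; have := numq_eq0 a; rewrite (negPf a0).
have [d dE] : exists d : nat, denq a = d by exists `|denq a|%N; rewrite gez0_abs.
have d0 : (0 < d)%N by rewrite -ltz_nat -dE.
have [k Uk] := Ounit_nat d0.
rewrite dE -pmulrn => nq0.
have n0 : (0 < `|numq a|)%N by rewrite absz_gt0 nq0.
have [l Ul] := Ounit_nat n0; exists (l - k).
have Ul' : Ounit ((numq a)%:~R * pK ^ l).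
  case: (intP (numq a)) Ul n0 => [|n|n] //=; rewrite mulrNz mulNr => -[x0 Ox OVx] _.
  by split; rewrite ?oppr_eq0 ?invrN //; exact: (ON gO).
have := OunitM Ul' (OunitV Uk).
by rewrite invfM -!mulrA [pK ^ l * _]mulrCA invr_expz -expfzDr.
Qed.

(** Being 0 or having an inverse outside O describes the maximal ideal of O. If z/t is in O, then z
    + t is t times an element of O, so an inverse of z + t in O would put 1/t in O. *)
Lemma nonunitD x y : (x = 0 \/ ~ O x^-1) -> (y = 0 \/ ~ O y^-1) ->
  (x + y = 0 \/ ~ O (x + y)^-1).
Proof.
have aux z t : z != 0 -> t != 0 -> O (z / t) -> ~ O t^-1 ->
    z + t = 0 \/ ~ O (z + t)^-1.
  move=> z0 t0 Ozt nOt; have [|s0] := eqVneq (z + t) 0; [by left | right].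
  move=> Os; apply: nOt.
  have -> : t^-1 = (1 + z / t) * (z + t)^-1.
    have -> : 1 + z / t = (z + t) / t by rewrite mulrDl divff // addrC.
    by rewrite mulrAC divff // mul1r.
  by apply: OM => //; apply: OD.
move=> [->|nx]; first by rewrite add0r.
move=> [->|ny]; first by rewrite addr0; right.
have [x0|x0] := eqVneq x 0; first by rewrite x0 add0r; right.
have [y0|y0] := eqVneq y 0; first by rewrite y0 addr0; right.
have xy0 : x / y != 0 by rewrite mulf_neq0 ?invr_neq0.
have [h|] := Otot xy0; first exact: aux.
by rewrite invf_div addrC => h; apply: aux.
Qed.

(** The least value in a vanishing sum is attained twice: after division by a term F k of least
    value, the other quotients would otherwise all lie in the maximal ideal, yet they add up to
    -1. *)
Lemma zero_sum_unit_ratio n (F : 'I_n -> algC) : \sum_i F i = 0 ->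
  (exists i, F i != 0) ->
  exists i j, [/\ i != j, F i != 0, F j != 0 & Ounit (F i / F j)].
Proof.
move=> sF [i0 Fi0]; pose s := [seq i <- enum 'I_n | F i != 0].
have [||||k] := @exists_max _ (fun i j => F i = 0 \/ F j != 0 /\ O (F i / F j)) s.
- by move=> i; have [->|Fi] := eqVneq (F i) 0; [left | right; rewrite divff].
- move=> i j k [->|[Fj Oij]]; [by left | case=> [Fj0|[Fk Ojk]]].
    by move: Fj; rewrite Fj0 eqxx.
  right; split=> //; have -> : F i / F k = (F i / F j) * (F j / F k).
    by rewrite mulrA divfK.
  exact: OM.
- move=> i j; rewrite !mem_filter => /andP[Fi _] /andP[Fj _].
  have ij0 : F i / F j != 0 by rewrite mulf_neq0 ?invr_neq0.
  have [h|] := Otot ij0; first by left; right.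
  by rewrite invf_div; right; right.
- by rewrite -has_filter; apply/hasP; exists i0; rewrite ?mem_enum.
rewrite mem_filter => /andP[Fk _] kmax.
apply: contrapT => noij.
have : (\sum_(i | i != k) F i / F k = 0 \/ ~ O (\sum_(i | i != k) F i / F k)^-1).
  elim/big_ind: _ => [|x y|i ik]; [by left | exact: nonunitD |].
  have [->|Fi] := eqVneq (F i) 0; first by rewrite mul0r; left.
  right=> OV; apply: noij; exists i, k; split=> //; split=> //.
    by rewrite mulf_neq0 ?invr_neq0.
  have := kmax i; rewrite mem_filter Fi mem_enum => /(_ isT)[FI|[]//].
  by move: Fi; rewrite FI eqxx.
have -> : \sum_(i | i != k) F i / F k = -1.
  rewrite -mulr_suml; move: sF; rewrite (bigD1 k) //= => /(canRL (addKr _)).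
  by rewrite addr0 => ->; rewrite mulNr divff.
case=> [/eqP|]; first by rewrite oppr_eq0 oner_eq0.
by rewrite invrN invr1; apply; exact: (ON gO).
Qed.

(** Two terms of the minimal polynomial at x have a unit ratio, so some power of x is a rational
    number up to a unit, and a rational number is a power of p up to a unit. *)
Lemma val_rel_exists x : x != 0 -> exists Nk, val_rel x Nk.
Proof.
move=> x0; have [q [qE qm] qroot] := minCpolyP x.
have qx : root (map_poly ratr q : {poly algC}) x by rewrite qroot dvdpp.
have q0 : q != 0 by rewrite monic_neq0.
pose n := size (map_poly ratr q : {poly algC}).
have : \sum_(i < n) (map_poly ratr q : {poly algC})`_i * x ^+ i = 0.
  by rewrite -horner_coef (eqP qx).
move/zero_sum_unit_ratio => -[|i [j [ij]]].
  have nE : n = (size q).-1.+1.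
    by rewrite /n size_map_poly prednK // lt0n size_poly_eq0.
  have lt : ((size q).-1 < n)%N by rewrite nE.
  exists (Ordinal lt) => /=; rewrite coef_map /= mulf_neq0 ?expf_neq0 //.
  by rewrite fmorph_eq0 lead_coef_eq0.
have nz k : ratr q`_k * x ^+ k != 0 -> q`_k != 0.
  by apply: contraNneq => ->; rewrite rmorph0 mul0r.
rewrite !coef_map /= => /nz qi /nz qj.
have [k Uk] := Ounit_rat qi; have [l Ul] := Ounit_rat qj.
wlog ltij : i j k l qi qj ij Uk Ul / (j < i)%N.
  move=> W U; have [lt|lt|eq] := ltngtP j i.
  - exact: (W i j k l).
  - apply: (W j i l k) => //; rewrite 1?eq_sym //.
    by have := OunitV U; rewrite invf_div.
  - by move: ij; rewrite -val_eqE /= eq eqxx.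
move=> U; exists ((i - j)%N, l - k); split; rewrite /= ?subn_gt0 //.
have := OunitM (OunitM U Ul) (OunitV Uk).
have xE : x ^+ i = x ^+ (i - j) * x ^+ j by rewrite -exprD subnK // ltnW.
rewrite xE.
have qi' : ratr q`_i != 0 :> algC by rewrite fmorph_eq0.
have qj' : ratr q`_j != 0 :> algC by rewrite fmorph_eq0.
have xj0 : x ^+ j != 0 by rewrite expf_neq0.
rewrite expfzDr // -invr_expz => h; apply: (eq_ind _ Ounit h).
have := expfz_neq0 k p0; move: (pK ^ l) (pK ^ k) => u v v0.
move: (ratr q`_i : algC) (ratr q`_j : algC) (x ^+ j) qi' qj' xj0 => a b c a0 b0 c0.
by field; rewrite a0 b0 c0 v0.
Qed.

Definition ring_val x : rat :=
  if pselect (exists Nk, val_rel x Nk) is left ex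
  then let Nk := sval (cid ex) in - Nk.2%:~R / Nk.1%:R else 0.

Lemma ring_valE x N k : val_rel x (N, k) -> x != 0 -> ring_val x = - k%:~R / N%:R.
Proof.
move=> [N0 Uk] x0; rewrite /ring_val; case: pselect => [ex|[]]; last first.
  by exists (N, k).
case: (cid ex) => -[M l] [M0 /= Ul].
have : Ounit (pK ^ (k * M%:Z - l * N%:Z)).
  have := OunitM (OunitX M Uk) (OunitV (OunitX N Ul)) => /= h.
  apply: (eq_ind _ Ounit h); rewrite expfzDr // -invr_expz -!exprz_exp.
  rewrite -[(_ ^ k) ^ _]exprnP -[(_ ^ l) ^ _]exprnP !exprMn -!exprM mulnC.
  have := expf_neq0 (M * N) x0; have := expf_neq0 N (expfz_neq0 l p0).
  move: ((pK ^ l) ^+ N) ((pK ^ k) ^+ M) (x ^+ (M * N)) => a b c a0 c0.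
  by field; rewrite a0 c0.
move/Ounit_pz/subr0_eq => klE.
have N0' : N%:R != 0 :> rat by rewrite pnatr_eq0 -lt0n.
have M0' : M%:R != 0 :> rat by rewrite pnatr_eq0 -lt0n.
have {}klE : k%:~R * M%:R = l%:~R * N%:R :> rat.
  by have := congr1 (fun z : int => z%:~R : rat) klE; rewrite !intrM.
apply: (mulIf M0'); rewrite divfK //; apply: (mulIf N0').
by rewrite mulrAC divfK // !mulNr klE.
Qed.

Lemma ring_val_rel x : x != 0 ->
  exists N k, val_rel x (N, k) /\ ring_val x = - k%:~R / N%:R.
Proof.
move=> x0; have [[N k] h] := val_rel_exists x0.
by exists N, k; split=> //; apply: ring_valE.
Qed.

Lemma ring_valM x y : x != 0 -> y != 0 -> ring_val (x * y) = ring_val x + ring_val y.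
Proof.
move=> x0 y0; have [N [k [[/= N0 Uk] ->]]] := ring_val_rel x0.
have [M [l [[/= M0 Ul] ->]]] := ring_val_rel y0.
have h : val_rel (x * y) ((N * M)%N, k * M%:Z + l * N%:Z).
  split; first by rewrite /= muln_gt0 N0.
  have /= h := OunitM (OunitX M Uk) (OunitX N Ul).
  apply: (eq_ind _ Ounit h); rewrite expfzDr // -!exprz_exp.
  rewrite -[(_ ^ k) ^ _]exprnP -[(_ ^ l) ^ _]exprnP !exprMn -!exprM [(M * N)%N]mulnC.
  by rewrite -!mulrA; congr (_ * _); rewrite mulrCA.
rewrite (ring_valE h) ?mulf_neq0 // intrD !intrM natrM /=.
have N0' : N%:R != 0 :> rat by rewrite pnatr_eq0 -lt0n.
have M0' : M%:R != 0 :> rat by rewrite pnatr_eq0 -lt0n.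
by rewrite -!pmulrn; field; rewrite N0' M0'.
Qed.

Lemma ring_val_ge0 x : x != 0 -> (0 <= ring_val x) <-> O x.
Proof.
move=> x0; have [N [k [[/= N0 Uk] ->]]] := ring_val_rel x0.
have Op n : O (pK ^+ n) by apply: (OX gO); apply: (Onat gO).
have N0' : (0 : rat) < N%:R^-1 by rewrite invr_gt0 ltr0n.
rewrite pmulr_lge0 // oppr_ge0 lerz0; split=> [k0|Ox].
  have [n kE] : exists n : nat, k = - n%:Z.
    by exists `|k|%N; rewrite lez0_abs ?opprK.
  have OxN : O (x ^+ N).
    case: Uk => _ h _; have := OM h (Op n).
    by rewrite kE -mulrA -exprnN mulVf ?mulr1 // expf_neq0.
  have [//|OV] := Otot x0; case: N {Uk N0'} N0 OxN => // N _ OxN.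
  have -> : x = x ^+ N.+1 * (x^-1) ^+ N.
    by rewrite exprS -mulrA -exprMn divff // expr1n mulr1.
  by apply: OM => //; apply: (OX gO).
rewrite leNgt; apply/negP=> k0; case: k k0 Uk => // -[|n] // _ [_ _].
rewrite invfM => h; apply: (notOp gO).
have -> : pK^-1 = x ^+ N * ((x ^+ N)^-1 * (pK ^ n.+1)^-1) * pK ^+ n.
  have := expf_neq0 N x0; move: (x ^+ N) => a a0.
  rewrite mulrA divff // mul1r -exprnP exprS invfM -mulrA mulVf ?mulr1 //.
  by rewrite expf_neq0.
by apply: OM => //; apply: OM => //; apply: (OX gO).
Qed.

Lemma is_val_ring_val : is_val p ring_val.
Proof.
split=> //; first exact: ring_valM.
- move=> x y x0 y0 xy0.
  wlog le : x y x0 y0 xy0 / ring_val x <= ring_val y.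
    move=> W; case/orP: (le_total (ring_val x) (ring_val y)) => le; first exact: W.
    have := W y x y0 x0 _ le; rewrite minC [y + x]addrC; exact.
  rewrite (min_idPl le).
  have q0 : (x + y) / x != 0 by rewrite mulf_neq0 ?invr_neq0.
  have -> : x + y = (x + y) / x * x by rewrite divfK.
  rewrite (ring_valM q0) // lerDr; apply/(ring_val_ge0 q0).
  rewrite mulrDl divff //; apply: OD => //.
  have yx0 : y / x != 0 by rewrite mulf_neq0 ?invr_neq0.
  apply/(ring_val_ge0 yx0); rewrite -(lerD2r (ring_val x)) -ring_valM //.
  by rewrite divfK // add0r.
- rewrite (@ring_valE pK 1 (-1)) ?divr1 ?rmorphN1 ?opprK //; split=> //=.
  by rewrite expr1 exprN1 mulfV //; apply: Ounit1.
Qed.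

End ValuationOfRing.

Theorem exists_padic_val (p : nat) : prime p ->
  exists v : algC -> rat, is_val p v.
Proof.
move=> pp; have p0 : p%:R != 0 :> algC by rewrite pnatr_eq0 -lt0n prime_gt0.
have [|O [gO maxO]] := @maximal_avoiding_subring algC p.
  split.
  - by exists 1.
  - by move=> _ _ [m _ <-] [n _ <-]; exists (m - n); rewrite // rmorphB.
  - by move=> _ _ [m _ <-] [n _ <-]; exists (m * n); rewrite // rmorphM.
  - move=> [m _ mE]; have : (m * p%:Z)%:~R = 1%:~R :> algC.
      by rewrite intrM mE mulVf.
    move/intr_inj/(congr1 absz); rewrite abszM /= => /eqP.
    by rewrite muln_eq1 => /andP[_ /eqP p1]; move: pp; rewrite p1.
by exists (ring_val p O); apply: is_val_ring_val.
Qed.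

(** * Approximation *)

Section IntegerValues.
Variables (K : fieldType) (p : nat) (v : K -> rat).
Hypotheses (Hv : is_val p v) (pp : prime p).

Lemma val_coprime n : coprime n p -> n%:R != 0 :> K /\ v n%:R = 0.
Proof.
move=> cnp; have n0 : (0 < n)%N.
  by case: n cnp => //; rewrite /coprime gcd0n => /eqP p1; move: pp; rewrite p1.
have contra r : 0 < r -> r <= 1 -> ~~ vge v r (n%:R : K).
  move=> r0 r1; apply/negP=> hn.
  case: (egcdnP p n0) => u w uE _; move: uE; rewrite (eqP cnp) => uE.
  have /(congr1 (fun m => m%:R : K)) := uE; rewrite natrM natrD natrM => uE'.
  have : vge v r (u%:R * n%:R - w%:R * p%:R).
    apply: (vgeB Hv); apply: (vge_mul0 Hv); rewrite ?(vge_nat Hv) //.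
    by rewrite vge_neq0 ?(valp Hv) ?(valp_neq0 Hv).
  by rewrite uE' addrAC subrr add0r vge_neq0 ?oner_neq0 // (val1 Hv) leNgt r0.
have nK : n%:R != 0 :> K.
  by apply: contraNneq (contra 1 ltr01 (lexx _)) => ->; apply: vge0.
split=> //; apply/eqP; rewrite eq_le -vge_neq0 // (vge_nat Hv) andbT leNgt.
apply/negP=> vn; have /negP[] := contra (Num.min (v n%:R) 1) ltac:(by rewrite lt_min vn ltr01)
  ltac:(by rewrite ge_min lexx orbT).
by rewrite vge_neq0 // ge_min lexx.
Qed.

Lemma val_nat n : (0 < n)%N -> n%:R != 0 :> K /\ v n%:R = (logn p n)%:R.
Proof.
move=> n0; have := congr1 (fun m => m%:R : K) (esym (partnC p n0)).
rewrite natrM p_part natrX => ->.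
have [|b0 vb] := @val_coprime (n`_p^')%N.
  by rewrite coprime_sym prime_coprime // -p'natE // part_pnat.
have p0 := valp_neq0 Hv.
by rewrite mulf_neq0 ?expf_neq0 // (valM Hv) ?expf_neq0 // (valX Hv) // (valp Hv) vb addr0 mulr1.
Qed.

Lemma val_int (n : int) : n != 0 -> n%:~R != 0 :> K /\ v n%:~R = (logn p `|n|)%:R.
Proof.
by case: n => [[|n]|n] // _; rewrite ?NegzE ?mulrNz ?oppr_eq0 ?(valN Hv);
   apply: val_nat.
Qed.

Lemma val_ratr (a : rat) : a != 0 -> exists k : int, v (ratr a) = k%:~R.
Proof.
move=> a0; have n0 : numq a != 0 by rewrite numq_eq0.
have [nK vn] := val_int n0; have [dK vd] := val_int (denq_neq0 a).
exists ((logn p `|numq a|)%:Z - (logn p `|denq a|)%:Z).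
by rewrite /ratr (valM Hv) ?invr_neq0 // (valV Hv) // vn vd rmorphB.
Qed.

End IntegerValues.

Lemma exists_large_multiple (I : eqType) (s : seq I) (a b : I -> rat) :
  (forall i, i \in s -> 0 < a i) ->
  exists N, forall M i, (N <= M)%N -> i \in s -> b i < M%:R * a i.
Proof.
elim: s => [|i s IH] ha; first by exists 0%N.
have [|N hN] := IH; first by move=> j js; apply: ha; rewrite inE js orbT.
have ai : 0 < a i by apply: ha; rewrite mem_head.
exists (maxn N (Num.truncn (`|b i| / a i)).+1) => M j; rewrite geq_max => /andP[NM iM].
rewrite inE => /predU1P[->|]; last exact: hN.
rewrite -ltr_pdivrMr //; apply: le_lt_trans (_ : `|b i| / a i < _).
  by rewrite ler_pM2r ?invr_gt0 // ler_norm.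
apply: lt_le_trans (_ : (Num.truncn (`|b i| / a i)).+1%:R <= _); last by rewrite ler_nat.
by rewrite truncnS_gt.
Qed.

Section Approximation.
Variables (K : fieldType) (p : nat) (v : K -> rat).
Hypothesis Hv : is_val p v.

(** Both valuations send p to 1, so for a rational a/b strictly between v(x) and w(x) the element
    x^b / p^a has values of opposite signs. *)
Lemma val_separate (w : K -> rat) x : is_val p w -> x != 0 -> v x != w x ->
  exists y, [/\ y != 0, v y < 0 & 0 < w y].
Proof.
move=> Hw x0; wlog lt : x x0 / v x < w x.
  move=> W; rewrite neq_lt => /orP[lt|lt]; first by apply: (W x) => //; rewrite lt_eqF.
  have lt' : v x^-1 < w x^-1 by rewrite (valV Hv) ?(valV Hw) // ltrN2.
  by apply: (W x^-1); rewrite ?invr_neq0 ?(lt_eqF lt').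
move=> _; pose r := (v x + w x) / 2%:R.
have [lt1 lt2] : v x < r /\ r < w x by rewrite /r; split; lra.
have p0 := valp_neq0 Hv.
have valpz (u : K -> rat) k : is_val p u -> u (p%:R ^ k) = k%:~R.
  move=> Hu; case: k => n; first by rewrite -exprnP (valX Hu) // (valp Hu) mulr1.
  by rewrite NegzE -exprnN (valV Hu) ?expf_neq0 // (valX Hu) // (valp Hu) mulr1 mulrNz.
have d0 : 0 < (denq r)%:~R :> rat by rewrite ltr0z.
have dE : (denq r)%:~R = `|denq r|%:R :> rat by rewrite pmulrn gez0_abs.
exists (x ^+ `|denq r| * p%:R ^ (- numq r)).
have xd0 : x ^+ `|denq r| != 0 by rewrite expf_neq0.
have pz0 : p%:R ^ (- numq r) != 0 :> K by rewrite expfz_neq0.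
rewrite mulf_neq0 // (valM Hv) // (valM Hw) // !valpz // (valX Hv) // (valX Hw) // -dE.
have rE : r = (numq r)%:~R / (denq r)%:~R by rewrite divq_num_den.
split=> //; rewrite rmorphN /=.
  by rewrite subr_lt0 mulrC -ltr_pdivlMr // -rE.
by rewrite subr_gt0 mulrC -ltr_pdivrMr // -rE.
Qed.

(** x^n / (1 + x^n) is close to 1 where x has a pole and close to 0 where x is small, so it acts at
    some places and leaves values at others unchanged. *)
Lemma val_cayley (w : K -> rat) x n : is_val p w -> x != 0 -> (0 < n)%N ->
  1 + x ^+ n != 0 ->
  (w x < 0 -> w (x ^+ n / (1 + x ^+ n)) = 0) /\
  (0 < w x -> w (x ^+ n / (1 + x ^+ n)) = n%:R * w x).
Proof.
move=> Hw x0 n0 s0; have n0' : 0 < n%:R :> rat by rewrite ltr0n.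
have xn0 := expf_neq0 n x0; have vx := valX Hw n x0.
rewrite (valM Hw) ?invr_neq0 // (valV Hw) // vx; split=> hx.
  have [|_] := @val_dom _ _ _ Hw 0 (x ^+ n) 1 xn0 _ (vge1 Hw).
    by rewrite vx pmulr_rlt0.
  by rewrite addrC => ->; rewrite vx subrr.
have h : vge w (n%:R * w x) (x ^+ n) by rewrite vge_neq0 ?vx.
have [|_ ->] := @val_dom _ _ _ Hw _ 1 (x ^+ n) (oner_neq0 _) _ h.
  by rewrite (val1 Hw) pmulr_rgt0.
by rewrite (val1 Hw) subr0.
Qed.

Lemma one_addX_neq0 x n : x != 0 -> v x < 0 -> (0 < n)%N -> 1 + x ^+ n != 0.
Proof.
move=> x0 vx n0; have [] // := @val_dom _ _ _ Hv 0 (x ^+ n) 1 _ _ (vge1 Hv).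
- exact: expf_neq0.
- by rewrite (valX Hv) // pmulr_rlt0 // ltr0n.
- by rewrite addrC.
Qed.

Variables (I : eqType) (w : I -> K -> rat).
Hypothesis Hw : forall i, is_val p (w i).

Lemma weak_approximation (s : seq I) :
  (forall i, i \in s -> exists2 x, x != 0 & v x != w i x) ->
  exists x, [/\ x != 0, v x < 0 & forall i, i \in s -> 0 < w i x].
Proof.
elim: s => [_|i s IH hs].
  exists (p%:R^-1); split=> //; first by rewrite invr_neq0 ?(valp_neq0 Hv).
  by rewrite (valV Hv) ?(valp_neq0 Hv) // (valp Hv).
have [|x [x0 vx wx]] := IH; first by move=> j js; apply: hs; rewrite inE js orbT.
have [t t0 vt] := hs i (mem_head _ _).
have [y [y0 vy wy]] := val_separate (Hw i) t0 vt.
have [N hN] := exists_large_multiple (fun j => - w j y) wx.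
pose n := N.+1; have n0 : 0 < n%:R :> rat by rewrite ltr0n.
have hn j : j \in s -> 0 < n%:R * w j x + w j y.
  by move=> js; have := hN n j (leqnSn _) js; rewrite -subr_gt0 opprK.
have xn0 := expf_neq0 n x0.
(* If w_i(x) >= 0, a large power of x corrects y at the other places without harm at place i. If
   w_i(x) < 0 it would do harm there, and x^n / (1 + x^n) takes its place. *)
have [le|lt] := leP 0 (w i x).
  exists (x ^+ n * y); rewrite mulf_neq0 //; split=> //.
    have nvx : n%:R * v x < 0 by rewrite pmulr_rlt0.
    by rewrite (valM Hv) // (valX Hv) //; lra.
  move=> j; rewrite inE (valM (Hw j)) // (valX (Hw j)) // => /predU1P[->|/hn//].
  by rewrite ltr_wpDl // mulr_ge0 // ltW.
have s0 := one_addX_neq0 x0 vx (ltn0Sn N).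
have z0 : x ^+ n / (1 + x ^+ n) != 0 by rewrite mulf_neq0 ?invr_neq0.
exists (x ^+ n / (1 + x ^+ n) * y); rewrite mulf_neq0 //; split=> //.
  by rewrite (valM Hv) // (proj1 (val_cayley Hv x0 (ltn0Sn N) s0)) // add0r.
move=> j; rewrite inE (valM (Hw j)) // => /predU1P[->|js].
  by rewrite (proj1 (val_cayley (Hw i) x0 (ltn0Sn N) s0)) // add0r.
by rewrite (proj2 (val_cayley (Hw j) x0 (ltn0Sn N) s0)) ?wx // hn.
Qed.

Lemma exists_unit_small_elsewhere (s : seq I) (B : rat) :
  (forall i, i \in s -> exists2 x, x != 0 & v x != w i x) ->
  exists y, [/\ y != 0, v y = 0 & forall i, i \in s -> B < w i y].
Proof.
move=> /weak_approximation[x [x0 vx wx]].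
have [N hN] := exists_large_multiple (fun=> B) wx.
have s0 := one_addX_neq0 x0 vx (ltn0Sn N).
exists (x ^+ N.+1 / (1 + x ^+ N.+1)); split.
- by rewrite mulf_neq0 ?invr_neq0 ?expf_neq0.
- by rewrite (proj1 (val_cayley Hv x0 (ltn0Sn N) s0)).
- move=> i js; rewrite (proj2 (val_cayley (Hw i) x0 (ltn0Sn N) s0)) ?wx //.
  exact: hN.
Qed.

End Approximation.

(** Fits two uses: w and x are the values of a conjugate of z and of z itself, u that of a conjugate
    of the approximating unit, e a fixed correction. The gap of 1 makes conjugates outside the
    decomposition group negligible. *)
Lemma small_term_bound (B u w x e : rat) :
  `|w| <= B -> B + `|x| + `|e| + 1 < u -> e + x + 1 <= w + u.
Proof.
rewrite ler_norml => /andP[h _]; have := ler_norm x; have := ler_norm e; lra.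
Qed.

(** * Decomposition and inertia *)

Section NormalNumberField.
Variables (L : splittingFieldType rat) (p : nat) (v : L -> rat).
Hypotheses (Hv : is_val p v) (pp : prime p).
Local Notation G := (gal_of {:L}).

Lemma gal_total (s : G) : s \in ('Gal({:L} / 1))%g.
Proof. by rewrite gal_kHom ?sub1v ?k1AHom. Qed.

Lemma galois_over_rat : galois 1 {:L}.
Proof.
rewrite /galois sub1v normalFieldf andbT; apply/separableP=> y _.
by apply: pcharf0_separable => q; rewrite pchar_lalg pchar_num.
Qed.

Definition tr (x : L) : L := \sum_(s : G) s x.

Lemma trE x : exists a : rat, tr x = ratr a.
Proof.
have /vlineP[a trx] := mem_galTrace galois_over_rat (memvf x).
exists a; rewrite -alg_num_field -trx /tr /galTrace.
by apply: eq_bigl => s; rewrite gal_total.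
Qed.

Lemma val_tr x : tr x != 0 -> exists k : int, v (tr x) = k%:~R.
Proof.
have [a ->] := trE x => a0; apply: (val_ratr Hv) => //.
by apply: contraNneq a0 => ->; rewrite -alg_num_field scale0r.
Qed.

Definition decomp : {set G} := [set s : G | `[< forall x, v (s x) = v x >]].

Lemma decompP (s : G) : reflect (forall x, v (s x) = v x) (s \in decomp).
Proof. by rewrite inE; apply: asboolP. Qed.

Lemma decomp_id : (1%g : G) \in decomp.
Proof. by apply/decompP=> x; rewrite gal_id. Qed.

Lemma decompM (s t : G) : s \in decomp -> t \in decomp -> (s * t)%g \in decomp.
Proof.
move=> /decompP hs /decompP ht; apply/decompP => x.
by rewrite galM ?memvf // ht.
Qed.

Lemma decompV (s : G) : s \in decomp -> (s^-1)%g \in decomp.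
Proof.
move=> /decompP hs; apply/decompP => x.
by rewrite -hs -galM ?memvf // mulVg gal_id.
Qed.

Lemma gal_eq0 (s : G) x : (s x == 0) = (x == 0).
Proof. exact: fmorph_eq0. Qed.

(** For s outside the decomposition group the valuation x -> v(s x) differs from v, so approximation
    applies to these finitely many valuations. *)
Lemma exists_decomp_unit (B : rat) :
  exists y, [/\ y != 0, v y = 0 & forall s : G, s \notin decomp -> B < v (s y)].
Proof.
pose s := enum [set s : G | s \notin decomp].
have [|y [y0 vy hy]] := @exists_unit_small_elsewhere L p v Hv _
    (fun (s : G) x => v (s x)) (fun s => is_val_comp s Hv) s B.
  move=> t; rewrite mem_enum inE => nt; apply: contrapT => noex.
  case/negP: nt; apply/decompP => x; have [->|x0] := eqVneq x 0; first by rewrite rmorph0.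
  by apply/eqP; apply: contra_notT noex => ne; exists x; rewrite // eq_sym.
by exists y; split=> // t nt; apply: hy; rewrite mem_enum inE.
Qed.

Lemma exists_bound (I : finType) (f : I -> rat) : exists2 B, 0 <= B & forall i, `|f i| <= B.
Proof.
exists (\sum_i `|f i|); first by apply: sumr_ge0 => i _; apply: normr_ge0.
move=> i; rewrite (bigD1 i) //= lerDl; apply: sumr_ge0 => j _; exact: normr_ge0.
Qed.

(** Let y' be a unit fixed by the decomposition group D and highly divisible after every other
    automorphism. The trace of z y' is #D z y' up to a negligible term; being rational it has an
    integral value, and so has #D. *)
Theorem val_fixed_decomp_int z : z != 0 ->
  (forall s : G, s \in decomp -> s z = z) -> exists k : int, v z = k%:~R.
Proof.
move=> z0 fixz.
have D0 : (0 < #|decomp|)%N by apply/card_gt0P; exists 1%g; exact: decomp_id.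
have [DK vD] := val_nat Hv pp D0.
have [B1 B10 hB1] := exists_bound (fun s : G => v (s z)).
pose B := B1 + `|v z| + `|v (#|decomp|%:R : L)| + 1.
have B0 : 0 <= B by rewrite /B !addr_ge0.
have [y [y0 vy hy]] := exists_decomp_unit B.
pose y' := \prod_(s in decomp) s y.
have sy0 (s : G) : s y != 0 by rewrite gal_eq0.
have y'0 : y' != 0 by apply/prodf_neq0 => s _.
have vy' : v y' = 0.
  by rewrite (val_prod Hv) // big1 // => s /decompP ->.
have fixy' (t : G) : t \in decomp -> t y' = y'.
  move=> Dt; rewrite /y' rmorph_prod /= (reindex_inj (mulIg t^-1)%g) /=.
  apply: eq_big => [s|s Ds]; last by rewrite -galM ?memvf // mulgVK.
  apply/idP/idP => Ds; last exact: decompM Ds (decompV Dt).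
  by rewrite -(mulgVK t s); apply: decompM.
have smally' (t : G) : t \notin decomp -> B < v (t y').
  move=> nDt; rewrite /y' rmorph_prod /= (val_prod Hv); last by move=> s _; rewrite !gal_eq0.
  have nDst s : s \in decomp -> (s * t)%g \notin decomp.
    by move=> Ds; apply: contra nDt => Dst; rewrite -(mulKg s t) decompM ?decompV.
  rewrite (bigD1 (1%g : G)) ?decomp_id //= gal_id.
  apply: lt_le_trans (hy t nDt) _; rewrite lerDl; apply: sumr_ge0 => s /andP[Ds _].
  by rewrite -galM ?memvf // ltW // (le_lt_trans B0) // hy ?nDst.
pose m := v (#|decomp|%:R * z * y').
have mE : m = v (#|decomp|%:R : L) + v z.
  by rewrite /m !(valM Hv) ?mulf_neq0 // vy' addr0.
have trE : tr (z * y') = #|decomp|%:R * z * y' +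
    \sum_(s : G | s \notin decomp) s (z * y').
  rewrite /tr (bigID (mem decomp)) /=; congr (_ + _).
  rewrite (eq_bigr (fun=> z * y')); last by move=> s Ds; rewrite rmorphM /= fixz ?fixy'.
  by rewrite sumr_const -mulrA mulr_natl.
have rest : vge v (m + 1) (\sum_(s : G | s \notin decomp) s (z * y')).
  apply: (vge_sum Hv) => s nDs; rewrite vge_neq0 ?gal_eq0 ?mulf_neq0 //.
  rewrite rmorphM /= (valM Hv) ?gal_eq0 // mE.
  exact: small_term_bound (hB1 s) (smally' s nDs).
have Dzy0 : #|decomp|%:R * z * y' != 0 by rewrite !mulf_neq0.
have lt1 : v (#|decomp|%:R * z * y') < m + 1 by rewrite ltrDl.
have [tr0 vtr] := val_dom Hv Dzy0 lt1 rest.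
move: tr0 vtr; rewrite -trE => /val_tr[k ->] => kE.
exists (k - (logn p #|decomp|)%:Z); rewrite rmorphB /= kE -/m mE vD.
by rewrite addrAC subrr add0r.
Qed.
End NormalNumberField.

Section Inertia.
Variables (L : splittingFieldType rat) (p : nat) (v : L -> rat).
Hypotheses (Hv : is_val p v) (pp : prime p).
Local Notation G := (gal_of {:L}).
Local Notation D := (decomp v).
Local Notation tr := (@tr L).

Variable x : G -> L.

(** In the expansion of [twist l t] these are the elements whose images under t occur. *)
Fixpoint monomials (l : seq G) : seq L :=
  if l is s :: l' then monomials l' ++ [seq x s * b | b <- monomials l'] else [:: 1].

(** As a function of t this weight vanishes at every member of l; it deletes unwanted conjugates
    from a trace. *)
Definition twist (l : seq G) (t : G) : L := \prod_(s <- l) (t (x s) - s (x s)).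

(** Expanding the weight turns the sum into a combination of ordinary traces of b w, whose
    coefficients are products of the integral s(x_s) up to sign. *)
Lemma twisted_trace_val r (l : seq G) w :
  (forall s : G, vge v 0 (s (x s))) ->
  (forall b, b \in monomials l -> vge v r (tr (b * w))) ->
  vge v r (\sum_(t : G) t w * twist l t).
Proof.
move=> hx; elim: l w => [|s l IH] w hw.
  rewrite (eq_bigr (fun t : G => t w)).
    by have := hw 1 (mem_head _ _); rewrite mul1r.
  by move=> t _; rewrite /twist big_nil mulr1.
rewrite (eq_bigr (fun t : G => t (x s * w) * twist l t - s (x s) * (t w * twist l t))).
  rewrite sumrB -mulr_sumr; apply: (vgeB Hv).
    apply: IH => b hb; rewrite mulrA [b * _]mulrC; apply: hw.
    by rewrite /= mem_cat map_f ?orbT.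
  apply: (vge_mul0 Hv) => //; apply: IH => b hb; apply: hw.
  by rewrite /= mem_cat hb.
move=> t _; rewrite /twist big_cons rmorphM /=; set P := \prod_(_ <- _) _.
ring.
Qed.

Lemma vge_monomials (l : seq G) b : (forall s, vge v 0 (x s)) ->
  b \in monomials l -> vge v 0 b.
Proof.
move=> hx; elim: l b => [|s l IH] b /=.
  by rewrite inE => /eqP->; apply: (vge1 Hv).
rewrite mem_cat => /orP[/IH//|/mapP[c /IH hc ->]].
exact: (vge_mul0 Hv).
Qed.

End Inertia.

(** If inertia were trivial, each nontrivial s in D would move some integral x_s by a unit. With w =
    z y, the weighted sum of the t(w) then loses all these s, keeps an identity term of value at
    most v(z), and has negligible terms outside D. As a combination of traces it nevertheless has a
    value above v(z). *)
Theorem exists_inertia (L : splittingFieldType rat) p (v : L -> rat) (z : L) :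
  is_val p v -> prime p -> z != 0 -> (forall k : int, v z != k%:~R) ->
  exists s : gal_of {:L}, [/\ exists x, s x != x, forall x, v (s x) = v x &
    forall x, vge v 0 x -> s x != x -> 0 < v (s x - x)].
Proof.
move=> Hv pp z0 vz; apply: contrapT => noinertia.
have ex_x (s : gal_of {:L}) : exists y, vge v 0 y /\
    (s \in decomp v -> s != 1%g -> s y != y /\ v (s y - y) <= 0).
  have [Ds|nDs] := boolP (s \in decomp v); last first.
    by exists 0; split=> //; apply: vge0.
  have [->|s1] := eqVneq s 1%g; first by exists 0; split; rewrite ?vge0.
  apply: contrapT => noy; apply: noinertia; exists s; split.
  - apply: contrapT => triv; case/negP: s1; apply/gal_eqP => y _.
    rewrite gal_id; apply/eqP; apply: contra_notT triv => ne; by exists y.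
  - exact/decompP.
  - move=> y hy ne; rewrite ltNge; apply/negP => le.
    by apply: noy; exists y.
pose x s := sval (cid (ex_x s)).
have vx s : vge v 0 (x s) by rewrite /x; case: (cid _) => y [].
have hx (s : gal_of {:L}) : s \in decomp v -> s != 1%g -> s (x s) != x s /\ v (s (x s) - x s) <= 0.
  by rewrite /x; case: (cid _) => y [].
(* Outside D nothing is known about the value of s(x_s), so x_s is replaced by 0 there. *)
pose x' (s : gal_of {:L}) := if s \in decomp v then x s else 0.
have vx' s : vge v 0 (x' s) by rewrite /x'; case: ifP => // _; apply: vge0.
have vsx' (s : gal_of {:L}) : vge v 0 (s (x' s)).
  rewrite /x'; case: ifP => [/decompP Ds|_]; last by rewrite rmorph0 vge0.
  by rewrite /vge gal_eq0 Ds; apply: vx.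
pose l := [seq s <- enum (decomp v) | s != 1%g].
have lP s : (s \in l) = (s != 1%g) && (s \in decomp v) by rewrite mem_filter mem_enum.
have [B1 B10 hB1] := exists_bound (fun s : gal_of {:L} => v (s z)).
have [B2 B20 hB2] := exists_bound (fun s : gal_of {:L} => v (twist x' l s)).
have [B3 B30 hB3] := exists_bound (fun si : gal_of {:L} * 'I_(size (monomials x' l)) =>
  v (si.1 (monomials x' l)`_si.2)).
pose B := B1 + `|v z| + `|B2 + B3| + 1.
have [y [y0 vy hy]] := exists_decomp_unit Hv B.
pose w := z * y.
have w0 : w != 0 by rewrite mulf_neq0.
have vw : v w = v z by rewrite (valM Hv) // vy addr0.
have small (s : gal_of {:L}) : s \notin decomp v -> v z + 1 + (B2 + B3) <= v (s w).
  move=> nDs; rewrite rmorphM (valM Hv) ?gal_eq0 //=.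
  by have := small_term_bound (hB1 s) (hy s nDs); rewrite [_ + 1 + _]addrC addrA.
have smallB2 (s : gal_of {:L}) : s \notin decomp v -> vge v (v z + 1) (s w * twist x' l s).
  move=> nDs; have [->|t0] := eqVneq (twist x' l s) 0; first by rewrite mulr0 vge0.
  rewrite vge_neq0 ?mulf_neq0 ?gal_eq0 // (valM Hv) ?gal_eq0 //.
  have := small s nDs; have := hB2 s; rewrite ler_norml => /andP[+ _].
  move: (v (s w)) (v (twist _ _ _)) B20 B30 => a b; clear; move: (v z) => c; lra.
have smallB3 (s : gal_of {:L}) b : s \notin decomp v -> b \in monomials x' l ->
    vge v (v z) (s (b * w)).
  move=> nDs hb; have [->|b0] := eqVneq b 0; first by rewrite mul0r rmorph0 vge0.
  rewrite vge_neq0 ?gal_eq0 ?mulf_neq0 // rmorphM (valM Hv) ?gal_eq0 //=.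
  have ib : (index b (monomials x' l) < size (monomials x' l))%N by rewrite index_mem.
  have := hB3 (s, Ordinal ib); rewrite /= nth_index // ler_norml => /andP[+ _].
  have := small s nDs; move: (v (s w)) (v (s b)) B20 B30 => a c; clear.
  move: (v z) => e; lra.
(* Traces have integral values; as v(z) is not an integer, a trace of value at least v(z) has value
   at least the next integer r. *)
pose r : rat := (Num.floor (v z) + 1)%:~R.
have rz : v z < r by rewrite floorD1_gt.
have trP b : b \in monomials x' l -> vge v r (tr (b * w)).
  move=> hb; have vb : vge v 0 b by apply: (vge_monomials Hv vx' hb).
  have : vge v (v z) (tr (b * w)).
    apply: (vge_sum Hv) => s _; have [Ds|nDs] := boolP (s \in decomp v); last exact: smallB3.
    rewrite rmorphM; apply: (vge_mul0 Hv).
      by move/decompP: Ds => Ds; move: vb; rewrite /vge gal_eq0 Ds.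
    by rewrite vge_neq0 ?gal_eq0 //; move/decompP: Ds => ->; rewrite vw.
  have [->|t0] := eqVneq (tr (b * w)) 0; first by rewrite !vge0.
  rewrite !vge_neq0 //; have [k kE] := val_tr Hv pp t0; rewrite kE => le.
  have lt : v z < k%:~R by rewrite lt_neqAle vz le.
  by rewrite /r ler_int lezD1 floor_lt_int.
have := twisted_trace_val Hv vsx' trP.
rewrite (bigD1 (1%g : gal_of {:L})) //= gal_id.
have main0 : twist x' l 1%g != 0 /\ v (twist x' l 1%g) <= 0.
  have F0 s : s \in l -> (1%g : gal_of {:L}) (x' s) - s (x' s) != 0 /\
      v ((1%g : gal_of {:L}) (x' s) - s (x' s)) <= 0.
    rewrite lP => /andP[s1 Ds]; have [ne le] := hx s Ds s1.
    by rewrite /x' Ds gal_id subr_eq0 eq_sym ne -(valN Hv) opprB.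
  rewrite /twist; elim: (l) F0 => [|s m IH] F0.
    by rewrite !big_nil oner_eq0 (val1 Hv).
  have [|m0 vm] := IH; first by move=> t tm; apply: F0; rewrite inE tm orbT.
  have [s0 vs] := F0 s (mem_head _ _).
  rewrite big_cons mulf_neq0 // (valM Hv) //; split=> //.
  by rewrite -[leRHS]addr0 lerD.
case: main0 => t0 vt.
have wt0 : w * twist x' l 1%g != 0 by rewrite mulf_neq0.
have rest : vge v (v z + 1)
    (\sum_(s : gal_of {:L} | s != 1%g) s w * twist x' l s).
  apply: (vge_sum Hv) => s s1; have [Ds|] := boolP (s \in decomp v); last exact: smallB2.
  have -> : twist x' l s = 0; last by rewrite mulr0 vge0.
  have sl : s \in l by rewrite lP s1 Ds.
  by rewrite /twist (big_rem s) //= subrr mul0r.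
have vwt : v (w * twist x' l 1%g) <= v z.
  by rewrite (valM Hv) // vw gerDl.
have [] // := val_dom Hv wt0 _ rest; first by apply: le_lt_trans vwt _; rewrite ltrDl.
move=> s0 vs; rewrite vge_neq0 // vs => /le_trans/(_ vwt).
by rewrite leNgt rz.
Qed.

(** * Splitting fields inside the algebraic numbers and automorphisms of the latter *)

Local Notation pQC := (map_poly (ratr : rat -> algC)).

Theorem splitting_num_field (f : {poly rat}) : f != 0 ->
  exists (L : splittingFieldType rat) (LC : {rmorphism L -> algC}) (rs : seq L),
    [/\ <<1 & rs>>%VS = {:L}%VS, (forall z, root (pQC f) z -> z \in map LC rs) &
      forall x, x \in rs -> root (pQC f) (LC x)].
Proof.
move=> f0; have fC0 : pQC f != 0 by rewrite map_poly_eq0.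
have [r fE] := closed_field_poly_normal (pQC f : {poly algC}).
have c0 : lead_coef (pQC f) != 0 by rewrite lead_coef_eq0.
have [Q [QC [rs rsE genQ]]] := num_field_exists r.
have ax : SplittingField.axiom Q.
  exists (map_poly (in_alg Q) f); first by apply/polyOverP => i; rewrite coef_map /= rpredZ ?mem1v.
  exists rs; last by rewrite genQ.
  rewrite -(eqp_map QC) -map_poly_comp (eq_map_poly (g := ratr)); last first.
    by move=> a /=; rewrite alg_num_field fmorph_rat.
  rewrite fE rmorph_prod /= (eq_bigr (fun z => 'X - (QC z)%:P)); last first.
    by move=> z _; rewrite map_polyXsubC.
  by rewrite -rsE big_map eqp_scale.
pose L : splittingFieldType rat := HB.pack (FieldExt.sort Q) (FieldExt_isSplittingField.Build rat Q ax).
have rootE z : root (pQC f) z = (z \in map QC rs).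
  by rewrite fE rootZ // rsE root_prod_XsubC.
exists L, QC, rs; split=> [||x xr]; [exact: genQ | by move=> z; rewrite rootE |].
by rewrite rootE map_f.
Qed.

Lemma gal_extend (L : splittingFieldType rat) (LC : {rmorphism L -> algC}) (s : gal_of {:L}) :
  exists sigma : {rmorphism algC -> algC}, forall x, sigma (LC x) = LC (s x).
Proof.
have [nu nuE] := extend_algC_subfield_aut LC (s : {rmorphism L -> L}).
by exists nu => x; rewrite nuE.
Qed.

Lemma irreducible_minpoly (f : {poly rat}) z : irreducible_poly f -> root (pQC f) z ->
  exists2 q : {poly rat}, minCpoly z = pQC q & q %= f.
Proof.
move=> [_ irr] fz; have [q [qE qm] qroot] := minCpolyP z.
exists q => //; apply: irr; last by rewrite -qroot.
by have := size_minCpoly z; rewrite qE size_map_poly; case: (size q) => [|[]].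
Qed.

Theorem aut_transitive (f : {poly rat}) x y : irreducible_poly f ->
  root (pQC f) x -> root (pQC f) y -> exists sigma : {rmorphism algC -> algC}, sigma x = y.
Proof.
move=> irr fx fy; have f0 : f != 0 by case: irr => + _; case: eqP => // ->; rewrite size_poly0.
have [L [LC [rs [gen inrs rsroot]]]] := splitting_num_field f0.
have /mapP[x1 _ xE] := inrs x fx; have /mapP[y1 _ yE] := inrs y fy.
have [q qE qf] := irreducible_minpoly irr fx.
have [||||s _ sx] := @normalField_root_minPoly rat L 1%AS {:L}%AS x1 y1.
- exact: sub1v.
- exact: normalFieldf.
- exact: memvf.
- have /polyOver1P[m mE] := minPolyOver 1%AS x1.
  have mC : map_poly LC (minPoly 1%AS x1) = pQC m.
    rewrite mE -map_poly_comp; apply: eq_map_poly => a /=.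
    by rewrite alg_num_field fmorph_rat.
  have mx : root (pQC m) x by rewrite -mC xE fmorph_root root_minPoly.
  have [q' [q'E _] q'root] := minCpolyP x.
  have qq' : q = q' by apply: (map_poly_inj (ratr : {rmorphism rat -> algC})); rewrite -qE.
  move: mx; rewrite q'root -qq' => qm.
  rewrite -(fmorph_root LC) mC -yE.
  have /dvdpP[t ->] := qm; rewrite rmorphM rootM; apply/orP; right.
  by rewrite /= (eqp_root (q := pQC f)) // eqp_map.
have [sigma sE] := gal_extend LC s; exists sigma.
by rewrite xE sE sx yE.
Qed.

Lemma fixed_rat z : (forall sigma : {rmorphism algC -> algC}, sigma z = z) ->
  exists a, z = ratr a.
Proof.
move=> fixz; have [q [qE qm] qroot] := minCpolyP z.
have [L [LC [rs [gen inrs rsroot]]]] := splitting_num_field (monic_neq0 qm).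
have qz : root (pQC q) z by rewrite qroot dvdpp.
have /mapP[x xr xE] := inrs z qz.
have /vlineP[a xa] : x \in 1%VS.
  have /galois_fixedField <- := galois_over_rat L.
  apply/fixedFieldP=> [|s _]; first exact: memvf.
  have [sigma sE] := gal_extend LC s; apply: (fmorph_inj LC).
  by rewrite -sE -xE fixz.
by exists a; rewrite xE xa alg_num_field fmorph_rat.
Qed.

Section RootsValuation.
Variables (p : nat) (v : algC -> rat).
Hypotheses (Hv : is_val p v) (pp : prime p).
Variable f : {poly rat}.
Hypothesis f0 : f != 0.

(* The decomposition group of v in the splitting field of f, seen through its action on the roots. *)
Definition decomp_aut (sigma : {rmorphism algC -> algC}) : Prop :=
  forall r (g : {poly rat}), root (pQC f) r -> v (pQC g).[sigma r] = v (pQC g).[r].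

Theorem val_prod_roots_int (s : seq algC) : (forall r, r \in s -> root (pQC f) r /\ r != 0) ->
  (forall sigma, decomp_aut sigma -> sigma (\prod_(r <- s) r) = \prod_(r <- s) r) ->
  exists k : int, v (\prod_(r <- s) r) = k%:~R.
Proof.
move=> sroot fixz; have [L [LC [rs [gen inrs rsroot]]]] := splitting_num_field f0.
have [z zE] : exists z, LC z = \prod_(r <- s) r.
  elim: (s) sroot => [|r t IH] sroot; first by exists 1; rewrite big_nil rmorph1.
  have [|z zE] := IH; first by move=> u ut; apply: sroot; rewrite inE ut orbT.
  have [/inrs/mapP[x _ xE] _] := sroot r (mem_head _ _).
  by exists (x * z); rewrite rmorphM big_cons zE xE.
have z0 : LC z != 0 by rewrite zE prodf_seq_neq0; apply/allP => r /sroot[_ ->].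
rewrite -zE; apply: (val_fixed_decomp_int (is_val_comp LC Hv) pp) => [|t /decompP Dt].
  by rewrite -(fmorph_eq0 LC).
apply: (fmorph_inj LC); have [sigma sE] := gal_extend LC t.
rewrite -sE zE; apply: fixz => r g /inrs/mapP[x _ ->].
have gE y : (pQC g).[LC y] = LC (map_poly (in_alg L) g).[y].
  rewrite -horner_map -map_poly_comp; congr _.[_]; apply: eq_map_poly => a /=.
  by rewrite alg_num_field fmorph_rat.
have tg : (map_poly (in_alg L) g).[t x] = t (map_poly (in_alg L) g).[x].
  rewrite -horner_map -map_poly_comp; congr _.[_]; apply: eq_map_poly => a /=.
  by rewrite linearZ rmorph1.
by rewrite sE !gE tg; apply: Dt.
Qed.

(** The inertia element is nontrivial on the splitting field, hence moves one of the roots that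
    generate it; it extends to all algebraic numbers. *)
Theorem inertia_moves_root (b : algC) (k : rat) : root (pQC f) b -> ratr k - b != 0 ->
  (forall m : int, v (ratr k - b) != m%:~R) ->
  exists sigma : {rmorphism algC -> algC}, (exists2 r, root (pQC f) r & sigma r != r) /\
   forall r, root (pQC f) r -> vge v 0 r -> sigma r != r -> 0 < v (sigma r - r).
Proof.
move=> fb kb0 vkb; have [L [LC [rs [gen inrs rsroot]]]] := splitting_num_field f0.
have /mapP[x _ xE] := inrs b fb.
have zE : LC (ratr k - x) = ratr k - b by rewrite rmorphB fmorph_rat xE.
have [|m|s [[y sy] Ds Is]] := @exists_inertia L p (v \o LC) (ratr k - x) (is_val_comp LC Hv) pp.
- by rewrite -(fmorph_eq0 LC) zE.
- by rewrite /= zE.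
have [sigma sE] := gal_extend LC s; exists sigma; split.
  apply: contrapT => noroot; case/negP: sy; apply/eqP.
  have yrs : y \in <<1 & rs>>%VS by rewrite gen memvf.
  have : (<<1 & rs>> <= fixedField [set s])%VS.
    apply/Fadjoin_seqP; split; first exact: sub1v.
    move=> r rr; apply/fixedFieldP => [|t]; first exact: memvf.
    rewrite inE => /eqP->; apply: (fmorph_inj LC); rewrite -sE.
    by apply/eqP; apply: contra_notT noroot => ne; exists (LC r); rewrite ?rsroot.
  by move/subvP/(_ y yrs)/mem_fixedFieldP => [_]; apply; rewrite inE.
move=> r /inrs/mapP[t _ ->] vr; rewrite sE -rmorphB => ne.
apply: Is; last by apply: contraNneq ne => ->.
by move: vr; rewrite /vge fmorph_eq0.
Qed.

End RootsValuation.

Local Notation aut := {rmorphism algC -> algC}.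

Definition aut_inv (s : aut) : aut := algC_invaut s.

Lemma aut_VK (s : aut) : cancel s (aut_inv s).
Proof. exact: algC_autK. Qed.

Lemma aut_KV (s : aut) : cancel (aut_inv s) s.
Proof. exact: algC_invautK. Qed.

(** * Transpositions in fibres *)

Section Swaps.
Variables (V : algC -> Prop) (F : algC -> algC).
Hypothesis V_aut : forall (s : aut) x, V x -> V (s x).
Hypothesis F_aut : forall (s : aut) x, F (s x) = s (F x).

(* For x = y this only asks for an automorphism trivial on V. *)
Definition swaps x y := exists s : aut,
  [/\ s x = y, s y = x & forall z, V z -> z != x -> z != y -> s z = z].

Lemma swaps_refl x : swaps x x.
Proof. by exists (idfun : aut). Qed.

Lemma swaps_sym x y : swaps x y -> swaps y x.
Proof. by case=> s [sx sy sz]; exists s; split=> // z Vz zy zx; apply: sz. Qed.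

Lemma swaps_aut (t : aut) x y : swaps x y -> swaps (t x) (t y).
Proof.
case=> s [sx sy sz]; exists (t \o s \o aut_inv t); split=> /=.
- by rewrite aut_VK sx.
- by rewrite aut_VK sy.
- move=> z Vz zx zy; rewrite sz ?aut_KV //; first exact: V_aut.
  + by apply: contraNneq zx => <-; rewrite aut_KV.
  + by apply: contraNneq zy => <-; rewrite aut_KV.
Qed.

(** Conjugating the exchange of x and y by that of y and z gives the exchange of x and z, as the
    latter automorphism fixes x. *)
Lemma swaps_trans x y z : V x -> swaps x y -> swaps y z -> swaps x z.
Proof.
move=> Vx xy yz; have [->|xney] := eqVneq x y; first by [].
have [<-|xnez] := eqVneq x z; first exact: swaps_refl.
case: yz => s [sy sz sw]; have := swaps_aut s xy.
by rewrite (sw x) // sy.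
Qed.

Hypothesis V_trans : forall x y, V x -> V y -> exists s : aut, s x = y.

Lemma swaps_spread u : V u -> (forall y, V y -> F y = F u -> swaps u y) ->
  forall x y, V x -> V y -> F x = F y -> swaps x y.
Proof.
move=> Vu hu x y Vx Vy Fxy; have [s su] := V_trans Vu Vx.
have := @swaps_aut s u (aut_inv s y); rewrite su aut_KV; apply.
apply: hu; first exact: V_aut.
by rewrite F_aut -Fxy -su F_aut aut_VK.
Qed.

Variables x0 y0 : algC.
Hypotheses (Vx0 : V x0) (Fxy0 : F x0 = F y0) (xy0 : x0 != y0) (sw0 : swaps x0 y0).

Lemma swaps_partner x : V x -> exists y, [/\ V y, F y = F x, y != x & swaps x y].
Proof.
move=> Vx; have [s sx] := V_trans Vx0 Vx; exists (s y0); split.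
- case: sw0 => t [<- _ _]; exact/V_aut/V_aut.
- by rewrite F_aut -Fxy0 -F_aut sx.
- by rewrite -sx fmorph_eq eq_sym.
- by rewrite -sx; apply: swaps_aut.
Qed.

(** The point u is exchanged with some z of its fibre, and automorphisms fixing u carry z to every
    other point of that fibre. *)
Lemma swaps_of_pointed_fiber u : V u ->
  (forall x y, V x -> V y -> x != u -> y != u -> F x = F u -> F y = F u ->
     exists s : aut, s u = u /\ s x = y) ->
  forall x y, V x -> V y -> F x = F y -> swaps x y.
Proof.
move=> Vu hu; apply: (swaps_spread Vu) => y Vy Fy.
have [->|yu] := eqVneq y u; first exact: swaps_refl.
have [z [Vz Fz zu uz]] := swaps_partner Vu.
have [s [su sz]] := hu z y Vz Vy zu yu Fz Fy.
by rewrite -su -sz; apply: swaps_aut.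
Qed.

(** Being exchangeable is an equivalence relation on the fibre. Transitivity of the group makes its
    classes equally large, and the given transposition makes them larger than one point, so a prime
    number of points forms a single class. *)
Lemma swaps_of_prime_fiber u (s : seq algC) : V u -> uniq s -> prime (size s) ->
  (forall x, (x \in s) <-> V x /\ F x = F u) ->
  forall x y, V x -> V y -> F x = F y -> swaps x y.
Proof.
move=> Vu us prs sP; apply: (swaps_spread Vu) => y Vy Fy.
pose T := 'I_(size s); pose e (i : T) := s`_i.
have eP (i : T) : V (e i) /\ F (e i) = F u by apply/sP/mem_nth/ltn_ord.
have e_inj : injective e by move=> i j /eqP; rewrite nth_uniq // => /eqP/val_inj.
have eX z : V z -> F z = F u -> exists i, e i = z.
  move=> Vz Fz; have zs : z \in s by apply/sP.
  by rewrite -index_mem in zs; exists (Ordinal zs); rewrite /e nth_index // -index_mem.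
pose R (i j : T) := `[< swaps (e i) (e j) >].
pose cls (i : T) : {set T} := [set j : T | R i j]%SET.
have clsP i j : reflect (swaps (e i) (e j)) (j \in cls i).
  by rewrite inE; apply: asboolP.
have Req : {in [set: T] & &, equivalence_rel R}.
  move=> i j k _ _ _; split; first by apply/asboolP/swaps_refl.
  move=> /asboolP ij; apply/asboolP/asboolP => h.
    by apply: swaps_trans (swaps_sym ij) h; case: (eP j).
  by apply: swaps_trans ij h; case: (eP i).
have [i0 i0E] := eX u Vu erefl.
pose k := #|cls i0|.
have cardR i : #|cls i| = k.
  have [t ti] := V_trans (proj1 (eP i0)) (proj1 (eP i)).
  have tinv (r : aut) (j : T) : r (e i0) = e i \/ r (e i) = e i0 ->
      V (r (e j)) /\ F (r (e j)) = F u.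
    move=> h; split; first by apply: V_aut; case: (eP j).
    rewrite F_aut (proj2 (eP j)); case: h => h.
      by rewrite -(proj2 (eP i0)) -F_aut h (proj2 (eP i)) (proj2 (eP i0)).
    by rewrite -(proj2 (eP i)) -F_aut h (proj2 (eP i)) (proj2 (eP i0)).
  have ti' : aut_inv t (e i) = e i0 by rewrite -ti aut_VK.
  (* The action of r on indices; h guarantees that r maps the fibre to itself. *)
  pose f (r : aut) (h : r (e i0) = e i \/ r (e i) = e i0) j :=
    sval (cid (eX _ (proj1 (tinv r j h)) (proj2 (tinv r j h)))).
  have fE r h j : e (f r h j) = r (e j) by rewrite /f; case: (cid _).
  have f_inj r h : injective (f r h).
    by move=> j l fjl; apply/e_inj/(fmorph_inj r); rewrite -!fE fjl.
  apply/eqP; rewrite eqn_leq; apply/andP; split.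
    rewrite -(card_imset _ (f_inj (aut_inv t) (or_intror ti'))).
    apply/subset_leq_card/fintype.subsetP => _ /imsetP[j /clsP ij ->].
    apply/clsP; rewrite fE -ti'; exact: swaps_aut.
  rewrite -[k](card_imset (mem (cls i0)) (f_inj t (or_introl ti))).
  apply/subset_leq_card/fintype.subsetP => _ /imsetP[j /clsP ij ->].
  by apply/clsP; rewrite fE -ti; apply: swaps_aut.
have := card_uniform_partition (n := k) _ (equivalence_partitionP Req).
rewrite cardsT card_ord => /(_ _)/esym kdvd.
have {kdvd} kdvd : (k %| size s)%N.
  apply/dvdnP; exists #|equivalence_partition R [set: T]|; rewrite kdvd //.
  move=> A /imsetP[i _ ->]; rewrite -(cardR i); apply: eq_card => j.
  by rewrite !inE.
have ki : k = size s.
  move/primeP: prs => [_ /(_ k kdvd)/orP[/eqP k1|/eqP//]].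
  have [z [Vz Fz zu uz]] := swaps_partner Vu; have [j jE] := eX z Vz Fz.
  have /eqP/cards1P[l lE] := k1.
  have : i0 \in cls i0 by apply/clsP/swaps_refl.
  have : j \in cls i0 by apply/clsP; rewrite i0E jE.
  rewrite lE !inE => /eqP jl /eqP i0l.
  by move: zu; rewrite -jE -i0E jl i0l eqxx.
have [j jE] := eX y Vy Fy.
have : j \in cls i0.
  have /eqP -> : cls i0 == [set: T]; last by rewrite inE.
  by rewrite eqEcard finset.subsetT cardsT card_ord -/k ki /= leqnn.
by move/clsP; rewrite i0E jE.
Qed.

End Swaps.

(** Induction on the number of points moved: following b by the exchange of x and b x fixes x and
    moves no new point. *)
Lemma fiber_perm_generated (V : algC -> Prop) (F b : algC -> algC) (s : seq algC) :
  (forall x, V x -> x \in s) ->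
  (forall x y, V x -> V y -> F x = F y -> swaps V x y) ->
  (forall x, V x -> V (b x)) -> (forall x, V x -> F (b x) = F x) ->
  (forall x y, V x -> V y -> b x = b y -> x = y) ->
  exists t : aut, forall x, V x -> t x = b x.
Proof.
move=> Vs sw; move: {2}(count _ s).+1 (ltnSn (count (fun x => `[< V x >] && (b x != x)) s)) => n.
elim: n b => // n IH b cnt Vb Fb binj.
have [triv|] := pselect (forall x, V x -> b x = x).
  by exists (idfun : aut) => x Vx; rewrite triv.
move=> /existsNP[x /not_implyP[Vx /eqP bx]].
have [t [tx tb tz]] := sw x (b x) Vx (Vb x Vx) (esym (Fb x Vx)).
have tV z : V z -> t z = if z == x then b x else if z == b x then x else z.
  move=> Vz; have [->//|zx] := eqVneq z x.
  by have [->//|zb] := eqVneq z (b x); apply: tz.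
have [||||r rE] := IH (t \o b).
- rewrite -ltnS; apply: leq_trans cnt; rewrite ltnS.
  pose P z := `[< V z >] && (b z != z); pose P' z := `[< V z >] && (t (b z) != z).
  have P'x : P' x = false.
    by rewrite /P' (tV _ (Vb _ Vx)) (negPf bx) eqxx eqxx andbF.
  have sub z : P' z -> P z.
    move=> /andP[/asboolP Vz tbz]; apply/andP; split; first exact/asboolP.
    apply: contraNneq tbz => bz; rewrite bz tV //.
    have [zx|_] := eqVneq z x; first by rewrite -zx bz.
    have [zbx|//] := eqVneq z (b x).
    by rewrite (binj z x) // bz.
  have := count_predUI P' (pred1 x) s.
  have -> : count (predI P' (pred1 x)) s = 0%N.
    apply/eqP; rewrite -leqn0 leqNgt -has_count; apply/hasPn => z _ /=.
    by have [->|] := eqVneq z x; rewrite ?P'x ?andbF.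
  have : (0 < count (pred1 x) s)%N by rewrite -has_count has_pred1 Vs.
  have : (count (predU P' (pred1 x)) s <= count P s)%N.
    apply: sub_count => z /= /orP[/sub//|/eqP->].
    by rewrite /P bx andbT; apply/asboolP.
  rewrite addn0 => le one E; suff : (count P' s < count P s)%N by [].
  by apply: leq_trans le; rewrite E -addn1 leq_add2l.
- by move=> z Vz /=; rewrite (tV _ (Vb _ Vz)); case: eqP => // _; [|case: eqP => // _]; auto.
- move=> z Vz /=; rewrite (tV _ (Vb _ Vz)); have [bzx|_] := eqVneq (b z) x.
    by rewrite Fb // -bzx Fb.
  have [bzx|_] := eqVneq (b z) (b x); last exact: Fb.
  by rewrite (binj z x).
- move=> z w Vz Vw /= /fmorph_inj; exact: binj.
by exists (aut_inv t \o r) => z Vz /=; rewrite rE //= aut_VK.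
Qed.

Lemma iter_polyS (R : nzRingType) n (f : {poly R}) :
  iter_poly n.+1 f = iter_poly n f \Po f.
Proof. by []. Qed.

Lemma horner_iter_poly (R : comNzRingType) n (f : {poly R}) x :
  (iter_poly n f).[x] = iter n (horner f) x.
Proof.
elim: n x => [|n IH] x; first by rewrite /iter_poly /= hornerX.
by rewrite iter_polyS horner_comp IH iterSr.
Qed.

Lemma map_iter_poly (R S : comNzRingType) (g : {rmorphism R -> S}) n (f : {poly R}) :
  map_poly g (iter_poly n f) = iter_poly n (map_poly g f).
Proof.
elim: n => [|n IH]; first by rewrite /iter_poly /= map_polyX.
by rewrite !iter_polyS map_comp_poly IH.
Qed.

Lemma size_monic_iter_poly (R : idomainType) n (f : {poly R}) : (1 < size f)%N ->
  f \is monic -> iter_poly n f \is monic /\ size (iter_poly n f) = ((size f).-1 ^ n).+1.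
Proof.
move=> sf fm; elim: n => [|n [IHm IHs]].
  by rewrite /iter_poly /= monicX size_polyX expn0.
rewrite iter_polyS.
have sz : size (iter_poly n f \Po f) = ((size f).-1 ^ n.+1).+1.
  have := size_comp_poly (iter_poly n f) f; rewrite IHs /= -expnSr => <-.
  by rewrite prednK // size_poly_gt0 comp_poly_eq0 // -size_poly_eq0 IHs.
split=> //; rewrite monicE lead_coef_comp // (monicP fm) expr1n mulr1.
exact/eqP/monicP.
Qed.

(** * Iterates of phi *)

Section Dynamics.
Variables d c : nat.
Hypothesis d3 : (3 <= d)%N.

Lemma phi_dcE (x : int) : (phi_dc d c).[x] =
  x ^+ d.-1 * (x - (c * d)%:R) + (c * d.-1)%:R.
Proof.
have xd : x ^+ d = x ^+ d.-1 * x by rewrite -exprSr (ltn_predK d3).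
by rewrite /phi_dc !hornerE xd mulrBr [x ^+ _ * _%:R]mulrC.
Qed.

Definition phi_fun (x : algC) : algC := (phiC d c).[x].
Local Notation F := phi_fun.

Lemma phiCE : phiC d c = 'X^d - ((c * d)%:R) *: 'X^(d.-1) + ((c * d.-1)%:R)%:P.
Proof.
rewrite /phiC /phi_dc rmorphD rmorphB /= map_polyZ /= !map_polyXn map_polyC /=.
by rewrite !rmorph_nat.
Qed.

Lemma FE x : F x = x ^+ d.-1 * (x - (c * d)%:R) + (c * d.-1)%:R.
Proof.
have xd : x ^+ d = x ^+ d.-1 * x by rewrite -exprSr (ltn_predK d3).
by rewrite /phi_fun phiCE !hornerE xd mulrBr [x ^+ _ * _%:R]mulrC.
Qed.

Lemma size_phi_dc : size (phi_dc d c) = d.+1.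
Proof.
rewrite /phi_dc -addrA size_polyDl size_polyXn // ltnS.
rewrite (leq_trans (size_polyD _ _)) // geq_max; apply/andP; split.
  by rewrite size_polyN (leq_trans (size_scale_leq _ _)) // size_polyXn; lia.
by rewrite (leq_trans (size_polyC_leq1 _)) //; lia.
Qed.

Lemma monic_phi_dc : phi_dc d c \is monic.
Proof.
rewrite monicE /lead_coef size_phi_dc /phi_dc !coefD coefN coefZ !coefXn coefC.
have [e1 e2] : (d == d.-1) = false /\ (d == 0%N) = false by split; lia.
by rewrite eqxx /= e1 e2 mulr0 subr0 addr0.
Qed.

Lemma size_phiC : size (phiC d c) = d.+1.
Proof. by rewrite size_map_inj_poly ?size_phi_dc //; apply: intr_inj. Qed.

Lemma monic_phiC : phiC d c \is monic.
Proof. exact/monic_map/monic_phi_dc. Qed.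

Definition orbit0 n : int := iter n (horner (phi_dc d c)) 0.
Local Notation orb := orbit0.

Lemma F_int (m : int) : F m%:~R = ((phi_dc d c).[m])%:~R.
Proof. by rewrite /phi_fun /phiC horner_map. Qed.

Lemma iterF_orb n : iter n F 0 = (orb n)%:~R.
Proof. by elim: n => // n IH; rewrite /orbit0 !iterS IH F_int. Qed.

Lemma orb1 : orb 1 = (c * d.-1)%:R.
Proof. by rewrite /orbit0 /= phi_dcE expr0n; case: d d3 => [|[|k]] //= _; rewrite mul0r add0r. Qed.

Lemma iterF_crit n : iter n F (c * d.-1)%:R = (orb n.+1)%:~R.
Proof.
by rewrite -iterF_orb iterSr -[0 in RHS]/(0%:~R) F_int -[(phi_dc d c).[0]]/(orb 1) orb1 mulrz_nat.
Qed.

Definition fQ n : {poly rat} := map_poly intr (iter_poly n (phi_dc d c)).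

Lemma fQ_C n : pQC (fQ n) = iter_poly n (phiC d c).
Proof.
rewrite /fQ -map_poly_comp /phiC -map_iter_poly; apply: eq_map_poly => a /=.
by rewrite ratr_int.
Qed.

Lemma fQ_neq0 n : fQ n != 0.
Proof.
rewrite map_poly_eq0_id0 ?intr_eq0 //.
  by have [/monic_neq0] := @size_monic_iter_poly _ n (phi_dc d c) ltac:(by rewrite size_phi_dc; lia) monic_phi_dc.
rewrite lead_coef_eq0.
by have [/monic_neq0] := @size_monic_iter_poly _ n (phi_dc d c) ltac:(by rewrite size_phi_dc; lia) monic_phi_dc.
Qed.

Lemma root_fQ n x : root (pQC (fQ n)) x = (iter n F x == 0).
Proof. by rewrite fQ_C /root horner_iter_poly. Qed.

Lemma F_aut (s : aut) x : F (s x) = s (F x).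
Proof.
rewrite !FE; move: (c * d)%N (c * d.-1)%N => a b.
by rewrite rmorphD rmorphM /= rmorphXn rmorphB /= !rmorph_nat.
Qed.

Lemma iterF_aut (s : aut) n x : iter n F (s x) = s (iter n F x).
Proof. by elim: n => // n IH; rewrite !iterS IH F_aut. Qed.

Definition zero_at n x := iter n F x = 0.
Local Notation Z := zero_at.

Lemma Z_aut n (s : aut) x : Z n x -> Z n (s x).
Proof. by rewrite /zero_at iterF_aut => ->; rewrite rmorph0. Qed.

Lemma Z_F n x : Z n.+1 x -> Z n (F x).
Proof. by rewrite /zero_at iterSr. Qed.

Lemma F_fiber (a : algC) : exists s : seq algC, size s = d /\
  phiC d c - a%:P = \prod_(r <- s) ('X - r%:P).
Proof.
have [s sE] := closed_field_poly_normal (phiC d c - a%:P).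
have sz : size (phiC d c - a%:P) = d.+1.
  rewrite size_polyDl ?size_phiC // size_polyN (leq_ltn_trans (size_polyC_leq1 _)) //; lia.
have l1 : lead_coef (phiC d c - a%:P) = 1.
  rewrite lead_coefDl ?(monicP monic_phiC) // size_phiC size_polyN.
  by rewrite (leq_ltn_trans (size_polyC_leq1 _)) //; lia.
exists s; move: sE sz; rewrite l1 scale1r => ->; split=> //.
by move: sz; rewrite size_prod_XsubC => -[].
Qed.

Lemma F_surj (a : algC) : exists x, F x = a.
Proof.
have [s [ss sE]] := F_fiber a; case: s ss sE => [|r s] ss sE; first by move: d3; rewrite -ss.
exists r; have := congr1 (fun P => P.[r]) sE; rewrite big_cons !hornerE subrr mul0r.
by move/eqP; rewrite subr_eq0 => /eqP.
Qed.

Hypothesis irr : forall n, (1 <= n)%N -> irreducible_poly (fQ n).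

Lemma Z_trans n x y : Z n x -> Z n y -> exists s : aut, s x = y.
Proof.
case: n => [|n]; first by rewrite /zero_at /= => -> ->; exists (idfun : aut).
by move=> /eqP Zx /eqP Zy; apply: (aut_transitive (irr (ltn0Sn n))); rewrite root_fQ.
Qed.

Lemma irreducible_separable (f : {poly rat}) : irreducible_poly f -> separable_poly f.
Proof.
move=> [sf irrf]; rewrite unlock.
apply/negPn/negP => ncop.
have /irrf : size (gcdp f f^`()) != 1%N by rewrite -coprimep_def.
rewrite dvdp_gcdl => /(_ isT) /eqp_dvdl fE.
have : f %| f^`() by rewrite -fE dvdp_gcdr.
have df0 : f^`() != 0.
  have szf : (size f).-2.+1 = (size f).-1 by case: (size f) sf => [|[]].
  have : f^`()`_(size f).-2 != 0.
    rewrite coef_deriv szf mulrn_eq0 negb_or -/(lead_coef f) lead_coef_eq0.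
    by rewrite -size_poly_eq0; case: (size f) sf => [|[]].
  by apply: contraNneq => ->; rewrite coef0.
move/(dvdp_leq df0); rewrite leqNgt => /negP; apply.
by apply: lt_size_deriv; rewrite -size_poly_gt0; lia.
Qed.

Lemma Z_seq n : exists s : seq algC, [/\ uniq s, forall x, (x \in s) = (iter n F x == 0) &
  forall x, iter n F x = \prod_(r <- s) (x - r)].
Proof.
case: n => [|n].
  by exists [:: 0]; split=> // x; rewrite ?inE // big_seq1 subr0.
have [|mon _] := @size_monic_iter_poly _ n.+1 (phiC d c) _ monic_phiC.
  by rewrite size_phiC; lia.
have [s sE] := closed_field_poly_normal (iter_poly n.+1 (phiC d c)).
rewrite (monicP mon) scale1r in sE.
exists s; split.
- rewrite -separable_prod_XsubC -sE -fQ_C separable_map.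
  by apply/irreducible_separable/irr.
- by move=> x; rewrite -root_prod_XsubC -sE /root horner_iter_poly.
- move=> x; rewrite -horner_iter_poly sE horner_prod.
  by apply: eq_bigr => r _; rewrite !hornerE.
Qed.

End Dynamics.

(** * From levels to the whole tree *)

Section UltraLimit.
Local Open Scope classical_set_scope.
Local Open Scope ring_scope.

Lemma ultra_seq_cover (T : Type) (K : eqType) (U : set_system T) (f : T -> K) (s : seq K) :
  UltraFilter U -> U [set k | f k \in s] -> exists y, U [set k | f k = y].
Proof.
move=> UU; elim: s => [|y s IH] Us.
  have /filter_ex [k] := Us; by rewrite /= in_nil.
have [Uy|nUy] := in_ultra_setVsetC [set k | f k = y] UU; first by exists y.
apply: IH; apply: filterS (filterI Us nUy) => k [/=].
by rewrite inE => /predU1P[].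
Qed.

Lemma aut_image_finite x : exists s : seq algC, forall t : aut, t x \in s.
Proof.
have [s sE] := closed_field_poly_normal (minCpoly x).
exists s => t; rewrite -root_prod_XsubC.
have := root_minCpoly (t x); rewrite minCpoly_aut sE rootZ //.
by rewrite lead_coef_eq0 minCpoly_eq0.
Qed.

(* Each x takes finitely many values under the automorphisms, so the pointwise limit along an ultrafilter exists. *)
Lemma aut_limit (f : nat -> aut) : exists s : aut,
  forall x y, (exists N, forall k, (N <= k)%N -> f k x = y) -> s x = y.
Proof.
have [U [UU Uoo]] := ultraFilterLemma eventually_filter.
have FU : ProperFilter U by exact: ultra_proper.
have UI A B : U A -> U B -> U (A `&` B) by apply: filterI.
have ex x : exists y, U [set k | f k x = y].
  have [s hs] := aut_image_finite x; apply: (ultra_seq_cover (s := s)).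
  by apply: filterS filterT => k _; apply: hs.
pose g x := sval (cid (ex x)).
have gU x : U [set k | f k x = g x] by rewrite /g; case: (cid _).
have ga : zmod_morphism g.
  move=> x y; have /filter_ex [k [[/= e1 e2] e3]] :=
    UI _ _ (UI _ _ (gU (x - y)) (gU x)) (gU y).
  by rewrite -e1 -e2 -e3 rmorphB.
have gm : monoid_morphism g.
  split=> [|x y].
    by have /filter_ex [k /= <-] := gU 1; rewrite rmorph1.
  have /filter_ex [k [[/= e1 e2] e3]] :=
    UI _ _ (UI _ _ (gU (x * y)) (gU x)) (gU y).
  by rewrite -e1 -e2 -e3 rmorphM.
pose gaM := GRing.isZmodMorphism.Build algC algC g ga.
pose gmM := GRing.isMonoidMorphism.Build algC algC g gm.
pose gRM : aut := HB.pack g gaM gmM.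
exists gRM => x y [N hN]; have UN : U [set k | (N <= k)%N] by apply: Uoo; exists N.
by have /filter_ex [k [/= <- /hN]] := UI _ _ (gU x) UN.
Qed.

End UltraLimit.

Section Tree.
Variables d c : nat.
Hypothesis d3 : (3 <= d)%N.
Hypothesis irr : forall n, (1 <= n)%N -> irreducible_poly (fQ d c n).
Local Notation F := (phi_fun d c).
Local Notation Z := (zero_at d c).
Local Notation phi := (phiC d c).

Lemma vertexP n x : Z n x -> root (iter_poly n phi) x.
Proof. by move=> Zx; rewrite /root horner_iter_poly; apply/eqP. Qed.

Definition mkvertex n x (h : Z n x) : vertex phi := exist _ (n, x) (vertexP h).

Lemma pt_Z (v : vertex phi) : Z (level v) (pt v).
Proof.
case: v => [[n x] h]; rewrite /level /pt /=; move: h.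
by rewrite /= /root horner_iter_poly => /eqP.
Qed.

Lemma vertex_eq (v w : vertex phi) : level v = level w -> pt v = pt w -> v = w.
Proof.
case: v w => [[n x] h] [[m y] k]; rewrite /level /pt /= => nm xy.
by apply: val_inj; rewrite /= nm xy.
Qed.

Lemma tree_aut_pt_F a n x (h : Z n.+1 x) (h' : Z n (F x)) : tree_aut a ->
  pt (a (mkvertex h')) = F (pt (a (mkvertex h))).
Proof.
move=> [_ [_ ae]]; have /ae[_] // : tedge (mkvertex h') (mkvertex h).
by split.
Qed.

Definition agree (f g : vertex phi -> algC) n := forall v, level v = n -> f v = g v.

Lemma exists_child (v : vertex phi) : exists (x : algC) (h : Z (level v).+1 x)
   (h' : Z (level v) (F x)), v = mkvertex h'.
Proof.
have [x xE] := F_surj c d3 (pt v).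
have h' : Z (level v) (F x) by rewrite xE; apply: pt_Z.
have h : Z (level v).+1 x by rewrite /zero_at iterSr; apply: h'.
by exists x, h, h'; apply: vertex_eq.
Qed.

Lemma agree_down a (s : aut) n m : tree_aut a -> (m <= n)%N ->
  agree (fun v => pt (a v)) (fun v => s (pt v)) n ->
  agree (fun v => pt (a v)) (fun v => s (pt v)) m.
Proof.
move=> ta /subnK <-; elim: (n - m)%N => // k IH; rewrite addSn => h.
apply: IH => v lv; have [x [hx [h' ->]]] := exists_child v.
rewrite (tree_aut_pt_F hx h' ta) h; first by rewrite F_aut.
by change ((level v).+1 = (k + m).+1); rewrite lv.
Qed.

(** For n >= 1 this means that the automorphisms fixing level n - 1 induce on level n the full
    product of the symmetric groups of the fibres. *)
Definition full_level n := forall x y, Z n x -> Z n y -> F x = F y -> swaps (Z n) x y.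

(** If s realises a on level m, then s^-1 a is trivial there, so it permutes each fibre of level m +
    1 and is realised by some t; then s t realises a on level m + 1. *)
Lemma tree_aut_level_realized a n0 n : tree_aut a ->
  (forall m, (n0 < m)%N -> full_level m) ->
  agree (fun v => pt (a v)) (@pt phi) n0 ->
  exists s : aut, agree (fun v => pt (a v)) (fun v => s (pt v)) (n0 + n).
Proof.
move=> ta full a0; elim: n => [|n [s IH]].
  by rewrite addn0; exists (idfun : aut).
rewrite addnS; set m := (n0 + n)%N in IH *.
pose b x := if pselect (Z m.+1 x) is left h then aut_inv s (pt (a (mkvertex h))) else x.
have bE x (h : Z m.+1 x) : b x = aut_inv s (pt (a (mkvertex h))).
  by rewrite /b; case: pselect => // h1; rewrite (Prop_irrelevance h1 h).
have la v : level (a v) = level v by case: ta => _ [].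
have [S [_ SE _]] := Z_seq d3 irr m.+1.
have [|||||t tE] := @fiber_perm_generated (Z m.+1) F b S.
- by move=> x Zx; rewrite SE; apply/eqP.
- by apply: full; rewrite ltnS leq_addr.
- move=> x h; rewrite (bE x h); apply: Z_aut => //.
  by have := pt_Z (a (mkvertex h)); rewrite la.
- move=> x h; rewrite (bE x h) F_aut //.
  have h' : Z m (F x) by apply: Z_F.
  by rewrite -(tree_aut_pt_F h h' ta) IH // aut_VK.
- move=> x y hx hy; rewrite (bE x hx) (bE y hy) => /(fmorph_inj (aut_inv s)) axy.
  have [a_bij _] := ta; have := bij_inj a_bij.
  move=> /(_ (mkvertex hx) (mkvertex hy)) inj.
  have := inj _ => /(_ _)/(congr1 (@pt phi)); apply.
  by apply: vertex_eq => //; rewrite !la.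
exists (s \o t : aut) => v lv.
have h : Z m.+1 (pt v) by rewrite -lv; apply: pt_Z.
have -> : v = mkvertex h by apply: vertex_eq.
by rewrite [pt (mkvertex h)]/= /= tE // (bE _ h) aut_KV.
Qed.

(** The realisations of single levels have a limit automorphism; agreement on a level implies
    agreement on all lower ones, so every vertex stabilises. *)
Lemma tree_aut_trivial_galois a n0 : tree_aut a ->
  (forall m, (n0 < m)%N -> full_level m) ->
  agree (fun v => pt (a v)) (@pt phi) n0 -> galois_image a.
Proof.
move=> ta full a0.
have ex n := tree_aut_level_realized n ta full a0.
pose f n := sval (cid (ex n)).
have fP n : agree (fun v => pt (a v)) (fun v => f n (pt v)) (n0 + n).
  by rewrite /f; case: (cid _).
have [s sP] := aut_limit f; exists s; split.
  by exists (aut_inv s); [apply: aut_VK | apply: aut_KV].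
move=> v; apply/esym/sP; exists (level v) => k lk; apply/esym.
exact: (agree_down ta (leq_trans lk (leq_addl n0 k)) (fP k)).
Qed.

Theorem full_levels_galois_full : (forall m, (0 < m)%N -> full_level m) ->
  galois_image_full phi.
Proof.
move=> full a ta; apply: (@tree_aut_trivial_galois a 0%N) => // v lv.
have := pt_Z v; have := pt_Z (a v); have [_ [-> _]] := ta; rewrite lv /zero_at /=.
by move=> -> ->.
Qed.

Lemma tree_aut_id : tree_aut (@id (vertex phi)).
Proof. by split; [exists id | split]. Qed.

Lemma tree_aut_comp (a b : vertex phi -> vertex phi) :
  tree_aut a -> tree_aut b -> tree_aut (a \o b).
Proof.
move=> [ab [al ae]] [bb [bl be]]; split; first exact: bij_comp.
split=> [v|v w] /=; first by rewrite al bl.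
by rewrite be ae.
Qed.

Lemma tree_aut_inv (a : vertex phi -> vertex phi) : tree_aut a ->
  exists b, [/\ tree_aut b, cancel a b & cancel b a].
Proof.
move=> [[b ab ba] [al ae]]; exists b; split=> //; split; first by exists a.
split=> [v|v w]; first by rewrite -al ba.
by have := ae (b v) (b w); rewrite !ba => ->.
Qed.

(** Two tree automorphisms with the same action on level n0 differ by one that is trivial there,
    hence by a Galois one, and only finitely many actions are possible. *)
Theorem full_high_levels_finite_index n0 : (forall m, (n0 < m)%N -> full_level m) ->
  finite_index_in_aut phi.
Proof.
move=> full; have [S [uS SE _]] := Z_seq d3 irr n0.
have SZ (i : 'I_(size S)) : Z n0 S`_i by apply/eqP; rewrite -SE mem_nth.
have v0 (v : vertex phi) : level v = n0 -> pt v \in S.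
  by move=> lv; rewrite SE -lv; apply/eqP/pt_Z.
pose idx x : 'I_(size S).+1 := inord (index x S).
have idxE x : x \in S -> (idx x = index x S :> nat).
  by move=> xS; rewrite inordK // ltnS ltnW // index_mem.
pose code (a : vertex phi -> vertex phi) : {ffun 'I_(size S) -> 'I_(size S).+1} :=
  [ffun i => idx (pt (a (mkvertex (SZ i))))].
have codeP a b : tree_aut a -> tree_aut b -> code a = code b ->
    agree (fun v => pt (a v)) (fun v => pt (b v)) n0.
  move=> [_ [la _]] [_ [lb _]] /ffunP ab v lv.
  have vS := v0 v lv; have iS : (index (pt v) S < size S)%N by rewrite index_mem.
  have := ab (Ordinal iS); rewrite !ffunE.
  have -> : mkvertex (SZ (Ordinal iS)) = v.
    by apply: vertex_eq; rewrite /= ?lv // /pt /= nth_index.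
  move/(congr1 (@nat_of_ord _)); rewrite !idxE ?v0 ?la ?lb //.
  by move/(congr1 (nth 0 S)); rewrite !nth_index ?v0 ?la ?lb.
pose rep (g : {ffun 'I_(size S) -> 'I_(size S).+1}) : vertex phi -> vertex phi :=
  if pselect (exists a, tree_aut a /\ code a = g) is left h then sval (cid h) else id.
have repP g : tree_aut (rep g).
  by rewrite /rep; case: pselect => [h|_]; [case: (cid h) => a [] | apply: tree_aut_id].
have repE a : tree_aut a -> code (rep (code a)) = code a.
  move=> ta; rewrite /rep; case: pselect => [h|[]]; last by exists a.
  by case: (cid h) => b [].
exists [seq rep g | g <- enum {: {ffun 'I_(size S) -> 'I_(size S).+1}}]; split.
  by move=> _ /mapP[g _ ->].
move=> a ta; exists (rep (code a)); first by apply: map_f; rewrite mem_enum.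
have [b [tb bK Kb]] := tree_aut_inv (repP (code a)).
exists (b \o a); split; first exact: tree_aut_comp.
split=> [|v]; last by rewrite /= Kb.
apply: (@tree_aut_trivial_galois _ n0) => //; first exact: tree_aut_comp.
move=> v lv /=; have := codeP _ _ (repP (code a)) ta (repE a ta) v lv.
have [_ [la _]] := ta; have [_ [lr _]] := repP (code a).
move=> rv; have -> : a v = rep (code a) v; last by rewrite bK.
by apply: vertex_eq; rewrite ?la ?lr.
Qed.
End Tree.

(** * Congruences modulo the maximal ideal of a valuation *)

Definition val_gt0 (K : fieldType) (v : K -> rat) (x : K) : bool := (x == 0) || (0 < v x).

Section Small.
Variables (K : fieldType) (p : nat) (v : K -> rat).
Hypotheses (Hv : is_val p v).
Local Notation small := (val_gt0 v).

Lemma small0 : small 0. Proof. by rewrite /val_gt0 eqxx. Qed.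

Lemma small_vge x : small x -> vge v 0 x.
Proof. by case/orP=> h; rewrite /vge ?h // ltW ?orbT. Qed.

Lemma smallN x : small (- x) = small x.
Proof. by rewrite /val_gt0 oppr_eq0 (valN Hv). Qed.

Lemma small_subC x y : small (x - y) = small (y - x).
Proof. by rewrite -smallN opprB. Qed.

Lemma smallD x y : small x -> small y -> small (x + y).
Proof.
rewrite /val_gt0; have [->|x0] := eqVneq x 0; first by rewrite add0r.
have [->|y0 /= hx hy] := eqVneq y 0; first by rewrite addr0 (negPf x0).
have [//|xy0] /= := eqVneq (x + y) 0.
by apply: lt_le_trans (valD Hv x0 y0 xy0); rewrite lt_min hx.
Qed.

Lemma smallB x y : small x -> small y -> small (x - y).
Proof. by move=> hx hy; rewrite smallD ?smallN. Qed.

Lemma small_trans x y z : small (x - y) -> small (y - z) -> small (x - z).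
Proof. by move=> h1 h2; have := smallD h1 h2; rewrite addrA subrK. Qed.

Lemma small_congr x y : small (x - y) -> small x = small y.
Proof.
move=> h; apply/idP/idP => hx; last by rewrite -(subrK y x) smallD.
by rewrite -(subKr x y) smallB.
Qed.

Lemma small_mul x y : vge v 0 x -> small y -> small (x * y).
Proof.
rewrite /vge /val_gt0 mulf_eq0; have [->|x0] //= := eqVneq x 0.
have [->|y0 /= hx hy] //= := eqVneq y 0.
by rewrite (valM Hv) // ltr_wpDl.
Qed.

Lemma small_mulr x y : small x -> vge v 0 y -> small (x * y).
Proof. by move=> hx hy; rewrite mulrC small_mul. Qed.

Lemma small_sum (I : eqType) (s : seq I) (f : I -> K) :
  (forall i, i \in s -> small (f i)) -> small (\sum_(i <- s) f i).
Proof.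
move=> hf; rewrite big_seq_cond; elim/big_ind: _ => [|x y|i /andP[/hf]//].
  exact: small0.
exact: smallD.
Qed.

Lemma nsmallE x : vge v 0 x -> ~~ small x -> x != 0 /\ v x = 0.
Proof.
rewrite /vge /val_gt0 negb_or -leNgt; have [->|x0] //= := eqVneq x 0.
by move=> h1 h2; split=> //; apply/eqP; rewrite eq_le h2.
Qed.

Lemma small_mulE x y : vge v 0 x -> vge v 0 y -> small (x * y) = small x || small y.
Proof.
move=> hx hy; apply/idP/orP => [h|[h|h]]; last 2 first.
- by rewrite small_mulr.
- by rewrite small_mul.
have [?|/(nsmallE hx)[x0 vx]] := boolP (small x); first by left.
have [?|/(nsmallE hy)[y0 vy]] := boolP (small y); first by right.
move: h; rewrite /val_gt0 mulf_eq0 (negPf x0) (negPf y0) (valM Hv) // vx vy.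
by rewrite addr0 ltxx.
Qed.

Lemma small_exp x n : vge v 0 x -> small (x ^+ n) -> small x.
Proof.
move=> hx; elim: n => [|n IH]; first by rewrite /val_gt0 oner_eq0 (val1 Hv) ltxx.
by rewrite exprS small_mulE ?(vgeX Hv) // => /orP[].
Qed.

Lemma nsmall1 : ~~ small 1.
Proof. by rewrite /val_gt0 oner_eq0 (val1 Hv) ltxx. Qed.

Lemma small_prod (s : seq K) (f : K -> K) : (forall i, i \in s -> vge v 0 (f i)) ->
  small (\prod_(i <- s) f i) -> exists2 i, i \in s & small (f i).
Proof.
elim: s => [|x s IH] hs; first by rewrite big_nil (negPf nsmall1).
rewrite big_cons small_mulE ?hs ?mem_head //; last first.
  rewrite big_seq_cond; apply: (vge_prod Hv) => i /andP[si _].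
  by rewrite hs // inE si orbT.
case/orP=> [hx|]; first by exists x; rewrite ?mem_head.
case/IH=> [i si|i si hi]; first by rewrite hs // inE si orbT.
by exists i; rewrite // inE si orbT.
Qed.

Lemma val_prod_unit (s : seq K) (f : K -> K) : (forall i, i \in s -> vge v 0 (f i)) ->
  (forall i, i \in s -> ~~ small (f i)) ->
  \prod_(i <- s) f i != 0 /\ v (\prod_(i <- s) f i) = 0.
Proof.
move=> hs ns; apply: nsmallE.
  rewrite big_seq_cond; apply: (vge_prod Hv) => i /andP[si _]; exact: hs.
by apply/negP => /(small_prod hs)[i /ns/negP].
Qed.

Lemma small_subX x y n : vge v 0 x -> vge v 0 y -> small (x - y) ->
  small (x ^+ n - y ^+ n).
Proof.
move=> hx hy hxy; elim: n => [|n IH]; first by rewrite !expr0 subrr small0.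
have -> : x ^+ n.+1 - y ^+ n.+1 = x * (x ^+ n - y ^+ n) + (x - y) * y ^+ n.
  by rewrite !exprS; ring.
by apply: smallD; [apply: small_mul | apply: small_mulr => //; apply: (vgeX Hv)].
Qed.

Lemma small_int (m : int) : prime p -> small m%:~R = (p %| `|m|)%N.
Proof.
move=> pp; have [->|m0] := eqVneq m 0; first by rewrite small0 dvdn0.
have [mK vm] := val_int Hv pp m0; rewrite /val_gt0 (negPf mK) vm /= ltr0n.
by rewrite logn_gt0 mem_primes pp absz_gt0 m0.
Qed.

Lemma small_nat m : prime p -> small m%:R = (p %| m)%N.
Proof. exact: (small_int m%:Z). Qed.

Lemma vge_horner (P : {poly K}) x : (forall i, vge v 0 P`_i) -> vge v 0 x -> vge v 0 P.[x].
Proof.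
move=> hP hx; rewrite horner_coef; apply: (vge_sum Hv) => i _.
by apply: (vge_mul0 Hv) => //; apply: (vgeX Hv).
Qed.

Lemma vge_deriv_coef (P : {poly K}) : (forall i, vge v 0 P`_i) -> forall i, vge v 0 P^`()`_i.
Proof.
move=> hP i; rewrite coef_deriv -mulr_natr; apply: (vge_mul0 Hv) => //.
exact: (vge_nat Hv).
Qed.

Lemma vge_prod_XsubC_coef (s : seq K) : (forall r, r \in s -> vge v 0 r) ->
  forall i, vge v 0 (\prod_(r <- s) ('X - r%:P))`_i.
Proof.
elim: s => [|r s IH] hs i.
  by rewrite big_nil coef1; case: eqP => _; [apply: (vge1 Hv) | apply: vge0].
rewrite big_cons mulrBl coefB coefXM coefCM; apply: (vgeB Hv).
  by case: eqP => _; [apply: vge0 | apply: IH => t ts; rewrite hs // inE ts orbT].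
apply: (vge_mul0 Hv); first by rewrite hs ?mem_head.
by apply: IH => t ts; rewrite hs // inE ts orbT.
Qed.

End Small.

(** Grouped so that each summand has one of g - x, g - y, g - z as a factor: the value is small when
    g is congruent to all three. *)
Lemma deriv2_triple (x y z g : algC) (S : {poly algC}) :
  (('X - x%:P) * (('X - y%:P) * (('X - z%:P) * S)))^`()^`().[g] =
   (g - x) * ((g - y) * (g - z) * S^`()^`().[g]
     + 2%:R * (g - y + (g - z)) * S^`().[g] + 2%:R * S.[g])
   + (g - y) * (2%:R * (g - z) * S^`().[g] + 2%:R * S.[g])
   + (g - z) * (2%:R * S.[g]).
Proof.
have dM (a : algC) (P : {poly algC}) : (('X - a%:P) * P)^`() = P + ('X - a%:P) * P^`().
  by rewrite derivM derivXsubC mul1r.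
do 8?rewrite ?dM ?derivD; have hM (a : algC) (P : {poly algC}) :
  (('X - a%:P) * P).[g] = (g - a) * P.[g] by rewrite hornerM hornerXsubC.
by do 12?rewrite ?hM ?hornerD; ring.
Qed.

(** * Reduction of phi modulo p *)

Section Reduction.
Variables d c : nat.
Hypothesis d3 : (3 <= d)%N.
Local Notation F := (phi_fun d c).
Local Notation Z := (zero_at d c).
Local Notation orb := (orbit0 d c).
Local Notation gam := ((c * d.-1)%:R : algC).
Variables (p : nat) (v : algC -> rat).
Hypotheses (Hv : is_val p v) (pp : prime p).
Local Notation small := (val_gt0 v).

Lemma vge_F x : vge v 0 x -> vge v 0 (F x).
Proof.
move=> hx; rewrite FE //; apply: (vgeD Hv); last exact: (vge_nat Hv).
apply: (vge_mul0 Hv); first exact: (vgeX Hv).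
by apply: (vgeB Hv) => //; apply: (vge_nat Hv).
Qed.

(** The map is monic with integral coefficients, so at a pole of x the top power dominates and F x
    has a pole too. *)
Lemma vge_F_inv x : vge v 0 (F x) -> vge v 0 x.
Proof.
apply: contraTT; rewrite /vge negb_or -ltNge => /andP[x0 vx].
have hcd : vge v 0 (- (c * d)%:R) by rewrite (vgeN Hv) (vge_nat Hv).
have [y0 vy] := val_dom Hv x0 vx hcd.
have m0 : x ^+ d.-1 * (x - (c * d)%:R) != 0 by rewrite mulf_neq0 ?expf_neq0.
have vm : v (x ^+ d.-1 * (x - (c * d)%:R)) < 0.
  rewrite (valM Hv) ?expf_neq0 // (valX Hv) // vy.
  by rewrite -[X in _ + X]mul1r -mulrDl pmulr_rlt0 // ltr_wpDl ?ler0n ?ltr01.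
have [z0 vz] := val_dom Hv m0 vm (vge_nat Hv (c * d.-1)).
by rewrite FE // negb_or z0 -ltNge vz.
Qed.

Lemma vge_Z n x : Z n x -> vge v 0 x.
Proof.
elim: n x => [|n IH] x; first by rewrite /zero_at /= => ->; apply: vge0.
by move=> Zx; apply/vge_F_inv/IH/Z_F.
Qed.

Lemma small_F x y : vge v 0 x -> vge v 0 y -> small (x - y) -> small (F x - F y).
Proof.
move=> hx hy hxy; rewrite !FE //.
have -> : x ^+ d.-1 * (x - (c * d)%:R) + gam - (y ^+ d.-1 * (y - (c * d)%:R) + gam) =
  (x ^+ d.-1 - y ^+ d.-1) * (x - (c * d)%:R) + y ^+ d.-1 * (x - y) by ring.
have hxc : vge v 0 (x - (c * d)%:R) by apply: (vgeB Hv) => //; apply: (vge_nat Hv).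
apply: (smallD Hv); first by apply: (small_mulr Hv) => //; apply: (small_subX Hv).
by apply: (small_mul Hv) => //; apply: (vgeX Hv).
Qed.

Lemma vge_iterF n x : vge v 0 x -> vge v 0 (iter n F x).
Proof. by move=> hx; elim: n => //= n IH; apply: vge_F. Qed.

Lemma small_iterF n x y : vge v 0 x -> vge v 0 y -> small (x - y) ->
  small (iter n F x - iter n F y).
Proof.
move=> hx hy hxy; elim: n => //= n IH; apply: small_F => //; exact: vge_iterF.
Qed.

Lemma deriv_phiCE : (phiC d c)^`() = d%:R *: ('X^(d.-2) * ('X - gam%:P)).
Proof.
have pX : 'X^(d.-1) = 'X * 'X^(d.-2) :> {poly algC}.
  by rewrite -exprS; congr ('X^_); clear -d3; lia.
rewrite phiCE derivD derivB derivZ !derivXn derivC addr0 pX.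
rewrite -!mul_polyC -[('X * _) *+ d]mulr_natr -['X^_ *+ _]mulr_natr !polyC_natr !natrM.
move: ('X^(d.-2) : {poly algC}) (d%:R : {poly algC}) (d.-1%:R : {poly algC}) => a e f.
by move: (c%:R : {poly algC}) => g; ring.
Qed.

Lemma deriv_phiC x : (phiC d c)^`().[x] = d%:R * (x ^+ d.-2 * (x - gam)).
Proof. by rewrite deriv_phiCE hornerZ hornerM hornerXn hornerXsubC. Qed.

Lemma deriv2_phiC_crit : (phiC d c)^`()^`().[gam] = d%:R * gam ^+ d.-2.
Proof.
rewrite deriv_phiCE derivZ hornerZ derivM derivXsubC hornerD !hornerM hornerXsubC.
by rewrite subrr mulr0 add0r hornerXn hornerC mulr1.
Qed.

Lemma fiber_mem (a : algC) (s : seq algC) : phiC d c - a%:P = \prod_(r <- s) ('X - r%:P) ->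
  forall x, (x \in s) = (F x == a).
Proof.
move=> sE x; rewrite -root_prod_XsubC -sE /root /phi_fun !hornerE.
by rewrite subr_eq0.
Qed.

Lemma deriv_phiC_fiber (a : algC) : (phiC d c - a%:P)^`() = (phiC d c)^`().
Proof. by rewrite derivB derivC subr0. Qed.

Lemma vge_fiber (a : algC) (s : seq algC) : vge v 0 a ->
  phiC d c - a%:P = \prod_(r <- s) ('X - r%:P) -> forall r, r \in s -> vge v 0 r.
Proof. by move=> ha sE r; rewrite (fiber_mem sE) => /eqP rE; apply: vge_F_inv; rewrite rE. Qed.

Hypothesis pd : ~~ (p %| d)%N.

(** The derivative at x is the product of x - r over the other points r of its fibre, so it is
    small; but it equals d x^(d-2) (x - gam), and p does not divide d. *)
Lemma congruent_preimages x y : vge v 0 x -> vge v 0 y -> x != y -> F x = F y ->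
  small (x - y) -> small x || small (x - gam).
Proof.
move=> hx hy xy Fxy hxy; have [s [ss sE]] := F_fiber c d3 (F x).
have hs := vge_fiber (vge_F hx) sE.
have xs : x \in s by rewrite (fiber_mem sE).
have ys : y \in rem x s.
  have : y \in s by rewrite (fiber_mem sE) Fxy.
  by rewrite (perm_mem (perm_to_rem xs)) inE eq_sym (negPf xy).
set S := \prod_(r <- rem y (rem x s)) ('X - r%:P).
have hS : vge v 0 S.[x].
  apply: (vge_horner Hv) => //; apply: (vge_prod_XsubC_coef Hv) => r rs.
  by apply: hs; apply: (mem_rem (x := x)); apply: (mem_rem rs).
have dE : d%:R * (x ^+ d.-2 * (x - gam)) = (x - y) * S.[x].
  rewrite -deriv_phiC -(deriv_phiC_fiber (F x)) sE.
  rewrite (perm_big _ (perm_to_rem xs)) big_cons /= (perm_big _ (perm_to_rem ys)) big_cons /=.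
  by rewrite derivM derivXsubC derivM derivXsubC !hornerE subrr mul0r addr0.
have : small (d%:R * (x ^+ d.-2 * (x - gam))) by rewrite dE (small_mulr Hv).
have hxg : vge v 0 (x - gam) by apply: (vgeB Hv) => //; apply: (vge_nat Hv).
rewrite (small_mulE Hv) ?(vge_nat Hv) ?(vge_mul0 Hv) ?(vgeX Hv) //.
rewrite (small_nat Hv _ pp) (negPf pd) /= (small_mulE Hv) ?(vgeX Hv) //.
by case/orP=> [/(small_exp Hv hx)->//|->]; rewrite orbT.
Qed.

(* A third preimage congruent to gam would make the second derivative of phi at gam, d * gam ^ (d - 2), non-unit. *)
Lemma at_most_two_near_crit x y z : vge v 0 x -> x != y -> x != z -> y != z ->
  F x = F y -> F x = F z -> small (x - gam) -> small (y - gam) -> small (z - gam) ->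
  (p %| c * d.-1)%N.
Proof.
move=> hx xy xz yz Fxy Fxz sx sy sz; have [s [ss sE]] := F_fiber c d3 (F x).
have hs := vge_fiber (vge_F hx) sE.
have xs : x \in s by rewrite (fiber_mem sE).
have ys : y \in rem x s.
  have : y \in s by rewrite (fiber_mem sE) Fxy.
  by rewrite (perm_mem (perm_to_rem xs)) inE eq_sym (negPf xy).
have zs : z \in rem y (rem x s).
  have : z \in s by rewrite (fiber_mem sE) Fxz.
  rewrite (perm_mem (perm_to_rem xs)) inE eq_sym (negPf xz) /=.
  by rewrite (perm_mem (perm_to_rem ys)) inE eq_sym (negPf yz).
set S := \prod_(r <- rem z (rem y (rem x s))) ('X - r%:P).
have hS : forall i, vge v 0 S`_i.
  apply: (vge_prod_XsubC_coef Hv) => r rs; apply: hs; apply: (mem_rem (x := x)).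
  by apply: (mem_rem (x := y)); apply: (mem_rem rs).
have hg := vge_nat Hv (c * d.-1).
have hS0 := vge_horner Hv hS hg.
have hS1 := vge_horner Hv (vge_deriv_coef Hv hS) hg.
have hS2 := vge_horner Hv (vge_deriv_coef Hv (vge_deriv_coef Hv hS)) hg.
have dE : d%:R * gam ^+ d.-2 = (('X - x%:P) * (('X - y%:P) * (('X - z%:P) * S)))^`()^`().[gam].
  rewrite -deriv2_phiC_crit -(deriv_phiC_fiber (F x)) sE (perm_big _ (perm_to_rem xs)) big_cons /=.
  rewrite (perm_big _ (perm_to_rem ys)) big_cons /=.
  by rewrite (perm_big _ (perm_to_rem zs)) big_cons.
rewrite deriv2_triple in dE.
have sx' : small (gam - x) by rewrite (small_subC Hv).
have sy' : small (gam - y) by rewrite (small_subC Hv).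
have sz' : small (gam - z) by rewrite (small_subC Hv).
have h2 : vge v 0 (2%:R : algC) by apply: (vge_nat Hv).
have [hx' hy' hz'] : [/\ vge v 0 (gam - x), vge v 0 (gam - y) & vge v 0 (gam - z)].
  by split; apply: small_vge.
have : small (d%:R * gam ^+ d.-2).
  rewrite dE; apply: (smallD Hv); [apply: (smallD Hv)|]; apply: (small_mulr Hv) => //;
    by repeat first [assumption | apply: (vgeD Hv) | apply: (vge_mul0 Hv)].
rewrite (small_mulE Hv) ?(vge_nat Hv) ?(vgeX Hv) // (small_nat Hv _ pp) (negPf pd) /=.
by move/(small_exp Hv hg); rewrite (small_nat Hv _ pp).
Qed.

End Reduction.

(** Divided derivatives keep the Taylor coefficients integral. *)
Lemma taylor2 (K : fieldType) (p : nat) (v : K -> rat) (P : {poly K}) x h :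
  is_val p v -> (forall i, vge v 0 P`_i) -> vge v 0 x -> vge v 0 h ->
  exists2 R, vge v 0 R & P.[x + h] = P.[x] + P^`().[x] * h + P^`N(2).[x] * h ^+ 2 + R * h ^+ 3.
Proof.
move=> Hv hP hx hh.
have hN n : vge v 0 P^`N(n).[x].
  apply: (vge_horner Hv) => // i; rewrite coef_nderivn -mulr_natr.
  by apply: (vge_mul0 Hv) => //; apply: (vge_nat Hv).
have sz : (size P <= (size P).+3)%N by rewrite !leqW.
exists (\sum_(i < size P) P^`N(i.+3).[x] * h ^+ i).
  by apply: (vge_sum Hv) => i _; apply: (vge_mul0 Hv) => //; apply: (vgeX Hv).
rewrite (nderiv_taylor_wide (mulrC _ _) sz) !big_ord_recl /=.
rewrite nderivn0 nderivn1 expr0 mulr1 expr1 -!addrA; do 3!congr (_ + _).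
rewrite mulr_suml; apply: eq_bigr => i _; rewrite -mulrA -exprD addn3.
by rewrite /bump /= !add1n.
Qed.

(** * A prime of odd multiplicity in the critical orbit yields a transposition *)

Section GoodPrime.
Variables d c : nat.
Hypothesis d3 : (3 <= d)%N.
Hypothesis irr : forall n, (1 <= n)%N -> irreducible_poly (fQ d c n).
Local Notation F := (phi_fun d c).
Local Notation Z := (zero_at d c).
Local Notation orb := (orbit0 d c).
Local Notation gam := ((c * d.-1)%:R : algC).
Variables (p : nat) (v : algC -> rat).
Hypotheses (Hv : is_val p v) (pp : prime p) (pd : ~~ (p %| d)%N).
Local Notation small := (val_gt0 v).

Lemma vge_gam : vge v 0 gam. Proof. exact: (vge_nat Hv). Qed.

Lemma vge_phiC_coef i : vge v 0 (phiC d c)`_i.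
Proof. by rewrite /phiC coef_map /=; apply: (vge_int Hv). Qed.

Lemma small_orb_congr n x : vge v 0 x -> small x -> small (iter n F x) = small (orb n)%:~R.
Proof.
move=> hx sx; apply: (small_congr Hv); rewrite -iterF_orb.
apply: (small_iterF c d3 Hv) => //; first exact: vge0.
by rewrite subr0.
Qed.

Lemma small_orb_crit n x : vge v 0 x -> small (x - gam) ->
  small (iter n F x) = small (orb n.+1)%:~R.
Proof.
move=> hx sx; apply: (small_congr Hv); rewrite -iterF_crit //.
by apply: (small_iterF c d3 Hv) => //; apply: vge_gam.
Qed.

Definition clean n := forall j, (1 <= j <= n)%N -> ~~ (p %| `|orb j|)%N.

Lemma cleanS n : clean n.+1 -> clean n.
Proof. by move=> h j /andP[j1 jn]; apply: h; rewrite j1 leqW. Qed.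

(** Let j be the last step at which the images of r and s differ. By [congruent_preimages] they are
    then near 0 or near gam; unless they are near gam with j = 0, p divides one of a_1, ..., a_n. *)
Lemma congruent_roots n r s : clean n -> Z n r -> Z n s -> r != s -> small (r - s) ->
  small (r - gam) /\ F r = F s.
Proof.
move=> cl Zr Zs rs srs; have hr := vge_Z d3 Hv Zr; have hs := vge_Z d3 Hv Zs.
case: n cl Zr Zs => [|n] cl Zr Zs; first by move: rs; rewrite (Zr : r = 0) (Zs : s = 0) eqxx.
have ex : exists j, iter j.+1 F r == iter j.+1 F s by exists n; rewrite Zr Zs.
case: (ex_minnP ex) => j /eqP eqj jmin.
have jn : (j <= n)%N by apply: jmin; rewrite Zr Zs.
have nej : iter j F r != iter j F s.
  case: j {eqj jn} jmin => [//|j] jmin; apply/negP => h.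
  by have := jmin j h; rewrite ltnn.
have hj x : vge v 0 x -> vge v 0 (iter j F x) by apply: (vge_iterF c d3 Hv).
have := congruent_preimages d3 Hv pp pd (hj r hr) (hj s hs) nej eqj
  (small_iterF c d3 Hv j hr hs srs).
have it0 : iter (n.+1 - j) F (iter j F r) = 0 by rewrite -iterD subnK // leqW.
case/orP => sj.
  have := small_orb_congr (n.+1 - j) (hj r hr) sj.
  rewrite it0 small0 (small_int Hv _ pp) => /esym h.
  by have := cl (n.+1 - j)%N; rewrite h subn_gt0 ltnS jn leq_subr => /(_ isT).
have := small_orb_crit (n.+1 - j) (hj r hr) sj.
rewrite it0 small0 (small_int Hv _ pp) => /esym h.
case: j sj eqj h {it0 hj nej jmin ex} jn => [|j] sj eqj h jn; first by split.
by have := cl (n.+1 - j.+1).+1; rewrite h subSS /= ltnS leq_subr => /(_ isT).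
Qed.

Variable n : nat.
Hypotheses (n1 : (1 <= n)%N) (cl : clean n) (podd : odd (logn p `|orb n.+1|)).

Lemma orb_next_neq0 : orb n.+1 != 0.
Proof. by apply: contraTneq podd => ->; rewrite logn0. Qed.

Lemma gam_nsmall : ~~ small gam.
Proof.
have := cl (j := 1%N); rewrite n1 orb1 // => /(_ isT).
by rewrite (small_nat Hv _ pp) natz absz_nat.
Qed.

Lemma vgam_sub x : vge v 0 x -> vge v 0 (gam - x).
Proof. by move=> hx; apply: (vgeB Hv) => //; apply: vge_gam. Qed.

Lemma exists_near_crit : exists b, [/\ Z n b, small (gam - b) &
  forall x, Z n x -> x != b -> small (x - b) -> small (x - gam)].
Proof.
have [s [us sE prodE]] := Z_seq d3 irr n.
have hs r : r \in s -> Z n r by rewrite sE => /eqP.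
have : small (\prod_(r <- s) (gam - r)).
  rewrite -prodE iterF_crit // (small_int Hv _ pp).
  have : (0 < logn p `|orb n.+1|)%N by case: logn podd.
  by rewrite logn_gt0 mem_primes => /and3P[].
case/(small_prod Hv) => [r rs|b bs sb]; first exact/vgam_sub/(vge_Z d3 Hv)/hs.
exists b; split=> //; first exact: hs.
move=> x Zx xb sxb; have [] // := congruent_roots cl Zx (hs b bs) xb sxb.
Qed.

(** a_(n+1) is the product of F gam - r over the zeros r of phi^(n-1). A small factor with r != F b
    would make r congruent to F b, hence to gam, and p would divide a_n. *)
Lemma val_crit_value b : Z n b -> small (gam - b) ->
  F gam - F b != 0 /\ v (F gam - F b) = (logn p `|orb n.+1|)%:R.
Proof.
move=> Zb sb; have hb := vge_Z d3 Hv Zb.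
have [m nE] : exists m, n = m.+1 by case: n n1 => // m; exists m.
have [s [us sE prodE]] := Z_seq d3 irr m.
have hs r : r \in s -> Z m r by rewrite sE => /eqP.
have Zfb : Z m (F b) by apply: Z_F; rewrite -nE.
have fbs : F b \in s by rewrite sE; apply/eqP.
have hFg := vge_F c d3 Hv vge_gam.
have vprod : v (\prod_(r <- s) (F gam - r)) = (logn p `|orb n.+1|)%:R /\
   \prod_(r <- s) (F gam - r) != 0.
  rewrite -prodE -iterSr -nE iterF_crit //.
  by have [] := val_int Hv pp orb_next_neq0.
move: vprod; rewrite (bigD1_seq (F b)) //= mulf_eq0 negb_or -big_filter.
have [||P0 vP] := @val_prod_unit _ _ _ Hv [seq r <- s | r != F b] (fun r => F gam - r).
- move=> r; rewrite mem_filter => /andP[_ rs].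
  by apply: (vgeB Hv) => //; apply: (vge_Z d3 Hv (hs r rs)).
- move=> r; rewrite mem_filter => /andP[rb rs]; apply/negP => sr.
  have sFb : small (F gam - F b) by apply: (small_F c d3 Hv) => //; apply: vge_gam.
  have srb : small (r - F b).
    by apply: (small_trans Hv _ sFb); rewrite (small_subC Hv).
  have clm : clean m by apply: cleanS; rewrite -nE.
  have [sg _] := congruent_roots clm (hs r rs) Zfb rb srb.
  have := small_orb_crit m (vge_Z d3 Hv (hs r rs)) sg.
  rewrite (hs r rs) small0 (small_int Hv _ pp) => /esym.
  by apply/negP/cl; rewrite -nE n1 leqnn.
case=> vE /andP[Fgb0 _]; split=> //; move: vE.
by rewrite (valM Hv) // vP addr0.
Qed.

Lemma val_near_crit b : Z n b -> small (gam - b) ->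
  gam - b != 0 /\ v (gam - b) *+ 2 = (logn p `|orb n.+1|)%:R.
Proof.
move=> Zb sb; have hb := vge_Z d3 Hv Zb; have [k0 vk] := val_crit_value Zb sb.
have gb0 : gam - b != 0 by apply: contraNneq k0 => /subr0_eq->; rewrite subrr.
split=> //; pose t := b - gam.
have st : small t by rewrite (small_subC Hv).
have t0 : t != 0 by rewrite subr_eq0 eq_sym -subr_eq0.
have [R hR tay] := taylor2 Hv vge_phiC_coef vge_gam (small_vge st).
have d1 : (phiC d c)^`().[gam] = 0 by rewrite deriv_phiC // subrr !mulr0.
have N2 : ~~ small (phiC d c)^`N(2).[gam].
  (* Twice this coefficient is d gam^(d-2), a unit because p divides neither d nor a_1 = gam. *)
  have : ~~ small ((phiC d c)^`N(2).[gam] *+ 2).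
    rewrite -hornerMn -[_ *+ 2]/(_ *+ 2`!) -nderivn_def derivnS derivn1.
    rewrite deriv2_phiC_crit //.
    have hg := vge_gam; apply/negP; rewrite (small_mulE Hv) ?(vge_nat Hv) ?(vgeX Hv) // (small_nat Hv _ pp) (negPf pd) /=.
    by move/(small_exp Hv vge_gam); apply/negP/gam_nsmall.
  by apply: contraNN => h; rewrite mulr2n; apply: (smallD Hv).
have hN2 : vge v 0 (phiC d c)^`N(2).[gam].
  apply: (vge_horner Hv) => [i|]; last exact: vge_gam.
  rewrite coef_nderivn -mulr_natr; apply: (vge_mul0 Hv); first exact: vge_phiC_coef.
  exact: (vge_nat Hv).
have bE : gam + t = b by rewrite addrC subrK.
have : F b - F gam = t ^+ 2 * ((phiC d c)^`N(2).[gam] + R * t).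
  by rewrite /phi_fun -{1}bE tay d1; ring.
have [] // := @nsmallE _ v ((phiC d c)^`N(2).[gam] + R * t).
- by apply: (vgeD Hv) => //; apply: (vge_mul0 Hv) => //; apply: small_vge.
- rewrite (small_congr Hv (y := (phiC d c)^`N(2).[gam])) // addrAC subrr add0r.
  exact: (small_mul Hv).
move=> u0 vu /(congr1 v); rewrite -opprB (valN Hv) vk (valM Hv) ?expf_neq0 // vu addr0 (valX Hv) //.
by rewrite /t -opprB (valN Hv) mulr_natl.
Qed.

(** Inertia moves some zero r. Every moved zero is near gam, hence congruent to r and in the fibre
    of r, where at most two points are near gam; so only r and its image move, and they are
    exchanged. *)
Theorem good_prime_transposition : exists x y,
  [/\ Z n x, Z n y, F x = F y, x != y & swaps (Z n) x y].
Proof.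
have [b [Zb sb _]] := exists_near_crit; have [gb0 vgb] := val_near_crit Zb sb.
have f0 := fQ_neq0 c d3 n.
have gamE : gam = ratr (c * d.-1)%:R by rewrite ratr_nat.
have fb : root (map_poly ratr (fQ d c n)) b by rewrite root_fQ; apply/eqP.
have [||s [[r fr sr] hs]] := @inertia_moves_root p v Hv pp (fQ d c n) f0 b (c * d.-1)%:R fb.
- by rewrite -gamE.
- move=> m; rewrite -gamE; apply/eqP => vm; move: vgb podd; rewrite vm.
  rewrite -[m%:~R *+ 2]mulr_natr -[2%:R]/(2%:~R) -intrM => E.
  have /(congr1 absz) : m * 2 = logn p `|orb n.+1| by apply: (@intr_inj rat).
  by rewrite abszM absz_nat => <-; rewrite oddM andbF.
have Zr : Z n r by move: fr; rewrite root_fQ => /eqP.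
have near x : Z n x -> s x != x -> small (x - gam) /\ F (s x) = F x.
  move=> Zx sx; have hx := vge_Z d3 Hv Zx.
  have fx : root (map_poly ratr (fQ d c n)) x by rewrite root_fQ; apply/eqP.
  have := hs x fx hx sx => vx.
  have sxx : small (x - s x) by rewrite (small_subC Hv) /val_gt0 vx orbT.
  have xs : x != s x by rewrite eq_sym.
  by have [? ->] := congruent_roots cl Zx (Z_aut d3 s Zx) xs sxx.
have Zsr := Z_aut d3 s Zr.
have [nr Fr] := near r Zr sr.
have nsr' : s (s r) != s r by rewrite fmorph_eq.
have [nsr Fsr] := near (s r) Zsr nsr'.
have no3 x y z : Z n x -> Z n y -> Z n z -> small (x - gam) -> small (y - gam) ->
    small (z - gam) -> F x = F y -> F x = F z -> x != y -> x != z -> y != z -> False.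
  move=> Zx Zy Zz nx ny nz Fxy Fxz xy xz yz.
  have := at_most_two_near_crit d3 Hv pp pd (vge_Z d3 Hv Zx) xy xz yz Fxy Fxz nx ny nz.
  by rewrite -(small_nat Hv _ pp); apply/negP/gam_nsmall.
have ssr : s (s r) = r.
  apply/eqP/negPn/negP => ne.
  have nssr' : s (s (s r)) != s (s r) by rewrite fmorph_eq.
  have [nssr _] := near _ (Z_aut d3 s Zsr) nssr'.
  apply: (no3 r (s r) (s (s r))) => //; rewrite 1?eq_sym ?Fsr ?Fr //.
  exact: Z_aut.
exists r, (s r); split=> //; first by rewrite eq_sym.
exists s; split=> // z Zz zr zsr; apply/eqP/negPn/negP => sz.
have [nz Fz] := near z Zz sz.
have [] := congruent_roots cl Zz Zr zr _.
  by apply: (small_trans Hv nz); rewrite (small_subC Hv).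
move=> _ Fzr; apply: (no3 z r (s r)) => //; rewrite ?Fr // 1?eq_sym //.
Qed.

End GoodPrime.

(** * Full symmetric groups in fibres *)

Section TotallyRamifiedPrime.
Variables d c : nat.
Hypothesis d3 : (3 <= d)%N.
Hypothesis irr : forall n, (1 <= n)%N -> irreducible_poly (fQ d c n).
Local Notation F := (phi_fun d c).
Local Notation Z := (zero_at d c).
Local Notation gam := ((c * d.-1)%:R : algC).
Variables (q : nat) (v : algC -> rat).
Hypotheses (Hv : is_val q v) (pq : prime q) (qd : (q %| d.-1)%N).
Hypotheses (cop : coprime d.-1 (logn q d.-1)) (cc : coprime c d.-1).
Local Notation small := (val_gt0 v).
Local Notation w := (logn q d.-1).

Let d1 : (0 < d.-1)%N. Proof. by clear -d3; lia. Qed.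

Lemma q_ndvd_d : ~~ (q %| d)%N.
Proof.
have dE : d = d.-1.+1 by rewrite prednK //; clear -d3; lia.
apply/negP; rewrite dE -addn1 dvdn_addr // dvdn1 => /eqP q1.
by move: pq; rewrite q1.
Qed.

Lemma q_ndvd_c : ~~ (q %| c)%N.
Proof.
apply/negP => qc; have : (q %| gcdn c d.-1)%N by rewrite dvdn_gcd qc.
by rewrite (eqP cc) dvdn1 => /eqP q1; move: pq; rewrite q1.
Qed.

Lemma small_gam : small gam.
Proof. by rewrite (small_nat Hv _ pq) dvdn_mull. Qed.

Lemma val_gam : gam != 0 /\ v gam = w%:R.
Proof.
have c0 : (0 < c)%N by rewrite lt0n; apply: contraNneq q_ndvd_c => ->; rewrite dvdn0.
have [|-> ->] := val_nat Hv pq (n := (c * d.-1)%N); first by rewrite muln_gt0 c0.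
split=> //; rewrite lognM // [logn q c]lognE pq c0 (negPf q_ndvd_c) //.
Qed.

Lemma nsmall_cd : ~~ small (c * d)%:R.
Proof. by rewrite (small_nat Hv _ pq) Euclid_dvdM // negb_or q_ndvd_c q_ndvd_d. Qed.

Let hcd : vge v 0 ((c * d)%:R : algC). Proof. exact: (vge_nat Hv). Qed.

Lemma vge_sub_cd x : vge v 0 x -> vge v 0 (x - (c * d)%:R).
Proof. by move=> hx; apply: (vgeB Hv). Qed.

Lemma FE' x : F x - gam = x ^+ d.-1 * (x - (c * d)%:R).
Proof. by rewrite FE // addrK. Qed.

(** Modulo q the map is x^(d-1) (x - cd), so a unit with small image is congruent to cd. Two such
    units in one fibre would be congruent, hence near 0 or near gam, which is itself small. *)
Lemma unit_preimage_unique x y : vge v 0 x -> vge v 0 y -> ~~ small x -> ~~ small y ->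
  small (F x) -> F x = F y -> x = y.
Proof.
move=> hx hy nx ny sF Fxy; apply/eqP/negPn/negP => xy.
have near z : vge v 0 z -> ~~ small z -> small (F z) -> small (z - (c * d)%:R).
  move=> hz nz sz; have : small (F z - gam) by rewrite (smallB Hv) // small_gam.
  rewrite FE' (small_mulE Hv) ?(vgeX Hv) ?vge_sub_cd // => /orP[/(small_exp Hv hz)|//].
  by rewrite (negPf nz).
have sxy : small (x - y).
  apply: (small_trans Hv (near x hx nx sF)); rewrite (small_subC Hv).
  by apply: near; rewrite -?Fxy.
have := congruent_preimages d3 Hv pq q_ndvd_d hx hy xy Fxy sxy.
rewrite (negPf nx) /= => h.
by case/negP: nx; have := smallD Hv h small_gam; rewrite subrK.
Qed.

(** The product of the fibre is gam - a up to sign, which is small. *)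
Lemma small_preimage a : small a -> exists2 r, F r = a & small r.
Proof.
move=> sa; have [s [ss sE]] := F_fiber c d3 a.
have hs := vge_fiber d3 Hv (small_vge sa) sE.
have : small (\prod_(r <- s) (0 - r)).
  have -> : \prod_(r <- s) (0 - r) = (phiC d c - a%:P).[0].
    by rewrite sE horner_prod; apply: eq_bigr => r _; rewrite hornerXsubC.
  rewrite hornerD hornerN hornerC -/(F 0) (smallB Hv) // FE // expr0n.
  have -> : (d.-1 == 0)%N = false by apply/negbTE; rewrite -lt0n.
  by rewrite mul0r add0r small_gam.
case/(small_prod Hv) => [r rs|r rs]; first by rewrite sub0r (vgeN Hv) hs.
rewrite sub0r (smallN Hv) => sr; exists r => //.
by apply/eqP; rewrite -(fiber_mem sE).
Qed.

(** The sum of the fibre is cd, a unit, so its points are not all small. *)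
Lemma unit_preimage a s : small a -> size s = d ->
  phiC d c - a%:P = \prod_(r <- s) ('X - r%:P) -> exists2 r, r \in s & ~~ small r.
Proof.
move=> sa ss sE; apply/hasP/negPn/negP => /hasPn alls.
have := nsmall_cd; apply/negP/negPn.
have -> : (c * d)%:R = \sum_(r <- s) r.
  apply: oppr_inj; have s0 : size s != 0%N by rewrite ss; clear -d3; lia.
  rewrite -coefPn_prod_XsubC // -sE ss phiCE !(coefB, coefD, coefZ, coefXn, coefC).
  have [-> ->] : (d.-1 == d) = false /\ (d.-1 == 0)%N = false by clear -d3; split; lia.
  by rewrite eqxx mulr1 addr0 subr0 sub0r.
by apply: (small_sum Hv) => r rs; have := alls r rs; rewrite negbK.
Qed.

(* These zeros form a single totally ramified orbit at q. *)
Definition ram n x := Z n x /\ forall j, (j < n)%N -> small (iter j F x).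

Lemma ram_small n x : ram n x -> small x.
Proof. by case: n => [|n] [Zx h]; [rewrite (Zx : x = 0) small0 | apply: (h 0%N)]. Qed.

Lemma ramS n x : small x -> ram n (F x) -> ram n.+1 x.
Proof.
move=> sx [Zx h]; split; first by rewrite /zero_at iterSr.
by case=> [//|j] jn; rewrite iterSr; apply: h.
Qed.

Lemma ram_F n x : ram n.+1 x -> ram n (F x).
Proof.
move=> [Zx h]; split; first exact: Z_F.
by move=> j jn; rewrite -iterSr; apply: h.
Qed.

Lemma ram_exists n : exists x, ram n x.
Proof.
elim: n => [|n [a ra]]; first by exists 0; split.
by have [r Fr sr] := small_preimage (ram_small ra); exists r; apply: ramS; rewrite ?Fr.
Qed.

(** Each step solves z^(d-1) (z - cd) = F z - gam with z - cd a unit, so the value is divided by d -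
    1. At the bottom the right side is -gam, of value w; afterwards F z has value below w and
    dominates gam. *)
Lemma val_ram n x : ram n.+1 x -> x != 0 /\ v x = w%:R / d.-1%:R ^+ n.+1.
Proof.
have [g0 vg] := val_gam.
have D0 : d.-1%:R != 0 :> rat by rewrite pnatr_eq0 -lt0n.
have D1 : 1 < d.-1%:R :> rat by rewrite ltr1n; clear -d3; lia.
have step z m : small z -> F z - gam != 0 -> v (F z - gam) = w%:R / d.-1%:R ^+ m ->
    z != 0 /\ v z = w%:R / d.-1%:R ^+ m.+1.
  move=> sz e0 ve; have hz := small_vge sz; rewrite FE' in e0 ve.
  have [z0 zcd0] : z != 0 /\ z - (c * d)%:R != 0.
    move: e0; rewrite mulf_eq0 negb_or expf_eq0 negb_and d1 /=.
    by case/andP.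
  split=> //; have [|_ vcd] := @nsmallE _ v (z - (c * d)%:R) (vge_sub_cd hz).
    apply: contra nsmall_cd => h; have := smallB Hv sz h.
    by rewrite opprB addrC subrK.
  move: ve; rewrite (valM Hv) ?expf_neq0 // vcd addr0 (valX Hv) // => ve.
  apply: (mulfI D0); rewrite ve exprS invfM mulrCA; congr (_ * _).
  by rewrite mulrA divff // mul1r.
elim: n x => [|n IH] x rx.
  have [Zx _] := rx; apply: step; first exact: ram_small rx.
    by rewrite (Zx : F x = 0) sub0r oppr_eq0.
  by rewrite (Zx : F x = 0) sub0r (valN Hv) vg expr0 divr1.
have [a0 va] := IH _ (ram_F rx).
have w0 : 0 < w%:R :> rat by rewrite ltr0n logn_gt0 mem_primes pq d1 qd.
have lt : v (F x) < w%:R.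
  rewrite va ltr_pdivrMr ?exprn_gt0 ?(lt_trans ltr01) // ltr_pMr //.
  by rewrite exprn_egt1.
have hg : vge v w%:R (- gam) by rewrite (vgeN Hv) vge_neq0 // vg.
have [e0 ve] := val_dom Hv a0 lt hg.
by apply: step; rewrite ?ve //; apply: ram_small rx.
Qed.

Lemma size_flatten_map (A B : eqType) (g : A -> seq B) (T : seq A) k :
  (forall a, a \in T -> (size (g a) <= k)%N) -> (size (flatten (map g T)) <= k * size T)%N.
Proof.
elim: T => [|a T IH] h; first by rewrite muln0.
rewrite /= size_cat mulnS leq_add ?h ?mem_head // IH // => b bT.
by rewrite h // inE bT orbT.
Qed.

Lemma ram_count n : exists T : seq algC,
  (forall x, (x \in T) <-> ram n x) /\ (size T <= d.-1 ^ n)%N.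
Proof.
elim: n => [|n [T [TP sT]]].
  exists [:: 0]; split=> // x; rewrite inE; split=> [/eqP->|[Zx _]]; first by split.
  by rewrite (Zx : x = 0).
pose fib a := sval (cid (F_fiber c d3 a)).
have fibP a : size (fib a) = d /\ phiC d c - a%:P = \prod_(r <- fib a) ('X - r%:P).
  by rewrite /fib; case: (cid _).
exists (flatten [seq [seq r <- fib a | small r] | a <- T]); split.
  move=> x; split.
    case/flatten_mapP => a /TP ra; rewrite mem_filter => /andP[sx].
    rewrite (fiber_mem (proj2 (fibP a))) => /eqP Fx.
    by apply: ramS; rewrite ?Fx.
  move=> rx; apply/flatten_mapP; exists (F x); first exact/TP/ram_F.
  by rewrite mem_filter (fiber_mem (proj2 (fibP _))) eqxx (ram_small rx).
rewrite expnS; apply: leq_trans (leq_mul (leqnn _) sT).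
apply: size_flatten_map => a /TP ra; have [sz sE] := fibP a.
have [r rs nr] := unit_preimage (ram_small ra) sz sE.
rewrite size_filter; have := count_predC small (fib a); rewrite sz.
have : (0 < count (predC small) (fib a))%N by rewrite -has_count; apply/hasP; exists r.
by move: (count _ _) (count _ _) => a1 a2; clear; lia.
Qed.

Section DecompositionAction.
Variable n : nat.
Hypothesis n1 : (1 <= n)%N.
Local Notation D := (decomp_aut v (fQ d c n)).

Lemma rootP x : Z n x <-> root (map_poly ratr (fQ d c n)) x.
Proof. by rewrite root_fQ; split=> [/eqP|/eqP]. Qed.

Lemma val_iterF_decomp (s : aut) j x : D s -> Z n x -> v (iter j F (s x)) = v (iter j F x).
Proof.
move=> Ds /rootP fx; have := Ds x (fQ d c j) fx.
by rewrite fQ_C !horner_iter_poly.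
Qed.

Lemma small_iterF_decomp (s : aut) j x : D s -> Z n x ->
  small (iter j F (s x)) = small (iter j F x).
Proof.
move=> Ds Zx; rewrite /val_gt0 val_iterF_decomp //; congr (_ || _).
by rewrite iterF_aut // fmorph_eq0.
Qed.

Lemma ram_decomp (s : aut) x : D s -> ram n x -> ram n (s x).
Proof.
move=> Ds [Zx h]; split; first exact: Z_aut.
by move=> j jn; rewrite small_iterF_decomp // h.
Qed.

Lemma decomp_aut_comp (s t : aut) : D s -> D t -> D (s \o t : aut).
Proof.
move=> Ds Dt x g fx; rewrite /= Ds ?Dt //.
by apply/rootP/Z_aut => //; apply/rootP.
Qed.

Lemma decomp_aut_inv (s : aut) : D s -> D (aut_inv s).
Proof.
move=> Ds x g fx; have fx' : root (map_poly ratr (fQ d c n)) (aut_inv s x).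
  by apply/rootP/Z_aut => //; apply/rootP.
by rewrite -(Ds _ g fx') aut_KV.
Qed.

(* Eisenstein-style: the product of the D-orbit of x has integral valuation #orbit * w / (d-1)^n with w prime to d-1. *)
Lemma ram_transitive x y : ram n x -> ram n y -> exists2 s : aut, D s & s x = y.
Proof.
move=> rx ry; have [T [TP sT]] := ram_count n.
pose O := undup [seq z <- T | `[< exists2 s : aut, D s & s x = z >]].
have OP z : (z \in O) <-> exists2 s : aut, D s & s x = z.
  rewrite mem_undup mem_filter; split=> [/andP[/asboolP]//|h].
  apply/andP; split; first exact/asboolP.
  by apply/TP; case: h => s Ds <-; apply: ram_decomp.
have Oram z : z \in O -> ram n z by case/OP => s Ds <-; apply: ram_decomp.
have [m nE] : exists m, n = m.+1 by case: n n1 => // m; exists m.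
have Ov z : z \in O -> z != 0 /\ v z = w%:R / d.-1%:R ^+ n.
  by move/Oram; rewrite nE; apply: val_ram.
have [||k kE] := @val_prod_roots_int q v Hv pq (fQ d c n) (fQ_neq0 c d3 n) O.
- by move=> r rO; split; [apply/rootP; case: (Oram r rO) | case: (Ov r rO)].
- move=> s Ds; rewrite rmorph_prod /= -(big_map s xpredT id).
  apply: perm_big; apply: uniq_perm.
  + by rewrite map_inj_uniq ?undup_uniq //; apply: fmorph_inj.
  + exact: undup_uniq.
  + move=> z; apply/mapP/idP => [[t /OP[r Dr <-] ->]|/OP[r Dr rz]].
      by apply/OP; exists (s \o r : aut) => //; apply: decomp_aut_comp.
    exists (aut_inv s z); last by rewrite aut_KV.
    apply/OP; exists (aut_inv s \o r : aut); last by rewrite /= rz.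
    by apply: decomp_aut_comp => //; apply: decomp_aut_inv.
have vO : v (\prod_(r <- O) r) = (size O)%:R * (w%:R / d.-1%:R ^+ n).
  have : forall r, r \in O -> r != 0 /\ v r = w%:R / d.-1%:R ^+ n by [].
  elim: (O) => [|r s IH] h; first by rewrite big_nil (val1 Hv) mul0r.
  have [r0 vr] := h r (mem_head _ _).
  have hs z : z \in s -> z != 0 /\ v z = w%:R / d.-1%:R ^+ n.
    by move=> zs; apply: h; rewrite inE zs orbT.
  rewrite big_cons (valM Hv) //; last first.
    by rewrite prodf_seq_neq0; apply/allP => z /hs[].
  by rewrite IH // vr /= -nat1r mulrDl mul1r.
have Dn0 : d.-1%:R ^+ n != 0 :> rat by rewrite expf_neq0 // pnatr_eq0 -lt0n.
have : (d.-1 ^ n %| size O * w)%N.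
  have : (size O * w)%:Z = k * (d.-1 ^ n)%:Z.
    apply: (@intr_inj rat); rewrite intrM -kE vO -!pmulrn natrM natrX.
    by rewrite mulrA divfK.
  move/(congr1 absz); rewrite abszM !absz_nat => ->; exact: dvdn_mull.
rewrite Gauss_dvdl; last by rewrite coprimeXl.
(* (d-1)^n divides the size of the orbit and bounds the number of all ramified zeros, so the orbit
   contains them all. *)
move=> dvd; have xO : x \in O.
  apply/OP; exists (idfun : aut) => //.
have O0 : (0 < size O)%N by case: (O) xO.
have OT : {subset O <= T} by move=> z /Oram/TP.
have sTO : (size T <= size O)%N by apply: leq_trans sT (dvdn_leq O0 dvd).
have [_ eqOT] := uniq_min_size (undup_uniq _) OT sTO.
by apply/OP; rewrite eqOT; apply/TP.
Qed.

(** Here u is the only unit of its fibre. An automorphism that preserves v and carries x to y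
    preserves this fibre, hence fixes u. *)
Lemma ramified_pointed_fiber : exists2 u, Z n u & forall x y, Z n x -> Z n y ->
  x != u -> y != u -> F x = F u -> F y = F u -> exists s : aut, s u = u /\ s x = y.
Proof.
have [m nE] : exists m, n = m.+1 by case: n n1 => // m; exists m.
have [a ra] := ram_exists m; have sa := ram_small ra.
have [s [ss sE]] := F_fiber c d3 a.
have [u us nu] := unit_preimage sa ss sE.
have Fu : F u = a by apply/eqP; rewrite -(fiber_mem sE).
have Zfib z : F z = a -> Z n z by move=> Fz; rewrite nE /zero_at iterSr Fz; case: ra.
exists u => [|x y Zx Zy xu yu Fx Fy]; first exact: Zfib.
have hZ z : Z n z -> vge v 0 z by apply: (vge_Z d3 Hv).
have uniq_u z : Z n z -> F z = a -> ~~ small z -> z = u.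
  move=> Zz Fz nz; apply: unit_preimage_unique => //; rewrite ?Fz ?Fu //; apply: hZ => //.
  exact: Zfib.
have ramz z : Z n z -> z != u -> F z = F u -> ram n z.
  move=> Zz zu Fz; rewrite nE; apply: ramS; last by rewrite Fz Fu.
  by apply: contraNT zu => nz; apply/eqP/uniq_u; rewrite ?Fz.
have [t Dt txy] := ram_transitive (ramz x Zx xu Fx) (ramz y Zy yu Fy).
exists t; split=> //; apply: uniq_u; first exact/Z_aut/Zfib.
  by rewrite F_aut // -Fx -F_aut // txy Fy.
by have := small_iterF_decomp 0 Dt (Zfib u Fu) => /= ->.
Qed.

End DecompositionAction.

End TotallyRamifiedPrime.

Section FullLevel.
Variables d c : nat.
Hypothesis d3 : (3 <= d)%N.
Hypothesis irr : forall n, (1 <= n)%N -> irreducible_poly (fQ d c n).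
Hypothesis orb0 : forall n, (1 <= n)%N -> orbit0 d c n != 0.
Local Notation F := (phi_fun d c).
Local Notation Z := (zero_at d c).

Lemma Z0_orb n : (1 <= n)%N -> ~ Z n 0.
Proof.
by move=> n1; rewrite /zero_at iterF_orb => /eqP; rewrite intr_eq0 (negPf (orb0 n1)).
Qed.

(** A repeated point would be critical, hence 0 or gam, and as a zero of phi^n it would make a
    member of the critical orbit vanish. *)
Lemma fiber_uniq n u (s : seq algC) : Z n u -> (1 <= n)%N ->
  phiC d c - (F u)%:P = \prod_(r <- s) ('X - r%:P) -> uniq s.
Proof.
move=> Zu n1 sE; have [m nE] : exists m, n = m.+1 by case: n n1 {Zu} => // m; exists m.
have Zs r : r \in s -> Z n r.
  rewrite (fiber_mem sE) => /eqP Fr.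
  by move: Zu; rewrite nE /zero_at !iterSr Fr.
rewrite -separable_prod_XsubC -sE; apply/negPn/negP.
rewrite unlock /coprimep => ncop.
have [x] : exists x, root (gcdp (phiC d c - (F u)%:P) (phiC d c - (F u)%:P)^`()) x.
  exact/closed_rootP.
rewrite root_gcd => /andP[]; rewrite sE root_prod_XsubC => /Zs Zx.
rewrite -sE deriv_phiC_fiber /root deriv_phiC //.
rewrite mulf_eq0 pnatr_eq0 mulf_eq0 expf_eq0 subr_eq0.
have -> : (d == 0)%N = false by clear -d3; lia.
rewrite /=; case/orP=> [/andP[_ /eqP x0]|/eqP xg]; first by apply: (Z0_orb n1); rewrite -x0.
have := orb0 (ltn0Sn n); move: Zx; rewrite xg /zero_at iterF_crit // => /eqP.
by rewrite intr_eq0 => ->.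
Qed.

Theorem transposition_full_level n : (1 <= n)%N ->
  (prime d \/ (coprime c d.-1 /\
    exists q : nat, [/\ prime q, (q %| d.-1)%N & coprime d.-1 (logn q d.-1)])) ->
  (exists x y, [/\ Z n x, Z n y, F x = F y, x != y & swaps (Z n) x y]) ->
  full_level d c n.
Proof.
move=> n1 hd [x [y [Zx Zy Fxy xy sw]]].
have Va (s : aut) z : Z n z -> Z n (s z) by apply: Z_aut.
have Fa (s : aut) z : F (s z) = s (F z) by apply: F_aut.
have Vt a b : Z n a -> Z n b -> exists s : aut, s a = b by apply: Z_trans.
case: hd => [pd|[cc [q [pq qd cop]]]].
  have [s [ss sE]] := F_fiber c d3 (F x).
  apply: (swaps_of_prime_fiber Va Fa Vt Zx Fxy xy sw Zx (s := s)).
  - exact: (fiber_uniq Zx n1 sE).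
  - by rewrite ss.
  - move=> z; rewrite (fiber_mem sE); split=> [/eqP Fz|[_ ->]//]; split=> //.
    case: n n1 Zx {Zy sw Va Vt} => // m _.
    by rewrite /zero_at !iterSr Fz.
have [v Hv] := exists_padic_val pq.
have [u Zu hu] := ramified_pointed_fiber d3 Hv pq qd cop cc n1.
exact: (swaps_of_pointed_fiber Va Fa Vt Zx Fxy xy sw Zu hu).
Qed.

End FullLevel.

Lemma iter_horner_modp (R : comNzRingType) (f : {poly int}) n (x : int) :
  iter n (horner (map_poly intr f)) (x%:~R : R) = (iter n (horner f) x)%:~R.
Proof. by elim: n => // n IH; rewrite !iterS IH horner_map. Qed.

Lemma prod_primes_dvd (s : seq nat) (M : nat) : uniq s ->
  (forall p, p \in s -> prime p /\ (p %| M)%N) -> (\prod_(p <- s) p %| M)%N.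
Proof.
elim: s => [|p s IH] /=; first by rewrite big_nil dvd1n.
move=> /andP[ps us] hs; have [pp pM] := hs p (mem_head _ _).
rewrite big_cons Gauss_dvd ?pM /=; last first.
  rewrite big_seq; elim/big_ind: _ => [|m n|q qs]; first exact: coprimen1.
    by rewrite coprimeMr => -> ->.
  have [pq _] := hs q (mem_behead (s := p :: s) qs).
  by rewrite prime_coprime // dvdn_prime2 //; apply: contraNneq ps => ->.
by apply: IH => // q qs; apply: hs; rewrite inE qs orbT.
Qed.

(** D is the product of the primes of odd multiplicity in N; each divides M, so D divides M. *)
Lemma exists_square_part (M N : nat) : (0 < M)%N -> (0 < N)%N ->
  (forall p, prime p -> ~~ (p %| M)%N -> ~~ odd (logn p N)) ->
  exists D z : nat, [/\ N = (D * z ^ 2)%N, (0 < D)%N & (D <= M)%N].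
Proof.
move=> M0 N0 hN.
pose D := (\prod_(p <- primes N | odd (logn p N)) p)%N.
pose z := (\prod_(p <- primes N) p ^ (logn p N)./2)%N.
exists D, z; have D0 : (0 < D)%N.
  by rewrite /D big_seq_cond prodn_cond_gt0 // => p /andP[]; rewrite mem_primes => /andP[/prime_gt0].
split=> //.
  rewrite {1}(prod_prime_decomp N0) prime_decompE big_map /= /D /z.
  rewrite [X in (X * _)%N]big_mkcond -mulnn -!big_split /=.
  apply: eq_bigr => p _; rewrite -expnD addnn -{1}(odd_double_half (logn p N)).
  by rewrite expnD; case: odd; rewrite ?expn1 ?expn0.
apply: dvdn_leq => //; rewrite /D -big_filter.
apply: prod_primes_dvd; first by rewrite filter_uniq // primes_uniq.
move=> p; rewrite mem_filter mem_primes => /andP[op /and3P[pp _ _]]; split=> //.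
by apply: contraLR op; apply: hN.
Qed.

(** * Prime divisors of the critical orbit *)

Section Orbit.
Variables d c : nat.
Hypotheses (d3 : (3 <= d)%N) (c2 : (2 <= c)%N).
Local Notation orb := (orbit0 d c).

Definition abs_orb n : nat := `|orb n|%N.
Local Notation A := abs_orb.

Lemma orbS n : orb n.+1 = orb n ^+ d.-1 * (orb n - (c * d)%:R) + (c * d.-1)%:R.
Proof. by rewrite /orbit0 iterS phi_dcE. Qed.

Lemma abs_orb1 : A 1 = (c * d.-1)%N.
Proof. by rewrite /abs_orb orb1 // natz absz_nat. Qed.

Lemma abs_orb1_ge4 : (4 <= A 1)%N.
Proof. by rewrite abs_orb1; apply: (@leq_mul 2 2); clear -d3 c2; lia. Qed.

(** With g = a_1 one has g - cd = -c, so a_2 = g - c g^(d-1); the factor c >= 2 leaves room for the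
    summand g. *)
Lemma abs_orb2_ge : (A 1 ^ 2 <= A 2)%N.
Proof.
have h4 := abs_orb1_ge4; move: h4; rewrite abs_orb1 /abs_orb orbS orb1 //.
set g := (c * d.-1)%N => g4.
have gE : (g%:R - (c * d)%:R : int) = - c%:R.
  have -> : (c * d = g + c)%N by rewrite /g -mulnSr; congr (_ * _)%N; clear -d3; lia.
  by rewrite natrD opprD addrA subrr add0r.
rewrite gE mulrN -natrX -natrM addrC !natz.
have e : (g ^ 2 <= g ^ d.-1)%N by rewrite leq_pexp2l //; clear -d3 g4; lia.
move: e; move: (g ^ d.-1)%N => G e.
have le : (g ^ 2 + g <= G * c)%N.
  apply: leq_trans (leq_mul e c2); rewrite -mulnn; clear -g4; nia.
rewrite distnEr; first by rewrite leq_subRL ?(leq_trans (leq_addl _ _) le) // addnC.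
exact: leq_trans (leq_addl _ _) le.
Qed.

(** Since cd is at most 2 a_1 and |a_n| at least a_1^2, the factor |a_n - cd| is at least 2; the
    second copy of a_n^2 absorbs the added a_1. *)
Lemma abs_orbS_ge n : (A 1 ^ 2 <= A n)%N -> (A n ^ 2 <= A n.+1)%N.
Proof.
rewrite abs_orb1 /abs_orb orbS; set x := orb n; set g := (c * d.-1)%N => hx.
have g4 : (4 <= g)%N by have := abs_orb1_ge4; rewrite abs_orb1.
have cdg : (c * d <= 2 * g)%N.
  by rewrite /g mulnCA; apply: leq_mul => //; clear -d3; lia.
rewrite -lez_nat abszE -[(_ ^ 2)%N]mulnn PoszM abszE.
have hx' : (g * g)%:Z <= `|x| by rewrite -abszE lez_nat mulnn.
have t1 : `|x| - (c * d)%:Z <= `|x - (c * d)%:R|.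
  by apply: le_trans (lerB_dist _ _); rewrite lerB // natz ger0_norm.
have t2 : `|x ^+ d.-1 * (x - (c * d)%:R)| - g%:Z <= `|x ^+ d.-1 * (x - (c * d)%:R) + g%:R|.
  rewrite -[X in _ <= `|_ + X|]opprK; apply: le_trans (lerB_dist _ _).
  by rewrite lerB // normrN natz ger0_norm.
apply: le_trans t2; rewrite normrM normrX.
have t3 : `|x| * `|x| <= `|x| ^+ d.-1.
  rewrite -expr2; apply: ler_weXn2l; last by clear -d3; lia.
  apply: le_trans hx'; rewrite lez_nat; clear -g4; nia.
move: t1 t3 hx'; rewrite -!abszE; move: (absz (x - (c * d)%:R)) (absz x) => u X.
rewrite -PoszM; move: (X%:Z ^+ d.-1) => W.
move: (c * d)%N (g) cdg g4 => e k ek k4 uX XW kX.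
have u2 : (2 : int) <= u by clear -ek k4 uX kX; nia.
have Wu : W * 2 <= W * u by apply: ler_wpM2l => //; apply: le_trans XW.
have kXX : k%:Z <= X * X by clear -k4 kX; nia.
by clear -Wu kXX XW; lia.
Qed.

Lemma abs_orb_growth n : (1 <= n)%N -> (A n ^ 2 <= A n.+1)%N.
Proof.
case: n => [//|[|n]] _; first exact: abs_orb2_ge.
apply: abs_orbS_ge; elim: n => [|n IH]; first exact: abs_orb2_ge.
apply: leq_trans (abs_orbS_ge IH); apply: leq_trans IH _.
by rewrite -{1}[A n.+2]expn1; case: (A n.+2) => // m; rewrite leq_pexp2l.
Qed.

Lemma abs_orb_ge4 n : (1 <= n)%N -> (4 <= A n)%N.
Proof.
case: n => // n _; elim: n => [|n IH]; first exact: abs_orb1_ge4.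
apply: leq_trans (abs_orb_growth (ltn0Sn n)); apply: leq_trans IH _.
by rewrite -{1}[A n.+1]expn1; case: (A n.+1) => // m; rewrite leq_pexp2l.
Qed.

Lemma abs_orb_pow k n : (1 <= k)%N -> (A k ^ (2 ^ n) <= A (k + n))%N.
Proof.
move=> k1; elim: n => [|n IH]; first by rewrite expn0 expn1 addn0.
rewrite addnS expnSr expnM; apply: leq_trans (abs_orb_growth _); last exact: leq_trans k1 (leq_addr _ _).
by rewrite leq_exp2r.
Qed.

(** The bound |a_k|^2 for the product up to k is at most |a_(k+1)|, so the next factor turns it into
    a square again. *)
Lemma prod_abs_orb_le k : (1 <= k)%N -> (\prod_(1 <= j < k.+1) A j <= A k ^ 2)%N.
Proof.
elim: k => // -[|k] IH _; first by rewrite big_nat1 -{1}[A 1]expn1 leq_pexp2l // (leq_trans _ abs_orb1_ge4).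
rewrite big_nat_recr //= -mulnn leq_mul2r; apply/orP; right.
by apply: leq_trans (IH _) (abs_orb_growth _).
Qed.

Lemma orb_neq0 n : (1 <= n)%N -> orb n != 0.
Proof. by move=> n1; rewrite -absz_gt0 (leq_trans _ (abs_orb_ge4 n1)). Qed.

Lemma prime_dvd_abs_orb (p n : nat) : prime p -> (p %| A n)%N = ((orb n)%:~R == 0 :> 'F_p).
Proof.
move=> pp; rewrite /abs_orb; have ch := pchar_Fp pp.
by case: (orb n) => m; rewrite ?NegzE ?mulrNz ?oppr_eq0 (dvdn_pcharf ch).
Qed.

(** If p divides a_j, the orbit of 0 modulo p returns to 0 after j steps. *)
Lemma prime_dvd_shift p j k : prime p -> (p %| A j)%N ->
  (p %| A (k + j))%N = (p %| A k)%N.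
Proof.
move=> pp; rewrite !prime_dvd_abs_orb // => /eqP j0.
have h n : (orb n)%:~R = iter n (horner (map_poly intr (phi_dc d c))) (0 : 'F_p).
  by rewrite -[0]/(0%:~R) iter_horner_modp.
by rewrite !h iterD -[iter j _ 0]h j0.
Qed.

Definition good_prime n p := [/\ prime p, ~~ (p %| d)%N, clean d c p n &
  odd (logn p (A n.+1))].

(* By periodicity modulo p, an old prime factor of A n.+1 already divides some A j with j <= (n + 1) / 2. *)
Lemma no_good_prime_square_part n : (1 <= n)%N -> (forall p, ~ good_prime n p) ->
  exists D z : nat, [/\ A n.+1 = (D * z ^ 2)%N, (0 < D)%N &
    (D <= d * \prod_(1 <= j < (n.+1)./2.+1) A j)%N].
Proof.
move=> n1 bad; apply: exists_square_part.
- rewrite muln_gt0 (leq_trans _ d3) //= big_nat prodn_cond_gt0 // => j /andP[j1 _].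
  by apply: leq_trans (abs_orb_ge4 j1).
- by apply: leq_trans (abs_orb_ge4 _).
move=> p pp pM; apply/negP => oddp; apply: (bad p); split=> //.
  by apply: contra pM => h; apply: dvdn_mulr.
have pA : (p %| A n.+1)%N.
  have : (0 < logn p (A n.+1))%N by case: logn oddp.
  by rewrite logn_gt0 mem_primes => /and3P[].
have half j : (1 <= j <= (n.+1)./2)%N -> ~~ (p %| A j)%N.
  move=> hj; apply: contra pM => h; apply: dvdn_mull.
  rewrite (big_rem j) /=; first exact: dvdn_mulr.
  by rewrite mem_index_iota ltnS.
move=> j /andP[j1 jn]; apply/negP => pj.
have pnj : (p %| A (n.+1 - j))%N.
  by rewrite -(prime_dvd_shift _ pp pj) subnK // leqW.
have [le|lt] := leqP j (n.+1)./2; first by have := half j; rewrite j1 le pj => /(_ isT).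
have /half/negP[//] : (1 <= n.+1 - j <= (n.+1)./2)%N.
by rewrite subn_gt0 ltnS jn /=; clear -lt; lia.
Qed.

End Orbit.

(** * Nonvanishing of discriminants *)

Local Notation pZC := (map_poly (intr : int -> algC)).

Lemma deriv_neq0_coef (f : {poly int}) : (1 < size f)%N -> f^`()`_(size f).-2 != 0.
Proof.
move=> sf; have szf : (size f).-2.+1 = (size f).-1 by case: (size f) sf => [|[]].
rewrite coef_deriv szf mulrn_eq0 negb_or -/(lead_coef f) lead_coef_eq0.
by rewrite -size_poly_eq0; case: (size f) sf => [|[]].
Qed.

(* Only the leading coefficients of f and f' occur in the last column of the Sylvester matrix. *)
Lemma lead_coef_dvd_resultant (f : {poly int}) : (1 < size f)%N ->
  (lead_coef f %| resultant f f^`())%Z.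
Proof.
move=> sf; set g := f^`().
have szg : ((size f).-2 < size g)%N.
  by rewrite ltnNge; apply: contra (deriv_neq0_coef sf) => /leq_sizeP/(_ _ (leqnn _)) ->.
have fm m : ((size f).-1 <= m)%N -> (lead_coef f %| f`_m)%Z.
  rewrite leq_eqVlt => /predU1P[<-|lt]; first exact: dvdzz.
  by rewrite nth_default ?dvdz0 //; case: (size f) sf lt.
have dS : (((size g).-1 + (size f).-1).-1 < (size g).-1 + (size f).-1)%N.
  by clear -sf; rewrite -subn1; move: (size f) (size g) sf => a b; lia.
pose j0 := Ordinal dS.
rewrite /resultant (expand_det_col _ j0).
elim/big_ind: _ => [|x y|i _]; [exact: dvdz0 | exact: rpredD |].
apply: dvdz_mulr; rewrite Sylvester_mxE.
case: (fintype.split i) => k /=; rewrite -mulr_natr; apply: dvdz_mulr.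
  apply: fm; have := ltn_ord k; move: (nat_of_ord k) => m.
  by clear -sf; move: (size f) (size g) sf => a b; lia.
rewrite coef_deriv -mulr_natr; apply: dvdz_mulr; apply: fm.
have := ltn_ord k; move: (nat_of_ord k) => m.
by clear -sf szg; move: (size f) (size g) sf szg => a b; lia.
Qed.

Lemma disc_neq0 (f : {poly int}) : (1 < size f)%N ->
  (forall x : algC, root (pZC f) x -> ~~ root (pZC f)^`() x) -> disc f != 0.
Proof.
move=> sf sep; have f0 : f != 0 by rewrite -size_poly_gt0 ltnW.
have l0 : lead_coef f != 0 by rewrite lead_coef_eq0.
have R0 : resultant f f^`() != 0.
  rewrite resultant_eq0; apply/negP => sr; set r := gcdp f f^`() in sr.
  have [x rx] : exists x, root (pZC r) x.
    apply/closed_rootP; rewrite size_map_inj_poly ?(gtn_eqF sr) //; exact: intr_inj.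
  have aux (h : {poly int}) : r %| h -> root (pZC h) x.
    case/Pdiv.Idomain.dvdpP => [[k q] /= k0 kh].
    have := congr1 (fun P => (pZC P).[x]) kh.
    rewrite map_polyZ hornerZ rmorphM hornerM (eqP rx) mulr0 => /eqP.
    by rewrite mulf_eq0 intr_eq0 (negPf k0).
  have := sep x (aux f (dvdp_gcdl _ _)).
  by rewrite deriv_map (aux _ (dvdp_gcdr _ _)).
rewrite /disc; set s := (-1) ^+ _; have s0 : s != 0 by rewrite expf_neq0.
(* [disc] is an integer quotient; exactness of the division is what keeps it from rounding to
   zero. *)
have dvd : (lead_coef f %| s * resultant f f^`())%Z.
  by apply: dvdz_mull; apply: lead_coef_dvd_resultant.
apply: contraNneq (mulf_neq0 s0 R0) => q0.
by have := divzK dvd; rewrite q0 mul0r => <-.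
Qed.

(** * Large levels *)

Section Heights.
Variable R : realType.

Lemma hpoly_le (f : {poly int}) (B : nat) : (1 <= B)%N ->
  (forall i, (absz (f`_i)%R <= B)%N) -> hpoly R f <= ln B%:R.
Proof.
move=> B1 hB; rewrite /hpoly ler_ln ?posrE ?ltr0n // ?lt_max ?ltr01 ?orbT //.
rewrite ge_max ler1n B1 andbT ler_nat; apply/bigmax_leqP => i _; exact: hB.
Qed.

Lemma hpoly_ge0 (f : {poly int}) : 0 <= hpoly R f.
Proof. by rewrite ln_ge0 // le_max lexx orbT. Qed.

Lemma hint_ge (x : int) : x != 0 -> ln (absz x)%:R <= hint R x.
Proof.
move=> x0; have x1 : (0 < absz x)%N by rewrite absz_gt0.
rewrite /hint ler_ln ?posrE ?ltr0n // ?lt_max ?ltr01 ?orbT //.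
by rewrite le_max -abszE lexx.
Qed.

Hypothesis Hvojta : vojta_conjecture R.

(** Nonnegative constants allow any coefficient bound B to replace the height. *)
Lemma vojta_nat (d : nat) : (3 <= d)%N -> exists C1 C2 : R, [/\ 0 <= C1, 0 <= C2 &
  forall (f : {poly int}) (B : nat) (x y : int), size f = d.+1 -> disc f != 0 -> (1 <= B)%N ->
    (forall i, (absz (f`_i)%R <= B)%N) -> y ^+ 2 = f.[x] -> x != 0 ->
    ln (absz x)%:R <= C1 * ln B%:R + C2].
Proof.
move=> d3; have [C1 [C2 h]] := Hvojta d3.
exists `|C1|, `|C2|; split=> // f B x y sf df B1 hB yx x0.
apply: le_trans (hint_ge x0) _; apply: le_trans (h f sf df x y yx) _.
apply: lerD; last exact: ler_norm.
apply: le_trans (ler_wpM2r (hpoly_ge0 f) (ler_norm C1)) _.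
by rewrite ler_wpM2l ?normr_ge0 // hpoly_le.
Qed.

(** A multiple zero would be critical, but the critical values are a_1 and a_2, both nonzero. *)
Lemma phi_dc_separable (d c : nat) (e : int) : (3 <= d)%N -> (2 <= c)%N -> e != 0 ->
  forall x : algC, root (pZC (e *: phi_dc d c)) x -> ~~ root (pZC (e *: phi_dc d c))^`() x.
Proof.
move=> d3 c2 e0 x; rewrite map_polyZ derivZ !rootZ ?intr_eq0 //.
rewrite -/(phiC d c) => /eqP rx; apply/negP; rewrite /root deriv_phiC //.
rewrite mulf_eq0 pnatr_eq0 mulf_eq0 expf_eq0 subr_eq0.
have -> : (d == 0)%N = false by clear -d3; lia.
rewrite /=; case/orP=> [/andP[_ /eqP x0]|/eqP xg].
  have := orb_neq0 d3 c2 (ltn0Sn 0); have := iterF_orb d c 1.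
  by rewrite /= /phi_fun -x0 rx => /esym/eqP; rewrite intr_eq0 => ->.
have := orb_neq0 d3 c2 (ltn0Sn 1); have := iterF_crit c d3 1.
by rewrite /= /phi_fun -xg rx => /esym/eqP; rewrite intr_eq0 => ->.
Qed.

Lemma coef_phi_dc_le (d c i : nat) : (3 <= d)%N -> (1 <= c)%N ->
  (absz ((phi_dc d c)`_i)%R <= c * d)%N.
Proof.
move=> d3 c1; rewrite /phi_dc !(coefB, coefD, coefZ, coefXn, coefC).
have [e1 e2 e3] : [/\ (d == d.-1) = false, (d == 0)%N = false & (d.-1 == 0)%N = false].
  by clear -d3; split; lia.
have [->|id] := eqVneq i d.
  by rewrite e1 e2 mulr0 subr0 addr0 /= muln_gt0 c1 (leq_trans _ d3).
have [->|id1] := eqVneq i d.-1.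
  by rewrite e3 mulr1 addr0 sub0r abszN natz absz_nat.
case: (i == 0)%N; rewrite mulr0 subr0 ?add0r // natz absz_nat leq_mul //.
exact: leq_pred.
Qed.

Theorem good_prime_large_level (d : nat) : (3 <= d)%N ->
  exists n0, forall c n, (2 <= c)%N -> (n0 <= n)%N -> exists p, good_prime d c n p.
Proof.
move=> d3; have [C1 [C2 [C10 C20 hV]]] := vojta_nat d3.
have l4 : 0 < ln 4 :> R by rewrite ln_gt0 // ltr1n.
(* With L = |a_k| >= 4 the conjecture will give ln |a_n| <= (5 C1 + C2 / ln 4) ln L, against |a_n|
   >= L^(2^N). *)
pose N := (Num.truncn (5%:R * C1 + C2 / ln 4)).+1.
have hN : 5%:R * C1 + C2 / ln 4 < N%:R by rewrite truncnS_gt.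
(* Large enough for k + N <= n, where k is the integer part of (n+1)/2. *)
exists (2 * N).+2 => c n c2 hn; have n1 : (1 <= n)%N by apply: leq_trans hn.
apply: contrapT => nogood.
have [|D [z [AE D0 DM]]] := @no_good_prime_square_part d c d3 c2 n n1.
  by move=> p hp; apply: nogood; exists p.
pose k := (n.+1)./2.
have k1 : (1 <= k)%N by rewrite /k; clear -n1; lia.
have kn : (k + N <= n)%N by rewrite /k; clear -hn; lia.
(* [e] carries the sign of a_(n+1), so that e a_(n+1) = (D z)^2. *)
pose e : int := sgz (orbit0 d c n.+1) * D%:Z.
have orb1n := orb_neq0 d3 c2 (ltn0Sn n).
have e0 : e != 0 by rewrite mulf_neq0 ?sgz_eq0 // -lt0n.
have eD : absz e = D by rewrite abszM -sgrz absz_sg orb1n mul1n.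
have sf : size (e *: phi_dc d c) = d.+1 by rewrite size_scale // size_phi_dc.
have B1 : (1 <= D * (c * d))%N by rewrite !muln_gt0 D0 (leq_trans _ c2) ?(leq_trans _ d3).
have coefB i : (absz ((e *: phi_dc d c)`_i)%R <= D * (c * d))%N.
  by rewrite coefZ abszM eD leq_mul // coef_phi_dc_le // ltnW.
have yx : (D%:Z * z%:Z) ^+ 2 = (e *: phi_dc d c).[orbit0 d c n].
  have -> : (e *: phi_dc d c).[orbit0 d c n] = e * orbit0 d c n.+1 by rewrite hornerZ.
  have oE : orbit0 d c n.+1 = sgz (orbit0 d c n.+1) * (D * z ^ 2)%N%:Z.
    by rewrite -AE /abs_orb abszE -intEsg.
  have ss : sgz (orbit0 d c n.+1) * sgz (orbit0 d c n.+1) = 1 by rewrite mulz_sg orb1n.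
  rewrite oE /e; move: ss; move: (sgz _) => u uu.
  rewrite PoszM -mulnn PoszM; transitivity (u * u * (D%:Z * z%:Z) ^+ 2); last by ring.
  by rewrite uu mul1r.
have disc0 : disc (e *: phi_dc d c) != 0.
  apply: disc_neq0; first by rewrite sf ltnS; clear -d3; lia.
  exact: phi_dc_separable.
have := hV _ _ _ _ sf disc0 B1 coefB yx (orb_neq0 d3 c2 n1).
rewrite -/(abs_orb d c n).
have Ak4 := abs_orb_ge4 d3 c2 k1.
set L := abs_orb d c k in Ak4 *.
have A1k : (abs_orb d c 1 <= L)%N.
  have := abs_orb_pow d3 c2 k.-1 (leqnn 1); rewrite add1n prednK //.
  apply: leq_trans; rewrite -{1}[abs_orb d c 1]expn1 leq_pexp2l ?expn_gt0 //.
  by apply: leq_trans (abs_orb1_ge4 d3 c2).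
have [dL cL] : (d <= L)%N /\ (c <= L)%N.
  move: A1k; rewrite abs_orb1 // => A1k; split; apply: leq_trans A1k.
    by apply: leq_trans (leq_mul c2 (leqnn _)); clear -d3; lia.
  by rewrite leq_pmulr //; clear -d3; lia.
(* D is at most d times the product of the first k terms, hence at most L^3, and c, d <= L. *)
have BM : (D * (c * d) <= L ^ 5)%N.
  have -> : (L ^ 5 = L * (L * L * (L * L)))%N by rewrite !expnS expn0 muln1 !mulnA.
  apply: leq_trans (leq_mul DM (leqnn _)) _.
  rewrite -mulnA; apply: leq_mul => //.
  by apply: leq_mul (leq_mul cL dL); rewrite mulnn; apply: prod_abs_orb_le.
have L0 : 0 < ln L%:R :> R by rewrite ln_gt0 // ltr1n; clear -Ak4; lia.
have lB : ln (D * (c * d))%:R <= 5%:R * ln L%:R :> R.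
  rewrite mulr_natl -lnXn ?ltr0n; last by clear -Ak4; lia.
  rewrite ler_ln ?posrE ?ltr0n //; first by rewrite -natrX ler_nat.
  by rewrite exprn_gt0 // ltr0n; clear -Ak4; lia.
have lA : (2 ^ N)%:R * ln L%:R <= ln (abs_orb d c n)%:R :> R.
  have Ln : (L ^ (2 ^ N) <= abs_orb d c n)%N.
    have Nnk : (N <= n - k)%N by clear -kn; lia.
    have := abs_orb_pow d3 c2 (n - k) k1; rewrite subnKC; last by clear -kn; lia.
    by apply: leq_trans; rewrite leq_pexp2l ?leq_pexp2l //; clear -Ak4; lia.
  have L1 : 0 < L%:R :> R by rewrite ltr0n; clear -Ak4; lia.
  rewrite mulr_natl -lnXn // ler_ln ?posrE ?exprn_gt0 // -?natrX ?ler_nat //.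
  by rewrite ltr0n; apply: leq_trans Ln; rewrite expn_gt0; clear -Ak4; lia.
have l4L : ln 4 <= ln L%:R :> R.
  by rewrite ler_ln ?posrE ?ltr0n ?ler_nat //; clear -Ak4; lia.
move=> /(le_trans lA) h1.
have h2 : C2 <= C2 / ln 4 * ln L%:R.
  by rewrite mulrAC ler_pdivlMr // ler_wpM2l.
have h3 : C1 * ln (D * (c * d))%:R <= 5%:R * C1 * ln L%:R.
  by rewrite -mulrA mulrCA; apply: ler_wpM2l.
have h4 : (2 ^ N)%:R * ln L%:R <= (5%:R * C1 + C2 / ln 4) * ln L%:R.
  by rewrite mulrDl; apply: le_trans h1 _; apply: lerD.
move: h4; rewrite ler_pM2r // => /le_lt_trans/(_ hN).
by rewrite ltr_nat ltnNge ltnW // ltn_expl.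
Qed.

End Heights.

(** * Large parameters *)

Section OrbitPolynomial.
Variable d : nat.
Hypothesis d3 : (3 <= d)%N.

Fixpoint orbP n : {poly int} :=
  if n is m.+1 then orbP m ^+ d.-1 * (orbP m - d%:R * 'X) + d.-1%:R * 'X else 0.

Lemma horner_natX (a : nat) (x : int) : (a%:R * 'X : {poly int}).[x] = a%:R * x.
Proof. by rewrite hornerM hornerX -polyC_natr hornerC. Qed.

Lemma orbP_horner c n : (orbP n).[c%:Z] = orbit0 d c n.
Proof.
elim: n => [|n IH]; first by rewrite horner0.
rewrite orbS //= hornerD hornerM horner_exp hornerD hornerN !horner_natX IH.
by rewrite !natrM !natz; ring.
Qed.

(** Modulo d the power P^d has derivative 0 and d - 1 is -1. *)
Lemma orbP_deriv n : exists Q, (orbP n.+1)^`() = d%:R * Q - 1.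
Proof.
set P := orbP n; exists (P ^+ d.-1 * P^`() - (P ^+ d.-1 * 'X)^`() + 1).
have -> : orbP n.+1 = P ^+ d - d%:R * (P ^+ d.-1 * 'X) + d.-1%:R * 'X.
  have -> : P ^+ d = P ^+ d.-1 * P by rewrite -exprSr (ltn_predK d3).
  by rewrite /= -/P; ring.
rewrite derivD derivB deriv_exp !derivM -!polyC_natr !derivC derivX !mul0r !add0r mulr1.
rewrite -mulr_natl -polyC_natr.
have -> : (d.-1%:R)%:P = (d%:R)%:P - 1 :> {poly int}.
  by rewrite -[d in RHS](ltn_predK d3) -natr1 polyCD addrK.
by rewrite !polyC_natr; ring.
Qed.

Lemma size_natX (a : nat) : (0 < a)%N -> size (a%:R * 'X : {poly int}) = 2.
Proof.
by move=> a0; rewrite -polyC_natr mul_polyC size_scale ?size_polyX // pnatr_eq0 -lt0n.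
Qed.

Lemma size_orbP n : size (orbP n.+1) = (d ^ n).+1.
Proof.
have d1 : (0 < d.-1)%N by clear -d3; lia.
(* The size of P - d X is a separate hypothesis because for P = (d-1) X the leading terms combine to
   -X. *)
have step n' : (size (orbP n'.+1)).-1 = (d ^ n')%N ->
    size (orbP n'.+1 - d%:R * 'X) = size (orbP n'.+1) -> size (orbP n'.+2) = (d ^ n'.+1).+1.
  move=> s1 s2; set P := orbP n'.+1 in s1 s2.
  have dn0 : (0 < d ^ n')%N by rewrite expn_gt0; clear -d3; lia.
  have P0 : P != 0 by rewrite -size_poly_gt0; clear -s1 dn0; move: s1; lia.
  have PX0 : P - d%:R * 'X != 0 by rewrite -size_poly_gt0 s2 size_poly_gt0.
  have szm : size (P ^+ d.-1 * (P - d%:R * 'X)) = (d ^ n'.+1).+1.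
    rewrite size_mul ?expf_neq0 // s2.
    have := size_exp P d.-1; rewrite s1 => e1.
    have pe0 : (0 < size (P ^+ d.-1))%N by rewrite size_poly_gt0 expf_neq0.
    have sp : size P = (d ^ n').+1 by rewrite -s1 prednK // size_poly_gt0.
    rewrite sp addnS /= -(prednK pe0) e1 addSn; congr _.+1.
    by rewrite -mulnSr (ltn_predK d3) expnSr.
  rewrite -[orbP n'.+2]/(P ^+ d.-1 * (P - d%:R * 'X) + d.-1%:R * 'X).
  rewrite size_polyDl ?szm // size_natX // ltnS expnS.
  by apply: leq_trans (ltnW d3) _; rewrite leq_pmulr.
elim: n => [|[|n] IH].
- by rewrite /= expr0n; case: (d) d3 => [|[|k]] // _; rewrite mul0r add0r size_natX.
- apply: step; first by rewrite IH.
  rewrite IH /= expr0n; case: (d) d3 => [|[|k]] // _; rewrite mul0r add0r /=.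
  rewrite -mulrBl -[k.+2%:R]natr1 opprD addrA subrr add0r mulN1r size_polyN size_polyX.
  by rewrite expn0.
- apply: step; first by rewrite IH.
  rewrite size_polyDl // size_polyN size_natX ?IH; last by clear -d3; lia.
  by rewrite ltnS expnS; apply: leq_trans (leq_pmulr _ _); [clear -d3; lia|rewrite expn_gt0; clear -d3; lia].
Qed.

Lemma pZC_horner_natX (a : nat) (x : algC) : (pZC (a%:R * 'X)).[x] = a%:R * x.
Proof. by rewrite -polyC_natr mul_polyC map_polyZ /= map_polyX hornerZ hornerX rmorph_nat. Qed.

Lemma orbP_hornerC n (x : algC) : (pZC (orbP n.+1)).[x] =
  (pZC (orbP n)).[x] ^+ d.-1 * ((pZC (orbP n)).[x] - d%:R * x) + d.-1%:R * x.
Proof.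
rewrite /= rmorphD rmorphM rmorphXn rmorphB /= hornerD hornerM horner_exp hornerD hornerN.
by rewrite !pZC_horner_natX.
Qed.

(* Modulo a prime p dividing d the derivative of orbP is -1 and its leading coefficient is a unit. *)
Lemma orbP_separable n (x : algC) : root (pZC (orbP n.+1)) x -> ~~ root (pZC (orbP n.+1))^`() x.
Proof.
have d1 : (1 < d)%N by clear -d3; lia.
pose p := pdiv d; have pp : prime p by apply: pdiv_prime.
have [v Hv] := exists_padic_val pp.
have sd : val_gt0 v (d%:R : algC) by rewrite (small_nat Hv _ pp) pdiv_dvd.
(* If x had a pole at p, each orbit polynomial would have at least as large a pole at x and could
   not vanish. *)
move=> rx; have hx : vge v 0 x.
  apply: contraTT rx; rewrite /vge negb_or -ltNge => /andP[x0 vx].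
  suff : (pZC (orbP n.+1)).[x] != 0 /\ v (pZC (orbP n.+1)).[x] <= v x by case.
  have dK : d%:R != 0 :> algC by rewrite pnatr_eq0; clear -d3; lia.
  have d1K : d.-1%:R != 0 :> algC by rewrite pnatr_eq0; clear -d3; lia.
  have [_ vd1] : d.-1%:R != 0 :> algC /\ v d.-1%:R = 0.
    apply: nsmallE; first exact: (vge_nat Hv).
    rewrite (small_nat Hv _ pp); apply/negP => pd1.
    have : (p %| d.-1.+1)%N by rewrite (ltn_predK d3) pdiv_dvd.
    rewrite -addn1 dvdn_addr // dvdn1 => /eqP p1.
    by move: pp; rewrite p1.
  have hd1x : vge v (v x) (d.-1%:R * x).
    by rewrite vge_neq0 ?mulf_neq0 // (valM Hv) // vd1 add0r.
  elim: n => [|n [y0 vy]].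
    rewrite orbP_hornerC rmorph0 horner0 expr0n.
    have -> : (d.-1 == 0)%N = false by clear -d3; lia.
    by rewrite mul0r add0r mulf_neq0 // (valM Hv) // vd1 add0r.
  rewrite orbP_hornerC; set y := (pZC _).[x] in y0 vy *.
  have hdx : vge v (v x + v d%:R) (- (d%:R * x)).
    by rewrite (vgeN Hv) vge_neq0 ?mulf_neq0 // (valM Hv) // addrC.
  have vd : 0 < v d%:R by move: sd; rewrite /val_gt0 (negPf dK).
  have [|z0 vz] := val_dom Hv y0 _ hdx; first by apply: le_lt_trans vy _; rewrite ltrDl.
  have m0 : y ^+ d.-1 * (y - d%:R * x) != 0 by rewrite mulf_neq0 ?expf_neq0.
  have vm : v (y ^+ d.-1 * (y - d%:R * x)) < v x.
    rewrite (valM Hv) ?expf_neq0 // (valX Hv) // vz.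
    have : d.-1%:R * v y < 0.
      by rewrite pmulr_rlt0 ?ltr0n; [apply: le_lt_trans vy vx | clear -d3; lia].
    by move=> neg; apply: lt_le_trans vy; rewrite gtrDr.
  have [w0 ->] := val_dom Hv m0 vm hd1x.
  by split=> //; apply: ltW.
have [Q QE] := orbP_deriv n; apply/negP; rewrite deriv_map QE /root rmorphB rmorphM.
rewrite rmorph_nat rmorph1 hornerD hornerN hornerM -polyC_natr !hornerC subr_eq0 => /eqP E.
have : val_gt0 v (d%:R * (pZC Q).[x]).
  apply: (small_mulr Hv) => //; apply: (vge_horner Hv) => // i.
  by rewrite coef_map; apply: (vge_int Hv).
by rewrite E (negPf (nsmall1 Hv)).
Qed.

End OrbitPolynomial.

Local Notation pZQ := (map_poly (intr : int -> rat)).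

Lemma scale_to_int (f : {poly rat}) :
  exists (g : {poly int}) (a : int), a != 0 /\ pZQ g = a%:~R *: f.
Proof.
have [g [a a0 fE]] := rat_poly_scale f; exists g, a; split=> //.
by rewrite fE scalerA divff ?intr_eq0 // scale1r.
Qed.

Lemma pZQ_inj : injective pZQ.
Proof. exact: (map_inj_poly (@intr_inj rat) (rmorph0 _)). Qed.

Lemma pQC_pZQ (f : {poly int}) : pQC (pZQ f) = pZC f.
Proof. by rewrite -map_poly_comp; apply: eq_map_poly => a /=; rewrite ratr_int. Qed.

Section PrimitivePart.
Variable d : nat.
Hypothesis d3 : (3 <= d)%N.
Local Notation orbP := (orbP d).

Definition old_orbP n := \prod_(1 <= j < n.+1) orbP j.

(** The degree is 1 + d + ... + d^(n-1), which is below d^n / 2 as d >= 3. *)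
Lemma degree_old_orbP n : old_orbP n != 0 /\ (2 * (size (old_orbP n)).-1 < d ^ n)%N.
Proof.
rewrite /old_orbP; elim: n => [|n [IH0 IH]].
  by rewrite big_geq // oner_neq0 size_poly1.
rewrite big_nat_recr //=; set Q := \prod_(1 <= j < n.+1) _ in IH0 IH *.
have P0 : orbP n.+1 != 0 by rewrite -size_poly_gt0 size_orbP.
split; first exact: mulf_neq0.
have Q1 : (0 < size Q)%N by rewrite size_poly_gt0.
rewrite -[_ + d.-1%:R * 'X]/(orbP n.+1) size_mul // size_orbP // expnS.
move: (size Q) (d ^ n)%N Q1 IH => q D q1 IH.
by apply: leq_trans (leq_mul d3 (leqnn D)); clear -q1 IH; lia.
Qed.

(* g is orbP n.+1 divided by its common factor with the earlier orbP j; the finitely many primes dividing M account for the denominators. *)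
Lemma primitive_part n : (4 <= d ^ n)%N -> exists (g : {poly int}) (M : nat),
  [/\ (3 < size g)%N, (0 < M)%N,
      forall x : algC, root (pZC g) x -> ~~ root (pZC g)^`() x &
      forall c, (2 <= c)%N -> g.[c%:Z] != 0 /\
        forall p, prime p -> ~~ (p %| M)%N -> (p %| absz g.[c%:Z])%N ->
        [/\ ~~ (p %| d)%N, clean d c p n & logn p (absz g.[c%:Z]) = logn p (abs_orb d c n.+1)]].
Proof.
move=> dn4; pose P := pZQ (orbP n.+1); pose Q := pZQ (old_orbP n).
have [Qz0 degQ] := degree_old_orbP n.
have Q0 : Q != 0 by rewrite map_poly_eq0_id0 ?intr_eq0 ?lead_coef_eq0.
have szQ : size Q = size (old_orbP n) by rewrite size_map_inj_poly //; apply: intr_inj.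
have szP : size P = (d ^ n).+1 by rewrite size_map_inj_poly ?size_orbP //; apply: intr_inj.
have P0 : P != 0 by rewrite -size_poly_gt0 szP.
pose G := gcdp P Q; pose g0 := P %/ G; pose H := Q %/ G.
have PE : P = g0 * G by rewrite divpK // dvdp_gcdl.
have QE : Q = H * G by rewrite divpK // dvdp_gcdr.
have G0 : G != 0 by rewrite gcdp_eq0 negb_and P0.
have sG : (size G <= size Q)%N by apply: dvdp_leq => //; apply: dvdp_gcdr.
(* G has degree below d^n / 2, so g0 has degree above d^n / 2 >= 2. *)
have sg0 : (3 < size g0)%N.
  rewrite size_divp // szP; rewrite szQ in sG.
  by clear -dn4 degQ sG; move: (d ^ n)%N (size G) (size _) dn4 degQ sG => a e f; lia.
have simple (x : algC) (f1 f2 : {poly algC}) : pZC (orbP n.+1) = f1 * f2 ->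
    root f1 x -> root f2 x -> False.
  move=> E r1 r2; have rx : root (pZC (orbP n.+1)) x by rewrite E rootM r1.
  have := orbP_separable d3 rx; rewrite E derivM /root hornerD !hornerM.
  by rewrite (eqP r1) (eqP r2) mulr0 mul0r addr0 eqxx.
have PCE : pZC (orbP n.+1) = pQC g0 * pQC G by rewrite -pQC_pZQ -/P PE rmorphM.
(* A common zero of g0 and Q would be a zero of G as well, hence a double zero of P = g0 G. *)
have cop : coprimep g0 Q.
  rewrite -(coprimep_map (ratr : {rmorphism rat -> algC})); apply/negPn/negP => ncop.
  have [x] : exists x, root (gcdp (pQC g0) (pQC Q)) x by apply/closed_rootP.
  rewrite root_gcd => /andP[r1 r2]; apply: (simple x _ _ PCE r1).
  by rewrite gcdp_map root_gcd r2 /P pQC_pZQ PCE rootM r1.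
have [[u w] /= uw] := Bezout_eq1_coprimepP _ _ cop.
have [g [a [a0 gE]]] := scale_to_int g0; have [G1 [b [b0 G1E]]] := scale_to_int G.
have [H1 [h [h0 H1E]]] := scale_to_int H; have [U [e [e0 UE]]] := scale_to_int u.
have [W [k [k0 WE]]] := scale_to_int w.
have gG : g * G1 = (a * b) *: orbP n.+1.
  apply: pZQ_inj; rewrite rmorphM /= gE G1E map_polyZ rmorphM /= -/P PE.
  by rewrite -!scalerAl -!scalerAr scalerA.
have HG : H1 * G1 = (h * b) *: old_orbP n.
  apply: pZQ_inj; rewrite rmorphM /= H1E G1E map_polyZ rmorphM /= -/Q QE.
  by rewrite -!scalerAl -!scalerAr scalerA.
(* The constant of the Bezout identity after clearing denominators: a prime not dividing r cannot
   divide both g(c) and a_1 ... a_n. *)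
pose r := a * e * k.
have Bez : k *: U * g + (a * e) *: W * old_orbP n = r%:P.
  apply: pZQ_inj; rewrite rmorphD !rmorphM /= !map_polyZ /= map_polyC /= gE UE WE -/Q.
  transitivity (r%:~R *: (u * g0 + w * Q)); last first. by rewrite uw alg_polyC /r !rmorphM /= !map_polyC.
  rewrite /r !rmorphM /= -!mul_polyC !polyCM; ring.
have r0 : r != 0 by rewrite !mulf_neq0.
exists g, (absz (a * b * (h * b) * r)%R * d)%N; split.
- have <- : size (pZQ g) = size g by rewrite size_map_inj_poly //; apply: intr_inj.
  by rewrite gE size_scale // intr_eq0.
- rewrite muln_gt0 absz_gt0 !mulf_neq0 //=; clear -d3; lia.
- move=> x rx; apply/negP => rx'.
  have rg : root (pQC g0) x.
    by move: rx; rewrite -pQC_pZQ gE map_polyZ rootZ // fmorph_eq0 intr_eq0.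
  have rg' : root (pQC g0)^`() x.
    by move: rx'; rewrite -pQC_pZQ gE map_polyZ derivZ rootZ // fmorph_eq0 intr_eq0.
  have rx2 : root (pZC (orbP n.+1)) x by rewrite PCE rootM rg.
  have := orbP_separable d3 rx2; rewrite PCE derivM /root hornerD !hornerM.
  by rewrite (eqP rg) (eqP rg') !mul0r addr0 eqxx.
move=> c c2; set gc := g.[c%:Z].
have gGc : gc * G1.[c%:Z] = a * b * orbit0 d c n.+1.
  by rewrite -hornerM gG hornerZ orbP_horner.
have HGc : H1.[c%:Z] * G1.[c%:Z] = h * b * \prod_(1 <= j < n.+1) orbit0 d c j.
  rewrite -hornerM HG hornerZ horner_prod; congr (_ * _).
  by apply: eq_bigr => j _; rewrite orbP_horner.
have BezC : (k *: U).[c%:Z] * gc + ((a * e) *: W).[c%:Z] * \prod_(1 <= j < n.+1) orbit0 d c j = r.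
  rewrite -[r](hornerC _ c%:Z) -Bez hornerD !hornerM; congr (_ + _ * _).
  by rewrite horner_prod; apply: eq_bigr => j _; rewrite orbP_horner.
have o0 := orb_neq0 d3 c2 (ltn0Sn n).
have [gc0 G1c0] : gc != 0 /\ G1.[c%:Z] != 0.
  have : gc * G1.[c%:Z] != 0 by rewrite gGc !mulf_neq0.
  by rewrite mulf_eq0 negb_or => /andP.
split=> // p pp; rewrite Euclid_dvdM // negb_or => /andP[+ pd] pg.
rewrite !abszM !Euclid_dvdM // !negb_or.
case/andP=> /andP[/andP[pa pb] /andP[ph _]] pr.
have {}pr : ~~ (p %| absz r)%N by rewrite !abszM !Euclid_dvdM // !negb_or.
have nQ : ~~ (p %| absz (\prod_(1 <= j < n.+1) orbit0 d c j)%R)%N.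
  apply: contra pr => pQ; rewrite -BezC -[p]absz_nat -dvdzE.
  by rewrite rpredD // dvdz_mull // dvdzE absz_nat.
(* Up to constants prime to p, G1(c) divides a_1 ... a_n, so p does not divide it; hence g(c) and
   a_(n+1) have the same multiplicity at p. *)
have nG1 : ~~ (p %| absz G1.[c%:Z])%N.
  apply/negP => pG; have : (p %| absz (H1.[c%:Z] * G1.[c%:Z])%R)%N by rewrite abszM dvdn_mull.
  by rewrite HGc !abszM !Euclid_dvdM // (negPf ph) (negPf pb) (negPf nQ).
split=> //.
  move=> j hj; apply: contra nQ => pj; rewrite (big_rem j) /=; last first.
    by rewrite mem_index_iota ltnS.
  by rewrite abszM dvdn_mulr.
have /(congr1 (logn p)) := congr1 absz gGc; rewrite !abszM.
rewrite !lognM ?muln_gt0 ?absz_gt0 ?a0 ?b0 //.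
have nl m : ~~ (p %| m)%N -> logn p m = 0%N.
  by move=> npm; rewrite lognE (negPf npm) !andbF.
by rewrite (nl _ pa) (nl _ pb) (nl _ nG1) addn0.
Qed.

End PrimitivePart.

Section FixedLevel.
Variables (R : realType) (d : nat).
Hypotheses (Hvojta : vojta_conjecture R) (d3 : (3 <= d)%N).

(** The integral point is c itself, on y^2 = e g(x) with |e| at most M; the coefficients are bounded
    independently of c, so ln c is bounded. *)
Theorem good_prime_large_c n : (1 <= n)%N -> (4 <= d ^ n)%N ->
  exists N, forall c, (2 <= c)%N -> (N < c)%N -> exists p, good_prime d c n p.
Proof.
move=> n1 dn4; have [g [M [sg M0 sepg hg]]] := primitive_part d3 dn4.
have [d' [d'3 sgE]] : exists d', (3 <= d')%N /\ size g = d'.+1.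
  by exists (size g).-1; rewrite prednK; [split=> //; clear -sg; move: sg; lia | apply: leq_trans sg].
have [C1 [C2 [C10 C20 hV]]] := vojta_nat Hvojta d'3.
pose mx := (\max_(i < size g) absz (g`_i)%R)%N.
pose B := (M * mx.+1)%N.
have B1 : (1 <= B)%N by rewrite muln_gt0 M0.
pose K : R := C1 * ln B%:R + C2.
have l2 : 0 < ln 2 :> R by rewrite ln_gt0 // ltr1n.
pose k := (Num.truncn (K / ln 2)).+1.
have hk : K < k%:R * ln 2 by rewrite -ltr_pdivrMr // truncnS_gt.
exists (2 ^ k)%N => c c2 Nc.
apply: contrapT => nogood; have [gc0 hp] := hg c c2.
set gc := g.[c%:Z] in gc0 hp.
have [||D [z [gcE D0 DM]]] := @exists_square_part M (absz gc) M0.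
- by rewrite absz_gt0.
- move=> p pp pM; have [pg|npg] := boolP (p %| absz gc)%N; last first.
    by rewrite lognE (negPf npg) !andbF.
  have [pd cl lE] := hp p pp pM pg; apply/negP => oddp.
  by apply: nogood; exists p; split=> //; rewrite -lE.
pose e : int := sgz gc * D%:Z.
have e0 : e != 0 by rewrite mulf_neq0 ?sgz_eq0 // -lt0n.
have eD : absz e = D by rewrite abszM -sgrz absz_sg gc0 mul1n.
have sf : size (e *: g) = d'.+1 by rewrite size_scale.
have disc0 : disc (e *: g) != 0.
  apply: disc_neq0; first by rewrite sf ltnS; clear -d'3; lia.
  by move=> x; rewrite map_polyZ derivZ !rootZ ?intr_eq0 //; apply: sepg.
have coefB i : (absz ((e *: g)`_i)%R <= B)%N.
  rewrite coefZ abszM eD; apply: leq_mul DM _.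
  have [lt|ge] := ltnP i (size g); last by rewrite nth_default.
  apply: leqW; exact: (@leq_bigmax _ (fun i : 'I_(size g) => absz (g`_i)%R) (Ordinal lt)).
have yx : (D%:Z * z%:Z) ^+ 2 = (e *: g).[c%:Z].
  rewrite hornerZ -/gc; have oE : gc = sgz gc * (D * z ^ 2)%N%:Z.
    by rewrite -gcE abszE -intEsg.
  have ss : sgz gc * sgz gc = 1 by rewrite mulz_sg gc0.
  rewrite oE /e; move: ss; move: (sgz gc) => u uu.
  rewrite PoszM -mulnn PoszM; transitivity (u * u * (D%:Z * z%:Z) ^+ 2); last by ring.
  by rewrite uu mul1r.
have c0 : c%:Z != 0 by rewrite -lt0n; apply: leq_trans c2.
have := hV _ _ _ _ sf disc0 B1 coefB yx c0; rewrite absz_nat -/K.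
apply/negP; rewrite -ltNge; apply: lt_le_trans hk _.
rewrite mulr_natl -lnXn // ler_ln ?posrE ?exprn_gt0 ?ltr0n ?(leq_trans _ c2) //.
by rewrite -natrX ler_nat ltnW.
Qed.

End FixedLevel.

(** * The first level for d = 3 *)

Section CubicFirstLevel.
Variable c : nat.
Hypothesis c2 : (2 <= c)%N.
Local Notation F := (phi_fun 3 c).
Local Notation Z := (zero_at 3 c).

Lemma cubic_roots : exists r1 r2 r3 : algC, uniq [:: r1; r2; r3] /\
  forall x, F x = (x - r1) * (x - r2) * (x - r3).
Proof.
have d3 : (3 <= 3)%N by [].
have [s [ss sE]] := F_fiber c d3 0; case: s ss sE => [|r1 [|r2 [|r3 []]]] // _ sE.
exists r1, r2, r3; split; last first.
  move=> x; have := congr1 (fun P => P.[x]) sE.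
  rewrite hornerD hornerN hornerC subr0 -/(F x) => ->.
  by rewrite !big_cons big_nil mulr1 !hornerM !hornerXsubC mulrA.
have orb0 n : (1 <= n)%N -> orbit0 3 c n != 0 by apply: (orb_neq0 d3 c2).
have F1 : F r1 = 0 by apply/eqP; rewrite -(fiber_mem sE) mem_head.
by apply: (fiber_uniq d3 orb0 (n := 1) (u := r1)); rewrite ?F1.
Qed.

(* The discriminant 108 c^2 (2 c^2 - 1) of the cubic is not a square because its 3-adic valuation is odd. *)
Theorem cubic_transposition : exists x y,
  [/\ Z 1 x, Z 1 y, F x = F y, x != y & swaps (Z 1) x y].
Proof.
have [r1 [r2 [r3 [ur FE3]]]] := cubic_roots.
have d3 : (3 <= 3)%N by [].
have FC x : F x = x ^+ 2 * (x - (3 * c)%:R) + (2 * c)%:R.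
  by rewrite FE //= [(c * 3)%N]mulnC [(c * 2)%N]mulnC.
pose C : algC := c%:R.
(* The values of the cubic at 0, 1 and -1 determine the elementary symmetric functions of its
   zeros. *)
have E0 := FE3 0; have E1 := FE3 1; have E2 := FE3 (-1).
rewrite !FC !natrM -/C in E0 E1 E2.
have e3 : r1 * r2 * r3 = - 2%:R * C.
  transitivity (- ((0 - r1) * (0 - r2) * (0 - r3))); first by ring.
  by rewrite -E0; ring.
have two0 : 2%:R != 0 :> algC by rewrite pnatr_eq0.
have e1 : r1 + r2 + r3 = 3%:R * C.
  apply: (mulfI two0).
  transitivity (- ((1 - r1) * (1 - r2) * (1 - r3)) - (-1 - r1) * (-1 - r2) * (-1 - r3)
    - 2%:R * (r1 * r2 * r3)); first by ring.
  by rewrite -E1 -E2 e3; ring.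
have e2 : r1 * r2 + r1 * r3 + r2 * r3 = 0.
  apply: (mulfI two0).
  transitivity ((1 - r1) * (1 - r2) * (1 - r3) - (-1 - r1) * (-1 - r2) * (-1 - r3) - 2%:R);
    first by ring.
  by rewrite -E1 -E2; ring.
pose del := (r1 - r2) * (r1 - r3) * (r2 - r3).
have delE : del ^+ 2 = (108 * c ^ 2 * (2 * c ^ 2 - 1))%N%:R.
  transitivity ((r1 + r2 + r3) ^+ 2 * (r1 * r2 + r1 * r3 + r2 * r3) ^+ 2
    - 4%:R * (r1 * r2 + r1 * r3 + r2 * r3) ^+ 3 - 4%:R * (r1 + r2 + r3) ^+ 3 * (r1 * r2 * r3)
    + 18%:R * (r1 + r2 + r3) * (r1 * r2 + r1 * r3 + r2 * r3) * (r1 * r2 * r3)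
    - 27%:R * (r1 * r2 * r3) ^+ 2); first by rewrite /del; ring.
  rewrite e1 e2 e3 !natrM natrB; last by rewrite muln_gt0 expn_gt0; clear -c2; lia.
  by rewrite natrM natrX -/C; ring.
have pr3 : prime 3 by [].
have [v Hv] := exists_padic_val pr3.
have npos : (0 < 108 * c ^ 2 * (2 * c ^ 2 - 1))%N.
  have c1 : (0 < c ^ 2)%N by rewrite expn_gt0; clear -c2; lia.
  by move: (c ^ 2)%N c1; clear => k k0; rewrite !muln_gt0; lia.
have oddl : odd (logn 3 (108 * c ^ 2 * (2 * c ^ 2 - 1))).
  (* The other factors contribute 3 + 2 v_3(c), as 108 is 4 times 27. *)
  have n3 : ~~ (3 %| 2 * c ^ 2 - 1)%N.
    rewrite (divn_eq c 3) /dvdn; have := ltn_pmod c (isT : 0 < 3)%N.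
    have : (0 < c %/ 3 \/ 0 < c %% 3)%N by clear -c2; lia.
    move: (c %/ 3)%N (c %% 3)%N => a [|[|[|]]] // a0 _; rewrite -/(dvdn 3 _).
    - have -> : (2 * (a * 3 + 0) ^ 2 - 1 = 3 * (6 * a ^ 2 - 1) + 2)%N by clear -a0; nia.
      by rewrite dvdn_addr ?dvdn_mulr.
    - have -> : (2 * (a * 3 + 1) ^ 2 - 1 = 3 * (6 * a ^ 2 + 4 * a) + 1)%N by clear; nia.
      by rewrite dvdn_addr ?dvdn_mulr.
    have -> : (2 * (a * 3 + 2) ^ 2 - 1 = 3 * (6 * a ^ 2 + 8 * a + 2) + 1)%N by clear; nia.
    by rewrite dvdn_addr ?dvdn_mulr.
  move: n3 npos (lognX 3 c 2); move: (c ^ 2)%N => k n3.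
  rewrite !muln_gt0 => /andP[/andP[_ p1] p2] L2.
  rewrite !lognM ?muln_gt0 ?p1 // L2 (lognE 3 (_ - 1)) (negPf n3) !andbF addn0.
  by rewrite oddD oddM.
have [nK vn] := val_nat Hv pr3 npos.
have del0 : del != 0 by move: nK; rewrite -delE expf_eq0.
have vdel : v del *+ 2 = (logn 3 (108 * c ^ 2 * (2 * c ^ 2 - 1)))%:R.
  by rewrite -vn -delE (valX Hv) // mulr_natl.
have [s sdel] : exists s : aut, s del != del.
  apply: contrapT => nos; have [a aE] : exists a, del = ratr a.
    by apply: fixed_rat => s; apply/eqP; apply: contra_notT nos => h; exists s.
  have a0 : a != 0 by apply: contraNneq del0 => a0; rewrite aE a0 rmorph0.
  have [m mE] := val_ratr Hv pr3 a0; move: vdel oddl; rewrite aE mE.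
  rewrite -[m%:~R *+ 2]mulr_natr -[2%:R]/(2%:~R) -intrM => E.
  have /(congr1 absz) : m * 2 = logn 3 (108 * c ^ 2 * (2 * c ^ 2 - 1)) by apply: (@intr_inj rat).
  by rewrite abszM absz_nat => <-; rewrite oddM andbF.
have Zr x : Z 1 x <-> x \in [:: r1; r2; r3].
  rewrite /zero_at /= FE3 !inE; split=> [/eqP|h]; first by rewrite !mulf_eq0 !subr_eq0 orbA.
  by apply/eqP; rewrite !mulf_eq0 !subr_eq0 -orbA.
have sr x : x \in [:: r1; r2; r3] -> s x \in [:: r1; r2; r3].
  by move=> /Zr Zx; apply/Zr/Z_aut.
have swap x y z : uniq [:: x; y; z] -> [:: x; y; z] =i [:: r1; r2; r3] ->
    s x = y -> s y = x -> s z = z ->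
    exists x y, [/\ Z 1 x, Z 1 y, F x = F y, x != y & swaps (Z 1) x y].
  move=> u eqs sx sy sz; have [Zx Zy] : Z 1 x /\ Z 1 y.
    by split; apply/Zr; rewrite -eqs !inE eqxx ?orbT.
  exists x, y; split=> //; first by rewrite (Zx : F x = 0) (Zy : F y = 0).
    by move: u; rewrite /= !inE negb_or => /andP[/andP[]].
  exists s; split=> // t /Zr; rewrite -eqs !inE => /or3P[] /eqP->; rewrite ?eqxx //.
have inj := fmorph_inj s; move: ur; rewrite /= !inE negb_or !andbT.
case/andP=> /andP[n12 n13] n23.
have sdE : s del = (s r1 - s r2) * (s r1 - s r3) * (s r2 - s r3).
  by rewrite !rmorphM !rmorphB.
have uniq3 x y z : x != y -> x != z -> y != z -> uniq [:: x; y; z].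
  by move=> /negPf xy /negPf xz /negPf yz; rewrite /= !inE xy xz yz.
have := sr r1; have := sr r2; have := sr r3; rewrite !inE !eqxx !orbT /=.
(* Of the 27 assignments, the noninjective ones are impossible, the even permutations fix [del], and
   the three transpositions remain. *)
move=> /(_ isT) /or3P[] /eqP A3 /(_ isT) /or3P[] /eqP A2 /(_ isT) /or3P[] /eqP A1;
  first [ by case/eqP: n12; apply: inj; rewrite A1 A2
        | by case/eqP: n13; apply: inj; rewrite A1 A3
        | by case/eqP: n23; apply: inj; rewrite A2 A3
        | by case/eqP: sdel; rewrite sdE A1 A2 A3 /del; ring
        | by apply: (swap r1 r2 r3) => //; apply: uniq3
        | by apply: (swap r1 r3 r2) => //; [apply: uniq3 => //; rewrite eq_sym
            | move=> t; rewrite !inE; case: (t == r1); case: (t == r2); case: (t == r3)]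
        | by apply: (swap r2 r3 r1) => //; [apply: uniq3 => //; rewrite eq_sym
            | move=> t; rewrite !inE; case: (t == r1); case: (t == r2); case: (t == r3)] ].
Qed.


End CubicFirstLevel.

(** * Assembling all levels; for c = 1 the number 1 is a zero of phi, so c >= 2 *)

Lemma in_Bd_gt1 d c : (3 <= d)%N -> in_Bd d c -> (2 <= c)%N.
Proof.
move=> d3 [c0 [irr _]]; case: c c0 irr => [|[|c]] // _ /(_ 1%N isT) irr.
have r1 : root (fQ d 1 1) 1.
  rewrite -(fmorph_root (@ratr algC)) root_fQ //= rmorph1 FE // expr1n !mul1r !mul1n.
  by rewrite -{1}(ltn_predK d3) -natr1; apply/eqP; ring.
have [/monic_neq0 nz szE] := @size_monic_iter_poly _ 1 (phi_dc d 1)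
  ltac:(by rewrite size_phi_dc // ltnS (leq_trans _ d3)) (monic_phi_dc 1 d3).
have /irr.2 : size ('X - 1%:P : {poly rat}) != 1%N by rewrite size_XsubC.
rewrite dvdp_XsubCl r1 => /(_ isT) /eqp_size; rewrite size_XsubC.
rewrite /fQ size_map_poly_id0 ?intr_eq0 ?lead_coef_eq0 // szE size_phi_dc // expn1 => - [dE].
by rewrite -dE in d3.
Qed.

Theorem theorem1p4 (R : realType) (Hvojta : vojta_conjecture R) (d : nat) :
  (3 <= d)%N ->
  (prime d \/ exists q : nat, [/\ prime q, (q %| d.-1)%N & coprime d.-1 (logn q d.-1)]) ->
  (forall c : nat, in_Bd d c -> finite_index_in_aut (phiC d c)) /\
  (exists N : nat, forall c : nat, in_Bd d c -> (N < c)%N ->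
     galois_image_full (phiC d c)).
Proof.
move=> d3 dP.
have transp c n : in_Bd d c -> (1 <= n)%N ->
    (exists x y, [/\ zero_at d c n x, zero_at d c n y, phi_fun d c x = phi_fun d c y, x != y & swaps (zero_at d c n) x y]) ->
    full_level d c n.
  move=> cB n1; have c2 := in_Bd_gt1 d3 cB; case: cB => _ [irr cop].
  apply: (transposition_full_level d3 irr) => // [m m1|]; first exact: orb_neq0.
  by case: dP; [left | right].
have full c n p : in_Bd d c -> (1 <= n)%N -> good_prime d c n p -> full_level d c n.
  move=> cB n1 [pp pd cl podd]; apply: transp => //; case: cB => _ [irr _].
  by have [v Hv] := exists_padic_val pp; apply: (good_prime_transposition d3 irr Hv pp).
have [n0 large_n] := good_prime_large_level Hvojta d3; split=> [c cB|].
  have c2 := in_Bd_gt1 d3 cB.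
  apply: (full_high_levels_finite_index d3 cB.2.1 (n0 := n0)) => m ltm.
  by have [p gp] := large_n c m c2 (ltnW ltm); apply: full gp => //; case: m ltm.
have level n : (1 <= n)%N -> exists N, forall c, in_Bd d c -> (N < c)%N -> full_level d c n.
  move=> n1; case: (leqP 4 (d ^ n)) => [dn|].
    have [N NP] := good_prime_large_c Hvojta d3 n1 dn; exists N => c cB ltc.
    by have [p] := NP c (in_Bd_gt1 d3 cB) ltc; apply: full.
  (* d^n < 4 leaves only d = 3 and n = 1. *)
  case: n n1 => [//|[_|n _]]; last first.
    have : (3 ^ 2 <= d ^ n.+2)%N.
      by apply: (@leq_trans (d ^ 2)); [rewrite leq_exp2r | rewrite leq_pexp2l // (leq_trans _ d3)].
    by move: (d ^ n.+2)%N => k; clear; lia.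
  rewrite expn1 => d4; have dE : d = 3%N by clear -d3 d4; lia.
  exists 0%N => c cB _; apply: transp => //; rewrite dE in cB *.
  exact: cubic_transposition (in_Bd_gt1 _ cB).
(* [n0] does not depend on c, so only finitely many levels ask for their own bound on c, and the
   maximum of these bounds serves. *)
have [N NP] : exists N, forall c m, in_Bd d c -> (N < c)%N -> (1 <= m < n0)%N -> full_level d c m.
  elim: n0 {large_n} => [|k [N NP]]; first by exists 0%N => c m _ _; rewrite ltn0 andbF.
  have [->|k0] := posnP k; first by exists 0%N => c [].
  have [M MP] := level k k0; exists (maxn N M) => c m cB; rewrite gtn_max ltnS => /andP[ltN ltM].
  by case/andP=> m1; rewrite leq_eqVlt => /predU1P[->|ltm]; [apply: MP | apply: NP; rewrite ?m1].
exists N => c cB ltc; apply: (full_levels_galois_full d3 cB.2.1) => m m1.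
case: (ltnP m n0) => mn; first by apply: NP; rewrite ?m1.
by have [p] := large_n c m (in_Bd_gt1 d3 cB) mn; apply: full.
Qed.
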